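(* Let $x,y$ be skew-Hermitian $n\times n$ complex matrices such that $\|e^{tx}e^{y}-1\|_\infty<\sqrt{2}$ for all $t\in[0,1]$. Let $\|\cdot\|_\phi$ be any unitarily invariant norm, and let $d_\phi$ be the induced metric in the unitary group $U_n(\mathbb C)$. Then the function $$t\mapsto d_\phi(1,e^{tx}e^{y})$$ is convex in $[0,1]$.
   Context: $U_n(\mathbb C)$ is the group of $n\times n$ unitary matrices, whose Lie algebra $\mathfrak u_n(\mathbb C)$ consists of the skew-Hermitian matrices. $\|\cdot\|_\infty$ is the spectral (operator) norm. A unitarily invariant norm is a norm on $M_n(\mathbb C)$ with $\|uav\|=\|a\|$ for all $a\in M_n(\mathbb C)$ and all unitary $u,v$; it is considered here restricted to $\mathfrak u_n(\mathbb C)$. The length of a piecewise smooth path $\gamma:[0,1]\to U_n(\mathbb C)$ is $L(\gamma)=\int_0^1\|\gamma(t)^{-1}\gamma'(t)\|_\phi\,dt$, and $d_\phi(u,v)$ is the infimum of the lengths of piecewise smooth paths in $U_n(\mathbb C)$ joining $u$ to $v$. *)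

(* Defs.v *)
From HB Require Import structures.
From mathcomp Require Import all_boot all_order all_algebra.
From mathcomp Require Import complex.
From mathcomp Require Import all_classical all_reals all_analysis.

Set Implicit Arguments.
Unset Strict Implicit.
Unset Printing Implicit Defensive.

Import Order.TTheory GRing.Theory Num.Theory.
Import numFieldNormedType.Exports.

Local Open Scope classical_set_scope.
Local Open Scope complex_scope.
Local Open Scope ring_scope.
Local Open Scope sesquilinear_scope.

(* [R[i]] carries its topology only through its [numFieldType] structure, hence
   the cast; it gives the entrywise topology on matrices. *)
Definition expmx (R : realType) (n : nat) (A : 'M[R[i]]_n) : 'M[R[i]]_n :=
  limn (series (fun k : nat =>
    (k`!%:R^-1 *: A ^+ k : 'M[(R[i] : numFieldType)]_n))).

Definition skew_hermitian (R : realType) (n : nat) (A : 'M[R[i]]_n) : Prop :=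
  A ^t* = - A.

Definition euclidean_norm (R : realType) (n : nat) (v : 'cV[R[i]]_n) : R :=
  Num.sqrt (\sum_(i < n) Normc.normc (v i 0) ^+ 2).

Definition spectral_norm (R : realType) (n : nat) (A : 'M[R[i]]_n) : R :=
  sup [set euclidean_norm (A *m v) |
       v in [set v : 'cV[R[i]]_n | euclidean_norm v <= 1]].

Record unitarily_invariant_norm (R : realType) (n : nat)
    (phi : 'M[R[i]]_n -> R) : Prop := UnitarilyInvariantNorm {
  uinorm_ge0 : forall A, 0 <= phi A;
  uinorm_eq0 : forall A, phi A = 0 -> A = 0;
  uinormZ : forall (c : R[i]) A, phi (c *: A) = Normc.normc c * phi A;
  uinormD : forall A B, phi (A + B) <= phi A + phi B;
  uinormU : forall U A V, U \is unitarymx -> V \is unitarymx ->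
    phi (U *m A *m V) = phi A
}.

(* [R[i]] is not a normed module over [R], so curves of complex matrices are
   differentiated through the real and imaginary parts of their entries. *)
Definition derive_mx (R : realType) (n : nat) (g : R -> 'M[R[i]]_n) (t : R) :
    'M[R[i]]_n :=
  \matrix_(i, j) (derive1 (fun s => complex.Re (g s i j)) t
                  +i* derive1 (fun s => complex.Im (g s i j)) t).

Definition smooth_mx (R : realType) (n : nat) (g : R -> 'M[R[i]]_n) : Prop :=
  forall (k : nat) (i j : 'I_n) (t : R),
    derivable (derive1n k (fun s => complex.Re (g s i j))) t 1 /\
    derivable (derive1n k (fun s => complex.Im (g s i j))) t 1.

(* Smoothness on a closed subinterval means being the restriction of a smooth
   curve defined on the whole line.  As consecutive closed subintervals share an
   endpoint, a piecewise smooth curve is continuous on [0, 1]. *)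
Definition piecewise_smooth_mx (R : realType) (n : nat)
    (gamma : R -> 'M[R[i]]_n) : Prop :=
  exists2 s : seq R, itv_partition 0 1 s &
    forall k : nat, (k < size s)%N ->
      exists2 g : R -> 'M[R[i]]_n, smooth_mx g &
        forall t : R, nth 0 (0 :: s) k <= t <= nth 0 (0 :: s) k.+1 ->
          gamma t = g t.

(* Only the values of [gamma] on [0, 1] matter. *)
Definition unitary_path (R : realType) (n : nat) (u v : 'M[R[i]]_n)
    (gamma : R -> 'M[R[i]]_n) : Prop :=
  [/\ piecewise_smooth_mx gamma,
      forall t : R, 0 <= t <= 1 -> gamma t \is unitarymx,
      gamma 0 = u
    & gamma 1 = v].

(* The arbitrary value of [derive_mx gamma] at the finitely many break points and
   at 0 and 1 does not affect the integral. *)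
Definition path_length (R : realType) (n : nat) (phi : 'M[R[i]]_n -> R)
    (gamma : R -> 'M[R[i]]_n) : R :=
  (\int[lebesgue_measure]_(t in `[0%R, 1%R])
     phi (invmx (gamma t) *m derive_mx gamma t))%R.

Definition unitary_dist (R : realType) (n : nat) (phi : 'M[R[i]]_n -> R)
    (u v : 'M[R[i]]_n) : R :=
  inf [set path_length phi gamma | gamma in unitary_path u v].

(* Main.v *)
(* Let [P] be an odd real polynomial with [|P' (sin a) * cos a| <= 1], and put
   [H v = phi (P ((v - v^-1) / 2i))].  If [D] is diagonal unitary and [E] is small,
   conjugating [D (1 + E)] by a suitable unitary removes to first order the part of
   [E] outside the eigenblocks of [D], and on the blocks the derivative of [P o sin]
   contracts.  Hence [H v <= H u + phi (u^-1 v - 1) + O(|v - u|^2)]; along a path [H]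
   increases by at most the length, and [H v <= d(1, v)].  Taking for [P] the partial
   sums of the arcsine series yields [d(1, exp K) = phi K] whenever the spectrum of
   [K] lies in (-i pi/2, i pi/2), which is what the spectral norm hypothesis says.

   To second order, [exp (i T) exp (s X)] with [T] diagonal is, up to conjugation and
   [O(s^3)], the exponential of [K_s = i T + s X0 + s^2 B], where [X0] is the block part
   of [X].  So [phi K_s + phi K_(-s) >= 2 phi (i T + s^2 diag B)] by pinching, and
   [diag B] pushes the eigenvalues apart with nonnegative symmetric weights: up to
   [O(s^4)] the diagonal [T] is a convex combination of permutations of
   [T - i s^2 diag B], whence [phi K_s + phi K_(-s) >= 2 phi (i T) - O(s^4)].  The
   distance thus has second differences at least [- O(s^3)], and a continuous function
   with this property is convex by the maximum principle. *)
Require Import Defs.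
From HB Require Import structures.
From mathcomp Require Import all_boot all_order all_algebra.
From mathcomp Require Import complex.
From mathcomp Require Import all_classical all_reals all_analysis.
From mathcomp Require Import measurable_realfun.
From mathcomp Require Import fingroup perm.
From mathcomp Require Import ring lra.

Import Order.TTheory GRing.Theory Num.Theory.
Import numFieldNormedType.Exports.

Local Open Scope classical_set_scope.
Local Open Scope complex_scope.
Local Open Scope ring_scope.
Local Open Scope sesquilinear_scope.

Set Implicit Arguments.
Unset Strict Implicit.
Unset Printing Implicit Defensive.

Import Normc.

Local Notation Re := complex.Re.
Local Notation Im := complex.Im.
(* [derive.derive_mx] of the analysis library shadows the definition of [Defs]. *)
Local Notation derive_mx := Defs.derive_mx.

(** * Norms of complex matrices *)

Section ComplexMatrixNorm.
Variable R : realType.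
Local Notation C := R[i].
Implicit Types (z w : C).

Lemma eq_ler (a b : R) : a = b -> a <= b.
Proof. by move=> ->. Qed.

Lemma conjC_conjc z : Num.conj z = conjc z.
Proof. by []. Qed.

Lemma normc_normr z : `|z| = (normc z)%:C.
Proof. by []. Qed.

Lemma normc_ge0 z : 0 <= normc z.
Proof. by rewrite -lecR -normc_normr normr_ge0. Qed.

Lemma normc_conj z : normc (Num.conj z) = normc z.
Proof. by apply: complexI; rewrite -!normc_normr norm_conjC. Qed.

Lemma normc_real (a : R) : normc a%:C = `|a|.
Proof. by rewrite /= expr0n addr0 sqrtr_sqr. Qed.

Lemma normc_sum (I : Type) (r : seq I) (P : pred I) (F : I -> C) :
  normc (\sum_(i <- r | P i) F i) <= \sum_(i <- r | P i) normc (F i).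
Proof.
elim/big_ind2: _ => [|x1 x2 y1 y2 h1 h2|//]; first by rewrite normc0.
by rewrite (le_trans (le_normcD _ _)) // lerD.
Qed.

Lemma Re_le_normc z : `|Re z| <= normc z.
Proof. by rewrite -lecR -normc_normr normc_ge_Re. Qed.

Lemma Im_le_normc z : `|Im z| <= normc z.
Proof. by case: z => a b; rewrite /= -sqrtr_sqr ler_wsqrtr // lerDr sqr_ge0. Qed.

Lemma normc_le_ReIm z : normc z <= `|Re z| + `|Im z|.
Proof.
rewrite {1}[z]complexE (le_trans (le_normcD _ _)) // normcM !normc_real lerD //.
by rewrite /= expr0n add0r expr1n sqrtr1 mul1r.
Qed.

Lemma complex_eq z w : Re z = Re w -> Im z = Im w -> z = w.
Proof. by case: z w => [a b] [c d] /= -> ->. Qed.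

Lemma ReD z w : Re (z + w) = Re z + Re w.
Proof. by case: z w => [a b] [c d]. Qed.

Lemma ImD z w : Im (z + w) = Im z + Im w.
Proof. by case: z w => [a b] [c d]. Qed.

Lemma ReM z w : Re (z * w) = Re z * Re w - Im z * Im w.
Proof. by case: z w => [a b] [c d]. Qed.

Lemma ImM z w : Im (z * w) = Re z * Im w + Im z * Re w.
Proof. by case: z w => [a b] [c d]. Qed.

Lemma conjCM z w : Num.conj (z * w) = Num.conj z * Num.conj w.
Proof. exact: rmorphM. Qed.

Lemma conjCB1 z : Num.conj (z - 1) = Num.conj z - 1.
Proof. by rewrite rmorphB rmorph1. Qed.

Lemma conjCV z : Num.conj z^-1 = (Num.conj z)^-1.
Proof. exact: fmorphV. Qed.

Lemma realcX (a : R) k : (a ^+ k)%:C = a%:C ^+ k.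
Proof. exact: (rmorphXn (real_complex R)). Qed.

Lemma realcM (a b : R) : (a * b)%:C = a%:C * b%:C.
Proof. exact: (rmorphM (real_complex R)). Qed.

Lemma realcD (a b : R) : (a + b)%:C = a%:C + b%:C.
Proof. exact: (rmorphD (real_complex R)). Qed.

Lemma realcN (a : R) : (- a)%:C = - a%:C.
Proof. exact: (rmorphN (real_complex R)). Qed.

Lemma realc_sum (I : Type) (r : seq I) (P : pred I) (F : I -> R) :
  (\sum_(j <- r | P j) F j)%:C = \sum_(j <- r | P j) (F j)%:C.
Proof. exact: (rmorph_sum (real_complex R)). Qed.

Lemma normc_eq1 (a b : R) : a ^+ 2 + b ^+ 2 = 1 -> normc (a +i* b) = 1.
Proof. by move=> /= ->; rewrite sqrtr1. Qed.

Definition mnorm m n (A : 'M[C]_(m, n)) : R := \sum_i \sum_j normc (A i j).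

Lemma mnorm_ge0 m n (A : 'M[C]_(m, n)) : 0 <= mnorm A.
Proof. by apply: sumr_ge0 => i _; apply: sumr_ge0 => j _; exact: normc_ge0. Qed.

Lemma normc_le_mnorm m n (A : 'M[C]_(m, n)) i j : normc (A i j) <= mnorm A.
Proof.
rewrite /mnorm (bigD1 i) //= (bigD1 j) //= -addrA lerDl addr_ge0 //.
  by apply: sumr_ge0 => k _; exact: normc_ge0.
by apply: sumr_ge0 => l _; apply: sumr_ge0 => k _; exact: normc_ge0.
Qed.

Lemma mnormD m n (A B : 'M[C]_(m, n)) : mnorm (A + B) <= mnorm A + mnorm B.
Proof.
rewrite /mnorm -big_split; apply: ler_sum => i _ /=.
by rewrite -big_split; apply: ler_sum => j _; rewrite mxE le_normcD.
Qed.

Lemma mnormZ m n c (A : 'M[C]_(m, n)) : mnorm (c *: A) = normc c * mnorm A.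
Proof.
rewrite /mnorm mulr_sumr; apply: eq_bigr => i _.
by rewrite mulr_sumr; apply: eq_bigr => j _; rewrite mxE normcM.
Qed.

Lemma mnorm0 m n : mnorm (0 : 'M[C]_(m, n)) = 0.
Proof. by rewrite -[0 in LHS](scale0r 0) mnormZ normc0 mul0r. Qed.

Lemma mnormN m n (A : 'M[C]_(m, n)) : mnorm (- A) = mnorm A.
Proof. by rewrite -scaleN1r mnormZ normcN normc1 mul1r. Qed.

Lemma mnormM m n p (A : 'M[C]_(m, n)) (B : 'M[C]_(n, p)) :
  mnorm (A *m B) <= mnorm A * mnorm B.
Proof.
apply: (@le_trans _ _ (\sum_i \sum_k \sum_j normc (A i j) * normc (B j k))).
  apply: ler_sum => i _; apply: ler_sum => k _; rewrite mxE.
  by rewrite (le_trans (normc_sum _ _ _)) // ler_sum // => j _; rewrite normcM.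
rewrite /mnorm mulr_suml; apply: ler_sum => i _.
rewrite exchange_big /= mulr_suml; apply: ler_sum => j _.
rewrite -mulr_sumr ler_wpM2l ?normc_ge0 // (bigD1 j) //= lerDl.
by apply: sumr_ge0 => l _; apply: sumr_ge0 => k _; exact: normc_ge0.
Qed.

Lemma mnorm_adj m n (A : 'M[C]_(m, n)) : mnorm (A ^t*) = mnorm A.
Proof.
rewrite /mnorm exchange_big; apply: eq_bigr => i _; apply: eq_bigr => j _.
by rewrite !mxE normc_conj.
Qed.

Lemma mnorm_entries m n (A : 'M[C]_(m, n)) (k : R) :
  (forall i j, normc (A i j) <= k) -> mnorm A <= (m * n)%:R * k.
Proof.
move=> Ak; apply: (@le_trans _ _ (\sum_(i < m) \sum_(j < n) k)).
  by apply: ler_sum => i _; apply: ler_sum => j _; exact: Ak.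
by rewrite !sumr_const !card_ord -mulrnA mulnC mulr_natl.
Qed.

Lemma adjM m n p (A : 'M[C]_(m, n)) (B : 'M[C]_(n, p)) :
  (A *m B) ^t* = B ^t* *m A ^t*.
Proof. by rewrite trmx_mul map_mxM. Qed.

Lemma adjD m n (A B : 'M[C]_(m, n)) : (A + B) ^t* = A ^t* + B ^t*.
Proof. by apply/matrixP => i j; rewrite !mxE rmorphD. Qed.

Lemma adjN m n (A : 'M[C]_(m, n)) : (- A) ^t* = - A ^t*.
Proof. by apply/matrixP => i j; rewrite !mxE rmorphN. Qed.

Lemma adjB m n (A B : 'M[C]_(m, n)) : (A - B) ^t* = A ^t* - B ^t*.
Proof. by rewrite adjD adjN. Qed.

Lemma adjZ m n c (A : 'M[C]_(m, n)) : (c *: A) ^t* = Num.conj c *: A ^t*.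
Proof. by apply/matrixP => i j; rewrite !mxE rmorphM. Qed.

Lemma adjZr m n (c : R) (A : 'M[C]_(m, n)) : (c%:C *: A) ^t* = c%:C *: A ^t*.
Proof. by rewrite adjZ conjC_conjc conjc_real. Qed.

Lemma adj1 n : (1%:M : 'M[C]_n) ^t* = 1%:M.
Proof. by rewrite trmx1 map_mx1. Qed.

Lemma adj_diag n (d : 'rV[C]_n) : (diag_mx d) ^t* = diag_mx (map_mx Num.conj d).
Proof. by rewrite tr_diag_mx map_diag_mx. Qed.

Lemma unitary_mulVmx n (U : 'M[C]_n) : U \is unitarymx -> U ^t* *m U = 1%:M.
Proof. by move=> uU; rewrite -invmx_unitary // mulVmx // unitarymx_unit. Qed.

Lemma unitary_mulmxV n (U : 'M[C]_n) : U \is unitarymx -> U *m U ^t* = 1%:M.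
Proof. by move/unitarymxP. Qed.

Lemma unitary_adj n (U : 'M[C]_n) : U \is unitarymx -> U ^t* \is unitarymx.
Proof. by rewrite trmxC_unitary. Qed.

Lemma unitary1 n : (1%:M : 'M[C]_n) \is unitarymx.
Proof. by apply/unitarymxP; rewrite adj1 mulmx1. Qed.

Lemma unitary_sum_sqr n (U : 'M[C]_n) i : U \is unitarymx ->
  \sum_j normc (U i j) ^+ 2 = 1.
Proof.
move=> /unitarymxP /matrixP /(_ i i); rewrite !mxE eqxx => h.
apply: complexI; rewrite rmorph_sum rmorph1 -[RHS]h; apply: eq_bigr => j _.
by rewrite !mxE -normCK normc_normr rmorphXn.
Qed.

Lemma unitary_entry n (U : 'M[C]_n) i j : U \is unitarymx -> normc (U i j) <= 1.
Proof.
move=> uU; have := unitary_sum_sqr i uU; rewrite (bigD1 j) //= => h.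
rewrite -(@expr_le1 R 2) ?normc_ge0 // -h lerDl sumr_ge0 // => k _.
exact: sqr_ge0.
Qed.

Lemma mnorm_unitary n (U : 'M[C]_n) : U \is unitarymx -> mnorm U <= (n * n)%:R.
Proof.
move=> uU; rewrite -[leRHS]mulr1; apply: mnorm_entries => i j.
exact: unitary_entry.
Qed.

Lemma mnorm_unitary_conj n (Q A : 'M[C]_n) : Q \is unitarymx ->
  mnorm (Q *m A *m Q ^t*) <= (n * n)%:R ^+ 2 * mnorm A.
Proof.
move=> /mnorm_unitary mQ; apply: le_trans (mnormM _ _) _; rewrite mnorm_adj.
have h : mnorm (Q *m A) <= (n * n)%:R * mnorm A.
  by apply: le_trans (mnormM _ _) _; exact: ler_wpM2r (mnorm_ge0 A) _ _ mQ.
apply: (@le_trans _ _ ((n * n)%:R * mnorm A * (n * n)%:R)).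
  by apply: ler_pM => //; exact: mnorm_ge0.
by rewrite expr2 mulrAC.
Qed.

Lemma unitary_diag n (d : 'rV[C]_n) :
  (forall i, normc (d 0 i) = 1) -> diag_mx d \is unitarymx.
Proof.
move=> d1; apply/unitarymxP; rewrite adj_diag mulmx_diag.
apply/matrixP => i j; rewrite !mxE -normCK normc_normr d1 rmorph1 expr1n.
by case: (i == j); rewrite ?mulr1n ?mulr0n.
Qed.

End ComplexMatrixNorm.

Section UnitarilyInvariantNorm.
Variables (R : realType) (n : nat) (phi : 'M[R[i]]_n -> R).
Hypothesis hphi : unitarily_invariant_norm phi.
Local Notation C := R[i].
Implicit Types (A B U V : 'M[C]_n).

Lemma uin0 : phi 0 = 0.
Proof. by rewrite -(scale0r 0) (uinormZ hphi) normc0 mul0r. Qed.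

Lemma uinZr (c : R) A : phi (c%:C *: A) = `|c| * phi A.
Proof. by rewrite (uinormZ hphi) normc_real. Qed.

Lemma uin_lip A B : phi A <= phi B + phi (A - B).
Proof. by rewrite -[A in phi A](subrK B) addrC (le_trans (uinormD hphi _ _)) // addrC. Qed.

Lemma uin_sum (I : Type) (r : seq I) (P : pred I) (F : I -> 'M[C]_n) :
  phi (\sum_(i <- r | P i) F i) <= \sum_(i <- r | P i) phi (F i).
Proof.
elim/big_ind2: _ => [|x1 x2 y1 y2 h1 h2|//]; first by rewrite uin0.
by rewrite (le_trans (uinormD hphi _ _)) // lerD.
Qed.

Definition uin_cst : R := \sum_i \sum_j phi (delta_mx i j).

Lemma uin_cst_ge0 : 0 <= uin_cst.
Proof. by do 2![apply: sumr_ge0 => ? _]; exact: uinorm_ge0. Qed.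

Lemma uin_le_mnorm A : phi A <= uin_cst * mnorm A.
Proof.
rewrite {1}(matrix_sum_delta A) /uin_cst mulr_suml.
apply: (le_trans (uin_sum _ _ _)); apply: ler_sum => i _.
apply: (le_trans (uin_sum _ _ _)); rewrite mulr_suml; apply: ler_sum => j _.
rewrite (uinormZ hphi) mulrC ler_wpM2l ?(uinorm_ge0 hphi) //.
exact: normc_le_mnorm.
Qed.

Lemma uin_conj U A : U \is unitarymx -> phi (U *m A *m U ^t*) = phi A.
Proof. by move=> uU; exact: (uinormU hphi _ uU (unitary_adj uU)). Qed.

Lemma uin_conjV U A : U \is unitarymx -> phi (U ^t* *m A *m U) = phi A.
Proof. by move=> uU; exact: (uinormU hphi _ (unitary_adj uU) uU). Qed.

Lemma uin_mull U A : U \is unitarymx -> phi (U *m A) = phi A.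
Proof.
by move=> uU; rewrite -[U *m A]mulmx1; exact: (uinormU hphi _ uU (unitary1 _ _)).
Qed.

Lemma uin_mean A B : phi ((2^-1)%:C *: (A + B)) <= 2^-1 * (phi A + phi B).
Proof.
rewrite uinZr ger0_norm ?invr_ge0 // ler_wpM2l ?invr_ge0 //.
exact: uinormD.
Qed.

Lemma half_halfC : (2^-1)%:C + (2^-1)%:C = 1 :> C.
Proof. by rewrite -rmorphD (_ : 2^-1 + 2^-1 = 1 :> R) //; lra. Qed.

Definition pinch (T : eqType) (c : 'I_n -> T) A : 'M[C]_n :=
  \matrix_(i, j) (if c i == c j then A i j else 0).

(* Conjugating by the diagonal sign matrix [U] flips the entries across the
   two classes of [p], and averaging with the original removes them. *)
Lemma uin_pinch_bool (p : 'I_n -> bool) A : phi (pinch p A) <= phi A.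
Proof.
pose U : 'M[C]_n := diag_mx (\row_j (-1) ^+ p j).
have uU : U \is unitarymx.
  apply: unitary_diag => i; rewrite mxE; case: (p i).
    by rewrite expr1 normcN normc1.
  by rewrite expr0 normc1.
have -> : pinch p A = (2^-1)%:C *: (A + U *m A *m U).
  apply/matrixP => i j; rewrite mxE [RHS]mxE [X in _ * X]mxE.
  rewrite mul_diag_mx mul_mx_diag !mxE.
  case: (p i) (p j) => [] [] /=; rewrite ?expr1 ?expr0 ?mulrN1 ?mulN1r ?mulr1
    ?mul1r ?opprK ?subrr ?mulr0 //.
    by rewrite mulrDr -mulrDl half_halfC mul1r.
  by rewrite mulrDr -mulrDl half_halfC mul1r.
apply: (le_trans (uin_mean _ _)); rewrite (uinormU hphi _ uU uU).
lra.
Qed.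

Lemma uin_pinch (T : eqType) (c : 'I_n -> T) A : phi (pinch c A) <= phi A.
Proof.
pose Q (s : seq 'I_n) : 'M[C]_n := \matrix_(i, j)
  (if all (fun k => (c i == c k) == (c j == c k)) s then A i j else 0).
have Qle s : phi (Q s) <= phi A.
  elim: s => [|k s IH].
    by rewrite (_ : Q [::] = A) //; apply/matrixP => i j; rewrite mxE.
  have -> : Q (k :: s) = pinch (fun i => c i == c k) (Q s).
    by apply/matrixP => i j; rewrite !mxE /=; case: (_ == _ :> bool).
  exact: (le_trans (uin_pinch_bool _ _) IH).
suff -> : pinch c A = Q (enum 'I_n) by exact: Qle.
apply/matrixP => i j; rewrite !mxE.
case: eqP => [->|cij]; first by rewrite (_ : all _ _ = true) //; apply/allP.
rewrite ifF //; apply/negP => /allP /(_ i); rewrite mem_enum eqxx => /(_ isT).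
by rewrite eq_sym => /eqP h; apply: cij; symmetry; apply/eqP; rewrite h.
Qed.

Lemma uin_contraction (r : 'I_n -> R) A : (forall j, `|r j| <= 1) ->
  phi (diag_mx (\row_j (r j)%:C) *m A) <= phi A.
Proof.
move=> r1; pose d := \row_j (r j +i* Num.sqrt (1 - r j ^+ 2)).
have uU : diag_mx d \is unitarymx.
  apply: unitary_diag => i; rewrite mxE; apply: normc_eq1.
  rewrite sqr_sqrtr ?subr_ge0; first by rewrite addrC subrK.
  by rewrite -(real_normK (num_real _)) expr_le1.
have -> : diag_mx (\row_j (r j)%:C) *m A =
    (2^-1)%:C *: (diag_mx d *m A + (diag_mx d) ^t* *m A).
  rewrite -mulmxDl scalemxAl; congr (_ *m _).
  apply/matrixP => i j; rewrite adj_diag !mxE; case: (i == j); last first.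
    by rewrite !mulr0n addr0 mulr0.
  rewrite !mulr1n conjC_conjc addcJ /= mulrA -[2]/(2%:R) mulr_natr mulr2n.
  by rewrite half_halfC mul1r.
move: (diag_mx d) uU => U uU; apply: (le_trans (uin_mean _ _)).
rewrite (uin_mull _ uU) (uin_mull _ (unitary_adj uU)).
lra.
Qed.

Lemma uin_diag_perm (s : {perm 'I_n}) (v : 'rV[C]_n) :
  phi (diag_mx (\row_j v 0 (s j))) = phi (diag_mx v).
Proof.
have up (t : {perm 'I_n}) : (perm_mx t : 'M[C]_n) \is unitarymx.
  apply/unitarymxP; rewrite tr_perm_mx map_perm_mx -perm_mxM mulgV.
  exact: perm_mx1.
rewrite -[RHS](uinormU hphi _ (up s) (up (s^-1)%g)) -row_permE -col_permE.
congr phi; apply/matrixP => i j; rewrite !mxE.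
by rewrite (inj_eq perm_inj).
Qed.

End UnitarilyInvariantNorm.

(** * Errors of first and second order *)

Section Congruence.
Variables (R : realType) (n : nat) (I : Type) (D : set I) (e : I -> R).
Local Notation C := R[i].
Implicit Types A B : I -> 'M[C]_n.

Definition bdd A := exists2 k : R, 0 <= k & forall i, D i -> mnorm (A i) <= k.

Definition eqO A B :=
  exists2 k : R, 0 <= k & forall i, D i -> mnorm (A i - B i) <= k * e i.

Lemma bdd_cst (M : 'M[C]_n) : bdd (fun=> M).
Proof. by exists (mnorm M) => //; exact: mnorm_ge0. Qed.

Lemma bddD A B : bdd A -> bdd B -> bdd (fun i => A i + B i).
Proof.
move=> [k k0 hk] [l l0 hl]; exists (k + l) => [|i Di]; first exact: addr_ge0.
by rewrite (le_trans (mnormD _ _)) // lerD ?hk ?hl.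
Qed.

Lemma bddN A : bdd A -> bdd (fun i => - A i).
Proof. by move=> [k k0 hk]; exists k => // i Di; rewrite mnormN hk. Qed.

Lemma bddM A B : bdd A -> bdd B -> bdd (fun i => A i *m B i).
Proof.
move=> [k k0 hk] [l l0 hl]; exists (k * l) => [|i Di]; first exact: mulr_ge0.
by rewrite (le_trans (mnormM _ _)) // ler_pM ?mnorm_ge0 ?hk ?hl.
Qed.

Lemma bddZ c A : bdd A -> bdd (fun i => c *: A i).
Proof.
move=> [k k0 hk]; exists (normc c * k) => [|i Di].
  by rewrite mulr_ge0 ?normc_ge0.
by rewrite mnormZ ler_wpM2l ?normc_ge0 ?hk.
Qed.

Lemma bdd_adj A : bdd A -> bdd (fun i => (A i) ^t*).
Proof. by move=> [k k0 hk]; exists k => // i Di; rewrite mnorm_adj hk. Qed.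

Lemma bdd_unitary A : (forall i, D i -> A i \is unitarymx) -> bdd A.
Proof.
move=> uA; exists (n * n)%:R => [|i Di]; first exact: ler0n.
exact: mnorm_unitary (uA i Di).
Qed.

Lemma eqO_refl A : eqO A A.
Proof. by exists 0 => // i Di; rewrite subrr mnorm0 mul0r. Qed.

Lemma eqO_eq A B : (forall i, D i -> A i = B i) -> eqO A B.
Proof. by move=> AB; exists 0 => // i Di; rewrite AB // subrr mnorm0 mul0r. Qed.

Lemma eqO_sym A B : eqO A B -> eqO B A.
Proof. by move=> [k k0 h]; exists k => // i Di; rewrite -mnormN opprB h. Qed.

Lemma eqO_trans B A G : eqO A B -> eqO B G -> eqO A G.
Proof.
move=> [k k0 hk] [l l0 hl]; exists (k + l) => [|i Di]; first exact: addr_ge0.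
rewrite -(subrK (B i) (A i)) -addrA (le_trans (mnormD _ _)) // mulrDl.
by rewrite lerD ?hk ?hl.
Qed.

Lemma eqOD A A' B B' : eqO A A' -> eqO B B' ->
  eqO (fun i => A i + B i) (fun i => A' i + B' i).
Proof.
move=> [k k0 hk] [l l0 hl]; exists (k + l) => [|i Di]; first exact: addr_ge0.
by rewrite opprD addrACA (le_trans (mnormD _ _)) // mulrDl lerD ?hk ?hl.
Qed.

Lemma eqON A A' : eqO A A' -> eqO (fun i => - A i) (fun i => - A' i).
Proof. by move=> [k k0 h]; exists k => // i Di; rewrite -opprD mnormN h. Qed.

Lemma eqOZ c A A' : eqO A A' -> eqO (fun i => c *: A i) (fun i => c *: A' i).
Proof.
move=> [k k0 h]; exists (normc c * k) => [|i Di].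
  by rewrite mulr_ge0 ?normc_ge0.
by rewrite -scalerBr mnormZ -mulrA ler_wpM2l ?normc_ge0 ?h.
Qed.

Lemma eqO_adj A A' : eqO A A' -> eqO (fun i => (A i) ^t*) (fun i => (A' i) ^t*).
Proof. by move=> [k k0 h]; exists k => // i Di; rewrite -adjB mnorm_adj h. Qed.

Lemma eqOM A A' B B' : bdd A -> bdd B' -> eqO A A' -> eqO B B' ->
  eqO (fun i => A i *m B i) (fun i => A' i *m B' i).
Proof.
move=> [a a0 ha] [b b0 hb] [k k0 hk] [l l0 hl]; exists (a * l + k * b) => [|i Di].
  by rewrite addr_ge0 // mulr_ge0.
have -> : A i *m B i - A' i *m B' i =
    A i *m (B i - B' i) + (A i - A' i) *m B' i.
  by rewrite mulmxBr mulmxBl addrA subrK.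
rewrite (le_trans (mnormD _ _)) // mulrDl lerD //.
  rewrite (le_trans (mnormM _ _)) // -mulrA ler_pM ?mnorm_ge0 ?ha //.
  exact: hl.
rewrite (le_trans (mnormM _ _)) // mulrAC ler_pM ?mnorm_ge0 ?hb //.
exact: hk.
Qed.

Lemma eqO_sum (J : Type) (r : seq J) (F G : J -> I -> 'M[C]_n) :
  (forall j, eqO (F j) (G j)) ->
  eqO (fun i => \sum_(j <- r) F j i) (fun i => \sum_(j <- r) G j i).
Proof.
move=> FG; elim: r => [|j r IH].
  by apply: eqO_eq => i _; rewrite !big_nil.
have h := eqOD (FG j) IH.
rewrite (_ : (fun i => \sum_(k <- j :: r) F k i) =
  (fun i => F j i + \sum_(k <- r) F k i)); last first.
  by apply/funext => i; rewrite big_cons.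
rewrite (_ : (fun i => \sum_(k <- j :: r) G k i) =
  (fun i => G j i + \sum_(k <- r) G k i)); last first.
  by apply/funext => i; rewrite big_cons.
exact: h.
Qed.

Lemma eqO_bdd A A' : (forall i, D i -> e i <= 1) -> eqO A A' -> bdd A -> bdd A'.
Proof.
move=> e1 [k k0 hk] [a a0 ha]; exists (k + a) => [|i Di]; first exact: addr_ge0.
rewrite -[A' i](subrK (A i)) (le_trans (mnormD _ _)) // lerD ?ha //.
by rewrite -mnormN opprB (le_trans (hk i Di)) // ler_piMr ?e1.
Qed.

Lemma eqO_uin (phi : 'M[C]_n -> R) A B : unitarily_invariant_norm phi ->
  eqO A B -> exists2 k : R, 0 <= k &
    forall i, D i -> phi (A i) <= phi (B i) + k * e i.
Proof.
move=> hphi [k k0 hk]; exists (uin_cst phi * k) => [|i Di].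
  by rewrite mulr_ge0 // uin_cst_ge0.
rewrite (le_trans (uin_lip hphi _ (B i))) // lerD2l.
rewrite (le_trans (uin_le_mnorm hphi _)) // -mulrA ler_wpM2l ?uin_cst_ge0 //.
exact: hk.
Qed.

End Congruence.

Section ProductOfSmall.
Variables (R : realType) (n : nat) (I : Type) (D : set I) (e e' : I -> R).
Local Notation C := R[i].
Implicit Types A B : I -> 'M[C]_n.

Lemma eqO_mul0 A B : eqO D e A (fun=> 0) -> eqO D e' B (fun=> 0) ->
  eqO D (fun i => e i * e' i) (fun i => A i *m B i) (fun=> 0).
Proof.
move=> [k k0 hk] [l l0 hl]; exists (k * l) => [|i Di]; first exact: mulr_ge0.
have := hk i Di; have := hl i Di; rewrite !subr0 => hB hA.
by rewrite (le_trans (mnormM _ _)) // mulrACA ler_pM ?mnorm_ge0.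
Qed.

End ProductOfSmall.

Section Jets.
Variables (R : realType) (n : nat).
Local Notation C := R[i].
Implicit Types (F G : R -> 'M[C]_n) (M N : 'M[C]_n).

Definition jet2 F M0 M1 M2 :=
  eqO [set d : R | `|d| <= 1] (fun d => `|d| ^+ 3) F
    (fun d => M0 + d%:C *: M1 + (d ^+ 2)%:C *: M2).

Lemma bdd_poly2 M0 M1 M2 :
  bdd [set d : R | `|d| <= 1] (fun d => M0 + d%:C *: M1 + (d ^+ 2)%:C *: M2).
Proof.
exists (mnorm M0 + mnorm M1 + mnorm M2) => [|d /= d1].
  by rewrite !addr_ge0 ?mnorm_ge0.
rewrite (le_trans (mnormD _ _)) // lerD //.
  rewrite (le_trans (mnormD _ _)) // lerD2l mnormZ normc_real ler_piMl //.
  exact: mnorm_ge0.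
by rewrite mnormZ normc_real ler_piMl ?mnorm_ge0 // normrX exprn_ile1.
Qed.

Lemma jet2_bdd F M0 M1 M2 : jet2 F M0 M1 M2 -> bdd [set d : R | `|d| <= 1] F.
Proof.
move/eqO_sym/eqO_bdd; apply; last exact: bdd_poly2.
by move=> d /= d1; rewrite exprn_ile1.
Qed.

Lemma jet2M F G M0 M1 M2 N0 N1 N2 : jet2 F M0 M1 M2 -> jet2 G N0 N1 N2 ->
  jet2 (fun d => F d *m G d) (M0 *m N0) (M0 *m N1 + M1 *m N0)
    (M0 *m N2 + M1 *m N1 + M2 *m N0).
Proof.
move=> hM hN; have := eqOM (jet2_bdd hM) (bdd_poly2 N0 N1 N2) hM hN.
move/eqO_trans; apply.
pose r := mnorm (M1 *m N2 + M2 *m N1) + mnorm (M2 *m N2).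
exists r => [|d /= d1]; first by rewrite addr_ge0 ?mnorm_ge0.
have -> : (M0 + d%:C *: M1 + (d ^+ 2)%:C *: M2) *m (N0 + d%:C *: N1 + (d ^+ 2)%:C *: N2) -
   (M0 *m N0 + d%:C *: (M0 *m N1 + M1 *m N0) +
    (d ^+ 2)%:C *: (M0 *m N2 + M1 *m N1 + M2 *m N0)) =
   (d ^+ 3)%:C *: (M1 *m N2 + M2 *m N1) + (d ^+ 4)%:C *: (M2 *m N2).
  rewrite !realcX; move: (d%:C) => c.
  rewrite !(mulmxDl, mulmxDr) -!(scalemxAl, scalemxAr).
  move: (M0 *m N0) (M0 *m N1) (M0 *m N2) (M1 *m N0) (M1 *m N1) (M1 *m N2).
  move: (M2 *m N0) (M2 *m N1) (M2 *m N2) => x1 x2 x3 x4 x5 x6 x7 x8 x9.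
  apply/matrixP => i j; rewrite !mxE.
  move: (x1 i j) (x2 i j) (x3 i j) (x4 i j) (x5 i j) (x6 i j) (x7 i j) (x8 i j).
  move: (x9 i j) => {x1 x2 x3 x4 x5 x6 x7 x8 x9}.
  by move=> x9 x1 x2 x3 x4 x5 x6 x7 x8; ring.
rewrite (le_trans (mnormD _ _)) // !mnormZ !normc_real !normrX mulrDl.
rewrite ![_ * `|d| ^+ 3]mulrC lerD // ler_wpM2r ?mnorm_ge0 //.
by rewrite ler_wiXn2l.
Qed.

Lemma jet2_eq F G M0 M1 M2 : jet2 F M0 M1 M2 ->
  (forall d, `|d| <= 1 -> F d = G d) -> jet2 G M0 M1 M2.
Proof.
by move=> h FG; apply: eqO_trans h; apply: eqO_eq => d d1; rewrite FG.
Qed.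

End Jets.

(** * Exponentials of skew-Hermitian matrices *)

Section UnitComplex.
Variable R : realType.
Local Notation C := R[i].
Implicit Types (t s : R) (f df : R -> R).

Lemma is_derive_continuous f df : (forall x : R, is_derive x 1 f (df x)) ->
  continuous f.
Proof.
move=> fdf x; apply/differentiable_continuous/derivable1_diffP.
exact: (@ex_derive _ _ _ _ _ _ _ (fdf x)).
Qed.

Lemma MVT_sym0 f df t : (forall x : R, is_derive x 1 f (df x)) ->
  exists2 c, `|c| <= `|t| & f t - f 0 = df c * t.
Proof.
move=> fdf; have cf := is_derive_continuous fdf.
have [t0|/ltW t0] := leP 0 t.
  have [|c] := @MVT_segment R f df 0 t t0 (fun x _ => fdf x).
    exact: continuous_subspaceT.
  rewrite in_itv /= subr0 => /andP[c0 ct] h; exists c => //.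
  by rewrite !ger0_norm.
have [|c] := @MVT_segment R f df t 0 t0 (fun x _ => fdf x).
  exact: continuous_subspaceT.
rewrite in_itv /= sub0r mulrN => /andP[c0 ct] h; exists c.
  by rewrite !ler0_norm // lerN2.
by rewrite -[LHS]opprB h opprK.
Qed.

Lemma derive_bound f df (k : R) m t : (forall x : R, is_derive x 1 f (df x)) ->
  0 <= k -> f 0 = 0 -> (forall x, `|df x| <= k * `|x| ^+ m) ->
  `|f t| <= k * `|t| ^+ m.+1.
Proof.
move=> fdf k0 f0 hdf; have [c ct] := MVT_sym0 t fdf; rewrite f0 subr0 => ->.
rewrite normrM exprSr mulrA ler_wpM2r // (le_trans (hdf c)) // ler_wpM2l //.
by rewrite lerXn2r ?nnegrE.
Qed.

Lemma norm_sin_le t : `|sin t| <= `|t|.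
Proof.
have d (x : R) : is_derive x 1 (@sin R) (cos x) by exact: is_derive_sin.
rewrite -[leRHS]mul1r; apply: (derive_bound (m := 0) t d) => // [|x].
  exact: sin0.
by rewrite expr0 mulr1 cos_max.
Qed.

Lemma norm_cosB1_le1 t : `|cos t - 1| <= `|t|.
Proof.
have d (x : R) : is_derive x 1 (fun x => cos x - 1) (- sin x).
  by apply: is_derive_eq; rewrite subr0.
rewrite -[leRHS]mul1r; apply: (derive_bound (m := 0) t d) => // [|x].
  by rewrite cos0 subrr.
by rewrite expr0 mulr1 normrN sin_max.
Qed.

Lemma norm_cosB1_le2 t : `|cos t - 1| <= `|t| ^+ 2.
Proof.
have d (x : R) : is_derive x 1 (fun x => cos x - 1) (- sin x).
  by apply: is_derive_eq; rewrite subr0.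
rewrite -[leRHS]mul1r; apply: (derive_bound (m := 1) t d) => // [|x].
  by rewrite cos0 subrr.
by rewrite expr1 mul1r normrN norm_sin_le.
Qed.

Lemma norm_sinB_le2 t : `|sin t - t| <= `|t| ^+ 2.
Proof.
have d (x : R) : is_derive x 1 (fun x => sin x - x) (cos x - 1).
  by apply: is_derive_eq.
rewrite -[leRHS]mul1r; apply: (derive_bound (m := 1) t d) => // [|x].
  by rewrite sin0 subrr.
by rewrite expr1 mul1r norm_cosB1_le1.
Qed.

Lemma norm_cosD_le3 t : `|cos t - 1 + t ^+ 2 / 2| <= `|t| ^+ 3.
Proof.
have d (x : R) : is_derive x 1 (fun x => cos x - 1 + x ^+ 2 / 2) (x - sin x).
  by apply: is_derive_eq; rewrite /GRing.scale /=; field.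
rewrite -[leRHS]mul1r; apply: (derive_bound (m := 2) t d) => // [|x].
  by rewrite cos0 subrr expr0n mul0r addr0.
by rewrite mul1r distrC norm_sinB_le2.
Qed.

Lemma norm_sinB_le3 t : `|sin t - t| <= `|t| ^+ 3.
Proof.
have d (x : R) : is_derive x 1 (fun x => sin x - x) (cos x - 1).
  by apply: is_derive_eq.
rewrite -[leRHS]mul1r; apply: (derive_bound (m := 2) t d) => // [|x].
  by rewrite sin0 subrr.
by rewrite mul1r norm_cosB1_le2.
Qed.

Definition cis t : C := cos t +i* sin t.

Lemma cis0 : cis 0 = 1.
Proof. by rewrite /cis cos0 sin0. Qed.

Lemma cisD s t : cis (s + t) = cis s * cis t.
Proof. by rewrite /cis cosD sinD; simpc; rewrite [_ * sin t + _]addrC. Qed.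

Lemma normc_cis t : normc (cis t) = 1.
Proof. by apply: normc_eq1; rewrite cos2Dsin2. Qed.

Lemma conj_cis t : Num.conj (cis t) = cis (- t).
Proof. by rewrite /cis cosN sinN. Qed.

Lemma cis_remainder1 t : normc (cis t - 1 - (0 +i* t)) <= 2 * `|t| ^+ 2.
Proof.
apply: le_trans (normc_le_ReIm _) _.
have -> : Re (cis t - 1 - (0 +i* t)) = cos t - 1 by rewrite /= subr0.
have -> : Im (cis t - 1 - (0 +i* t)) = sin t - t by rewrite /= subr0.
by rewrite mulrDl mul1r lerD // ?norm_cosB1_le2 ?norm_sinB_le2.
Qed.

Lemma cis_remainder2 t :
  normc (cis t - 1 - (0 +i* t) - (2^-1)%:C * (0 +i* t) ^+ 2) <= 2 * `|t| ^+ 3.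
Proof.
apply: le_trans (normc_le_ReIm _) _.
have -> : (2^-1)%:C * (0 +i* t) ^+ 2 = (- (t ^+ 2 / 2)) +i* 0.
  by rewrite expr2; apply: complex_eq => /=; field.
have -> : Re (cis t - 1 - (0 +i* t) - ((- (t ^+ 2 / 2)) +i* 0)) =
  cos t - 1 + t ^+ 2 / 2 by rewrite /= subr0 opprK.
have -> : Im (cis t - 1 - (0 +i* t) - ((- (t ^+ 2 / 2)) +i* 0)) = sin t - t.
  by rewrite /= !subr0.
by rewrite mulrDl mul1r lerD // ?norm_cosD_le3 ?norm_sinB_le3.
Qed.

Lemma exp_series_term t k :
  (k`!%:R^-1 * (0 +i* t) ^+ k : C) = cos_coeff t k +i* sin_coeff t k.
Proof.
have im j : ((0 +i* t) ^+ j.*2 : C) = ((-1) ^+ j * t ^+ j.*2)%:C.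
  elim: j => [|j IH]; first by rewrite !expr0 mulr1.
  by rewrite doubleS !exprS IH; apply: complex_eq => /=; ring.
have -> : (k`!%:R^-1 : C) = ((k`!%:R)^-1 : R)%:C.
  by rewrite fmorphV rmorph_nat.
have [j [->|->]] : exists j, k = j.*2 \/ k = j.*2.+1.
    exists k./2; rewrite -{1 3}(odd_double_half k).
    by case: (odd k); [right|left].
  rewrite im /cos_coeff /sin_coeff /= odd_double /= doubleK.
  apply: complex_eq => /=; rewrite -?exprnP; last by rewrite mulr0 !mul0r addr0.
  by rewrite mulr0 subr0 mul1r mulrC.
rewrite exprS im /cos_coeff /sin_coeff /= odd_double /= doubleK.
apply: complex_eq => /=; rewrite -?exprnP.
  by rewrite !(mul0r, mulr0, subr0, add0r, oppr0).
rewrite exprS; move: (_^-1 : R) ((-1) ^+ j : R) (t ^+ _) => a b c; ring.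
Qed.

End UnitComplex.

Section MatrixPowers.
Variables (K : comNzRingType) (n : nat).

Lemma expr_diag_mx (d : 'rV[K]_n) k :
  (diag_mx d) ^+ k = diag_mx (\row_j d 0 j ^+ k).
Proof.
elim: k => [|k IH].
  by rewrite expr0; apply/matrixP => i j; rewrite !mxE expr0.
rewrite exprS IH -[_ * _]/(_ *m _) mulmx_diag; congr diag_mx.
by apply/rowP => j; rewrite !mxE exprS.
Qed.

Lemma expr_conjmx (P Q D : 'M[K]_n) k : Q *m P = 1%:M -> P *m Q = 1%:M ->
  (P *m D *m Q) ^+ k = P *m D ^+ k *m Q.
Proof.
move=> QP PQ; elim: k => [|k IH]; first by rewrite !expr0 mulmx1 PQ.
rewrite !exprS IH -![_ * _]/(_ *m _) !mulmxA -[_ *m Q *m P]mulmxA.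
by rewrite QP mulmx1.
Qed.

Lemma conjmxB (P Q A B : 'M[K]_n) :
  P *m A *m Q - P *m B *m Q = P *m (A - B) *m Q.
Proof. by rewrite mulmxBr mulmxBl. Qed.

Lemma conjmxZ (P Q A : 'M[K]_n) c : c *: (P *m A *m Q) = P *m (c *: A) *m Q.
Proof. by rewrite -scalemxAr -scalemxAl. Qed.

Lemma conjmx_subl_sum (P Q D : 'M[K]_n) m (c : nat -> K) (F : nat -> 'M[K]_n) :
  P *m D *m Q - \sum_(0 <= l < m) c l *: (P *m F l *m Q) =
  P *m (D - \sum_(0 <= l < m) c l *: F l) *m Q.
Proof.
rewrite -conjmxB; congr (_ - _).
by rewrite mulmx_sumr mulmx_suml; apply: eq_bigr => l _; rewrite conjmxZ.
Qed.

End MatrixPowers.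

Section ExpSpectral.
Variables (R : realType) (n : nat).
Local Notation C := R[i].
Implicit Types (Q A B U : 'M[C]_n) (t : 'I_n -> R).

Lemma mx_norm_le_mnorm A :
  `|A : 'M[(C : numFieldType)]_n| <= (mnorm A)%:C.
Proof.
rewrite /Num.norm /=.
have [->|/mx_norm_neq0[[i j] ->]] := eqVneq (mx_norm (A : 'M[(C : numFieldType)]_n)) 0.
  by rewrite ler0c mnorm_ge0.
by rewrite normc_normr lecR; exact: normc_le_mnorm.
Qed.

(* The series of [expmx] is taken in the topology of the matrices over the
   [numFieldType] [R[i]], where the tested radii are positive complex numbers. *)
Lemma cvg_mx_mnorm (u : nat -> 'M[(C : numFieldType)]_n)
    (L : 'M[(C : numFieldType)]_n) :
  (fun k => mnorm (L - u k)) @ \oo --> (0 : R) -> u @ \oo --> L.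
Proof.
move=> /cvgrPdist_le h; apply/cvgrPdist_le => eps eps0.
have epsE : eps = (Re eps)%:C by rewrite RRe_real // gtr0_real.
have e0 : 0 < Re eps by rewrite -ltcR -epsE.
near=> k; have : mnorm (L - u k) <= Re eps.
  rewrite -[leLHS]ger0_norm ?mnorm_ge0 // -[leLHS]normrN -sub0r.
  by near: k; exact: h.
by rewrite -lecR -epsE; apply: le_trans; exact: mx_norm_le_mnorm.
Unshelve. all: by end_near. Qed.

Definition imdiag t : 'M[C]_n := diag_mx (\row_j (0 +i* t j)).
Definition cisdiag t : 'M[C]_n := diag_mx (\row_j cis (t j)).

Lemma unitary_cisdiag t : cisdiag t \is unitarymx.
Proof. by apply: unitary_diag => i; rewrite mxE normc_cis. Qed.

Lemma expr_conj_diag Q (d : 'rV[C]_n) k : Q \is unitarymx ->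
  (Q ^t* *m diag_mx d *m Q) ^+ k = Q ^t* *m diag_mx (\row_j d 0 j ^+ k) *m Q.
Proof.
move=> uQ; rewrite (expr_conjmx _ _ (unitary_mulmxV uQ) (unitary_mulVmx uQ)).
by rewrite expr_diag_mx.
Qed.

Lemma expmx_spectral Q t : Q \is unitarymx ->
  expmx (Q ^t* *m imdiag t *m Q) = Q ^t* *m cisdiag t *m Q.
Proof.
move=> uQ; rewrite /expmx.
apply: (@cvg_lim 'M[(C : numFieldType)]_n); first exact: norm_hausdorff.
apply: cvg_mx_mnorm.
pose r k j : C := cis (t j) - \sum_(0 <= l < k) l`!%:R^-1 * (0 +i* t j) ^+ l.
have part k : Q ^t* *m cisdiag t *m Q - series (fun k : nat =>
    k`!%:R^-1 *: (Q ^t* *m imdiag t *m Q) ^+ k) k =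
    Q ^t* *m diag_mx (\row_j r k j) *m Q.
  rewrite /series /=.
  under eq_bigr do rewrite (expr_conj_diag _ _ uQ).
  rewrite conjmx_subl_sum; apply: (congr1 (fun X => Q ^t* *m X *m Q)).
  apply/matrixP => i j; rewrite !mxE summxE.
  case: (eqVneq i j) => [->|ij]; last first.
    rewrite !mulr0n big1 ?subr0 // => l _.
    by rewrite !mxE (negPf ij) mulr0n mulr0.
  rewrite !mulr1n; congr (_ - _); apply: eq_bigr => l _.
  by rewrite !mxE eqxx mulr1n.
have rE k j : r k j = (cos (t j) - series (cos_coeff (t j)) k) +i*
    (sin (t j) - series (sin_coeff (t j)) k).
  rewrite /r; under eq_bigr do rewrite exp_series_term.
  have -> : \sum_(0 <= l < k) (cos_coeff (t j) l +i* sin_coeff (t j) l) =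
      series (cos_coeff (t j)) k +i* series (sin_coeff (t j)) k.
    rewrite /series /=; elim/big_ind3: _ => //= z1 z2 z3 w1 w2 w3 -> -> //.
  by [].
apply: (@squeeze_cvgr _ _ _ _ (fun=> 0) (fun k => mnorm (Q ^t*) *
  (\sum_j (`|cos (t j) - series (cos_coeff (t j)) k| +
  `|sin (t j) - series (sin_coeff (t j)) k|)) * mnorm Q)).
- near=> k; rewrite mnorm_ge0 part /=.
  apply: (le_trans (mnormM _ _)); rewrite ler_wpM2r ?mnorm_ge0 //.
  apply: (le_trans (mnormM _ _)); rewrite ler_wpM2l ?mnorm_ge0 //.
  apply: ler_sum => i _; rewrite (bigD1 i) //= big1 => [|j ji].
    rewrite addr0 !mxE eqxx mulr1n rE.
    exact: (le_trans (normc_le_ReIm _)).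
  by rewrite !mxE eq_sym (negPf ji) mulr0n normc0.
- exact: cvg_cst.
rewrite [X in _ --> X](_ : _ = mnorm (Q ^t*) * (\sum_(j < n) (0 + 0)) * mnorm Q);
  last by rewrite big1 ?mulr0 ?mul0r // => j _; rewrite addr0.
apply: cvgMr_tmp; apply: cvgMl_tmp.
apply: (@cvg_big R 'I_n +%R 0 predT (@add_continuous R) nat \oo _ (fun j k =>
  `|cos (t j) - series (cos_coeff (t j)) k| +
  `|sin (t j) - series (sin_coeff (t j)) k|) (fun=> 0 + 0)) => j _.
have d0 (a : R) (v : nat -> R) : v @ \oo --> a -> `|a - v k| @[k --> \oo] --> (0 : R).
  move=> va; rewrite -(normr0 R) -(subrr a); apply: cvg_norm.
  exact: (cvgB (cvg_cst a) va).
by apply: cvgD; apply: d0; rewrite unlock;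
  [exact: is_cvg_series_cos_coeff | exact: is_cvg_series_sin_coeff].
Unshelve. all: by end_near. Qed.

End ExpSpectral.

Local Opaque expmx.

Section SkewExponential.
Variables (R : realType) (n : nat).
Local Notation C := R[i].
Implicit Types (Q A B U : 'M[C]_n) (t : 'I_n -> R).

Lemma normal_spectral A : A \is normalmx ->
  exists2 Q : 'M[C]_n, Q \is unitarymx & exists d : 'rV[C]_n, A = Q ^t* *m diag_mx d *m Q.
Proof.
move=> /orthomx_spectralP hA; have uQ := spectral_unitarymx A.
exists (spectralmx A) => //; exists (spectral_diag A).
by rewrite {1}hA (invmx_unitary uQ).
Qed.

Lemma conj_unitary_diag Q A d : Q \is unitarymx -> A = Q ^t* *m diag_mx d *m Q ->
  diag_mx d = Q *m A *m Q ^t*.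
Proof.
move=> uQ ->; rewrite !mulmxA (unitary_mulmxV uQ) mul1mx -mulmxA.
by rewrite (unitary_mulmxV uQ) mulmx1.
Qed.

Lemma unitary_diag_norm1 Q U (d : 'rV[C]_n) : Q \is unitarymx -> U \is unitarymx ->
  U = Q ^t* *m diag_mx d *m Q -> forall j, normc (d 0 j) = 1.
Proof.
move=> uQ uU hd j.
have ud : diag_mx d \is unitarymx.
  rewrite (conj_unitary_diag uQ hd).
  exact: (mul_unitarymx (mul_unitarymx uQ uU) (unitary_adj uQ)).
have /unitarymxP := ud; rewrite adj_diag mulmx_diag => /matrixP /(_ j j).
rewrite !mxE eqxx -normCK normc_normr mulr1n -realcX => /complexI.
by move=> /eqP; rewrite sqrp_eq1 ?normc_ge0 // => /eqP.
Qed.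

Lemma unitary_spectral U : U \is unitarymx ->
  exists2 Q : 'M[C]_n, Q \is unitarymx & exists2 d : 'rV[C]_n, forall j, normc (d 0 j) = 1 &
    U = Q ^t* *m diag_mx d *m Q.
Proof.
move=> uU.
have [|Q uQ [d hd]] := normal_spectral (A := U).
  by apply/normalmxP; rewrite (unitary_mulmxV uU) (unitary_mulVmx uU).
by exists Q => //; exists d => //; exact: unitary_diag_norm1 hd.
Qed.

Lemma skew_spectral A : skew_hermitian A ->
  exists2 Q : 'M[C]_n, Q \is unitarymx & exists t : 'I_n -> R, A = Q ^t* *m imdiag t *m Q.
Proof.
rewrite /skew_hermitian => sA.
have [|Q uQ [d hd]] := normal_spectral (A := A).
  by apply/normalmxP; rewrite sA mulmxN mulNmx.
exists Q => //; exists (fun j => Im (d 0 j)); rewrite hd.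
apply: (congr1 (fun X => Q ^t* *m X *m Q)); congr diag_mx.
apply/rowP => j; rewrite mxE.
have /matrixP /(_ j j) : (diag_mx d) ^t* = - diag_mx d.
  rewrite (conj_unitary_diag uQ hd) !adjM trmxCK sA mulNmx mulmxN.
  by rewrite mulmxA.
rewrite adj_diag !mxE eqxx !mulr1n conjC_conjc; case: (d 0 j) => a b /= [].
by move=> /eqP; rewrite -addr_eq0 -mulr2n mulrn_eq0 /= => /eqP ->.
Qed.

Lemma skew_conj U A : skew_hermitian A -> skew_hermitian (U ^t* *m A *m U).
Proof.
rewrite /skew_hermitian => sA.
by rewrite !adjM trmxCK sA mulNmx mulmxN mulmxA.
Qed.

Lemma skewD A B : skew_hermitian A -> skew_hermitian B -> skew_hermitian (A + B).
Proof. by rewrite /skew_hermitian adjD => -> ->; rewrite opprD. Qed.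

Lemma skewZ (c : R) A : skew_hermitian A -> skew_hermitian (c%:C *: A).
Proof. by rewrite /skew_hermitian adjZr => ->; rewrite scalerN. Qed.

Lemma skewN A : skew_hermitian A -> skew_hermitian (- A).
Proof. by rewrite /skew_hermitian adjN => ->. Qed.

Lemma skew_imdiag t : skew_hermitian (imdiag t).
Proof.
rewrite /skew_hermitian /imdiag adj_diag; apply/matrixP => i j; rewrite !mxE.
by rewrite -mulNrn; congr (_ *+ _); apply: complex_eq => /=; rewrite ?oppr0.
Qed.

Lemma imdiagZ (s : R) t : s%:C *: imdiag t = imdiag (fun j => s * t j).
Proof.
apply/matrixP => i j; rewrite !mxE mulrnAr; congr (_ *+ _).
by apply: complex_eq => /=; ring.
Qed.

Lemma scale_spectral (s : R) Q t :
  s%:C *: (Q ^t* *m imdiag t *m Q) = Q ^t* *m imdiag (fun j => s * t j) *m Q.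
Proof. by rewrite -imdiagZ -scalemxAr -scalemxAl. Qed.

Lemma expmx_scale_spectral (s : R) Q t : Q \is unitarymx ->
  expmx (s%:C *: (Q ^t* *m imdiag t *m Q)) =
  Q ^t* *m cisdiag (fun j => s * t j) *m Q.
Proof. by move=> uQ; rewrite scale_spectral; exact: expmx_spectral. Qed.

Lemma conj_unitaryM Q A B : Q \is unitarymx ->
  (Q ^t* *m A *m Q) *m (Q ^t* *m B *m Q) = Q ^t* *m (A *m B) *m Q.
Proof.
by move=> uQ; rewrite !mulmxA -[_ *m Q *m Q ^t*]mulmxA (unitary_mulmxV uQ) mulmx1.
Qed.

Lemma cisdiagD t t' : cisdiag (fun j => t j + t' j) = cisdiag t *m cisdiag t'.
Proof.
rewrite mulmx_diag; congr diag_mx; apply/rowP => j.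
by rewrite !mxE cisD.
Qed.

Lemma expmx_unitary A : skew_hermitian A -> expmx A \is unitarymx.
Proof.
move=> /skew_spectral[Q uQ [t ->]]; rewrite (expmx_spectral t uQ).
exact: (mul_unitarymx (mul_unitarymx (unitary_adj uQ) (unitary_cisdiag t)) uQ).
Qed.

Lemma expmx_scaleD (s s' : R) A : skew_hermitian A ->
  expmx ((s + s')%:C *: A) = expmx (s%:C *: A) *m expmx (s'%:C *: A).
Proof.
move=> /skew_spectral[Q uQ [t ->]]; rewrite !(expmx_scale_spectral _ t uQ) (conj_unitaryM _ _ uQ) -cisdiagD.
apply: (congr1 (fun X => Q ^t* *m X *m Q)); congr diag_mx; apply/rowP => j.
by rewrite !mxE mulrDl.
Qed.

Lemma expmx_imdiag t : expmx (imdiag t) = cisdiag t.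
Proof.
have := expmx_spectral t (unitary1 R n).
by rewrite adj1 !mul1mx !mulmx1.
Qed.

Lemma expmx0 : expmx (0 : 'M[C]_n) = 1%:M.
Proof.
rewrite (_ : 0 = imdiag (fun=> 0)).
  rewrite expmx_imdiag; apply/matrixP => i j; rewrite !mxE.
  by rewrite cis0.
by apply/matrixP => i j; rewrite !mxE mul0rn.
Qed.

Lemma expmx_conj U A : U \is unitarymx -> skew_hermitian A ->
  expmx (U ^t* *m A *m U) = U ^t* *m expmx A *m U.
Proof.
move=> uU /skew_spectral[Q uQ [t ->]].
have uQU := mul_unitarymx uQ uU.
have -> : U ^t* *m (Q ^t* *m imdiag t *m Q) *m U =
    (Q *m U) ^t* *m imdiag t *m (Q *m U) by rewrite adjM !mulmxA.
rewrite (expmx_spectral t uQU) (expmx_spectral t uQ) adjM !mulmxA.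
by [].
Qed.

Lemma expmxN A : skew_hermitian A -> expmx (- A) = (expmx A) ^t*.
Proof.
move=> sA; have uA := expmx_unitary sA.
have : expmx (- A) *m expmx A = 1%:M.
  have := expmx_scaleD (-1) 1 sA.
  by rewrite addNr scale0r expmx0 realcN scaleN1r scale1r => <-.
move: (expmx A) (expmx (- A)) uA => V W uV /(congr1 (fun X => X *m V ^t*)).
by rewrite -mulmxA (unitary_mulmxV uV) mulmx1 mul1mx.
Qed.

Definition exp_cst : R := 2 * (n * n)%:R ^+ 10.

Lemma skew_eigenvalue_le Q t A : Q \is unitarymx -> A = Q ^t* *m imdiag t *m Q ->
  forall j, `|t j| <= (n * n)%:R ^+ 2 * mnorm A.
Proof.
move=> uQ hA j.
have -> : `|t j| = normc (imdiag t j j).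
  by rewrite !mxE eqxx mulr1n /= expr0n add0r sqrtr_sqr.
apply: (le_trans (normc_le_mnorm _ _ _)).
rewrite /imdiag (conj_unitary_diag uQ hA).
apply: (le_trans (mnormM _ _)); rewrite mnorm_adj.
have mQ := mnorm_unitary uQ.
rewrite expr2 -mulrA mulrC ler_pM ?mnorm_ge0 //.
rewrite (le_trans (mnormM _ _)) // ler_pM ?mnorm_ge0 //.
Qed.

Lemma spectral_remainder Q (d : 'rV[C]_n) t (k : nat) A : Q \is unitarymx ->
  A = Q ^t* *m imdiag t *m Q ->
  (forall j, normc (d 0 j) <= 2 * `|t j| ^+ k) -> (k <= 3)%N ->
  mnorm (Q ^t* *m diag_mx d *m Q) <= exp_cst * mnorm A ^+ k.
Proof.
move=> uQ hA hd k3; have mQ := mnorm_unitary uQ; set N := (n * n)%:R : R.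
have [n0|n0] := posnP n.
  rewrite {1}/mnorm big1 => [|i _].
    by rewrite mulr_ge0 ?exprn_ge0 ?mnorm_ge0 // mulr_ge0 // exprn_ge0.
  by have := ltn_ord i; rewrite {2}n0.
have N1 : 1 <= N by rewrite /N ler1n muln_gt0 n0.
have N0 : 0 <= N by exact: ler0n.
have md : mnorm (diag_mx d) <= N * (2 * (N ^+ 2 * mnorm A) ^+ k).
  apply: mnorm_entries => i j; rewrite mxE; case: eqVneq => [->|_]; last first.
    by rewrite mulr0n normc0 mulr_ge0 // exprn_ge0 // mulr_ge0 ?exprn_ge0 ?mnorm_ge0.
  rewrite mulr1n (le_trans (hd j)) // ler_wpM2l // lerXn2r ?nnegrE //.
    by rewrite mulr_ge0 ?exprn_ge0 ?mnorm_ge0.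
  exact: skew_eigenvalue_le uQ hA j.
have : mnorm (Q ^t* *m diag_mx d *m Q) <= N * (N * (2 * (N ^+ 2 * mnorm A) ^+ k)) * N.
  rewrite (le_trans (mnormM _ _)) // ler_pM ?mnorm_ge0 //.
  by rewrite (le_trans (mnormM _ _)) // ler_pM ?mnorm_ge0 // mnorm_adj.
move/le_trans; apply.
have -> : N * (N * (2 * (N ^+ 2 * mnorm A) ^+ k)) * N =
    2 * N ^+ (3 + 2 * k) * mnorm A ^+ k.
  by rewrite exprMn -exprM exprD; ring.
rewrite /exp_cst -/N ler_wpM2r ?exprn_ge0 ?mnorm_ge0 // ler_wpM2l //.
rewrite ler_weXn2l //.
by move: k3; case: k {hd md} => [|[|[|[|]]]].
Qed.

Lemma expmx_remainder1 A : skew_hermitian A ->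
  mnorm (expmx A - 1%:M - A) <= exp_cst * mnorm A ^+ 2.
Proof.
move=> /skew_spectral[Q uQ [t hA]].
have -> : expmx A - 1%:M - A =
    Q ^t* *m diag_mx (\row_j (cis (t j) - 1 - (0 +i* t j))) *m Q.
  have h1 : 1%:M = Q ^t* *m 1%:M *m Q by rewrite mulmx1 (unitary_mulVmx uQ).
  rewrite {1}hA (expmx_spectral t uQ) [X in _ - X - _]h1 [X in _ - X]hA.
  rewrite !conjmxB.
  apply: (congr1 (fun X => Q ^t* *m X *m Q)); apply/matrixP => i j; rewrite !mxE.
  by case: (i == j); rewrite ?mulr1n ?mulr0n ?subrr.
apply: spectral_remainder uQ hA _ _ => // j; rewrite mxE.
exact: cis_remainder1.
Qed.

Lemma expmx_remainder2 A : skew_hermitian A ->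
  mnorm (expmx A - 1%:M - A - (2^-1)%:C *: (A *m A)) <= exp_cst * mnorm A ^+ 3.
Proof.
move=> /skew_spectral[Q uQ [t hA]].
have -> : expmx A - 1%:M - A - (2^-1)%:C *: (A *m A) = Q ^t* *m diag_mx
    (\row_j (cis (t j) - 1 - (0 +i* t j) - (2^-1)%:C * (0 +i* t j) ^+ 2)) *m Q.
  have -> : A *m A = Q ^t* *m (imdiag t *m imdiag t) *m Q.
    by rewrite -(conj_unitaryM _ _ uQ) -hA.
  have h1 : 1%:M = Q ^t* *m 1%:M *m Q by rewrite mulmx1 (unitary_mulVmx uQ).
  rewrite {1}hA (expmx_spectral t uQ) [X in _ - X - _ - _]h1 [X in _ - X - _]hA.
  rewrite conjmxZ !conjmxB mulmx_diag.
  apply: (congr1 (fun X => Q ^t* *m X *m Q)); apply/matrixP => i j; rewrite !mxE.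
  by case: (i == j); rewrite ?mulr1n ?mulr0n ?mulr0 ?subrr // expr2.
apply: spectral_remainder uQ hA _ _ => // j; rewrite mxE.
exact: cis_remainder2.
Qed.

End SkewExponential.

Section MatrixDerivative.
Variables (R : realType).
Local Notation C := R[i].

Definition cder (f : R -> C) (t : R) (l : C) :=
  is_derive t 1 (fun s => Re (f s)) (Re l) /\
  is_derive t 1 (fun s => Im (f s)) (Im l).

Lemma cder_cst (c : C) t : cder (fun=> c) t 0.
Proof. by split; exact: is_derive_cst. Qed.

Lemma cderD f g t l k : cder f t l -> cder g t k ->
  cder (fun s => f s + g s) t (l + k).
Proof.
case=> fr fi [gr gi]; split.
  have -> : (fun s => Re (f s + g s)) = (fun s => Re (f s)) + (fun s => Re (g s)).
    by apply/funext => s; exact: ReD.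
  by apply: (is_derive_eq (is_deriveD fr gr)); rewrite ReD.
have -> : (fun s => Im (f s + g s)) = (fun s => Im (f s)) + (fun s => Im (g s)).
  by apply/funext => s; exact: ImD.
by apply: (is_derive_eq (is_deriveD fi gi)); rewrite ImD.
Qed.

Lemma cder_sum (I : Type) (r : seq I) (P : pred I) (f : I -> R -> C) t (l : I -> C) :
  (forall j, P j -> cder (f j) t (l j)) ->
  cder (fun s => \sum_(j <- r | P j) f j s) t (\sum_(j <- r | P j) l j).
Proof.
move=> h; elim: r => [|j r IH].
  rewrite big_nil (_ : (fun s => _) = fun=> 0); first exact: cder_cst.
  by apply/funext => s; rewrite big_nil.
rewrite big_cons (_ : (fun s => _) = fun s => if P j then
  f j s + \sum_(k <- r | P k) f k s else \sum_(k <- r | P k) f k s).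
  by case: ifP => // Pj; apply: cderD => //; exact: h.
by apply/funext => s; rewrite big_cons.
Qed.

Lemma cderM f g t l k : cder f t l -> cder g t k ->
  cder (fun s => f s * g s) t (l * g t + f t * k).
Proof.
case=> fr fi [gr gi]; split.
  have -> : (fun s => Re (f s * g s)) =
      (fun s => Re (f s)) * (fun s => Re (g s)) -
      (fun s => Im (f s)) * (fun s => Im (g s)).
    by apply/funext => s; exact: ReM.
  apply: (is_derive_eq (is_deriveB (is_deriveM fr gr) (is_deriveM fi gi))).
  by rewrite /GRing.scale /= ReD !ReM; ring.
have -> : (fun s => Im (f s * g s)) =
    (fun s => Re (f s)) * (fun s => Im (g s)) +
    (fun s => Im (f s)) * (fun s => Re (g s)).
  by apply/funext => s; exact: ImM.
apply: (is_derive_eq (is_deriveD (is_deriveM fr gi) (is_deriveM fi gr))).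
by rewrite /GRing.scale /= ImD !ImM; ring.
Qed.

Lemma cder_eq f t l k : cder f t l -> l = k -> cder f t k.
Proof. by move=> ? <-. Qed.

Lemma is_derive_scale (f : R -> R) (a t l : R) : is_derive (t * a) 1 f l ->
  is_derive t 1 (fun s => f (s * a)) (l * a).
Proof.
move=> fl; have df : derivable f (t * a) 1 by exact: ex_derive.
have da : is_derive t 1 (fun s : R => s * a) a.
  apply: (is_derive_eq (is_deriveM (is_derive_id t 1) (is_derive_cst a t 1))).
  by rewrite /GRing.scale /= mulr0 add0r mulr1.
have dg : derivable (fun s : R => s * a) t 1 by exact: (@ex_derive _ _ _ _ _ _ _ da).
apply: DeriveDef.
  move/derivable1_diffP : df; move/derivable1_diffP : dg => dg df.
  exact/derivable1_diffP/(@differentiable_comp _ _ _ _ (fun s : R => s * a) f).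
have h := @derive1_comp R (fun s : R => s * a) f t dg df.
move: h; rewrite !derive1E => ->; congr (_ * _); exact: derive_val.
Qed.

Lemma cder_cis (a t : R) : cder (fun s => cis (s * a)) t ((0 +i* a) * cis (t * a)).
Proof.
split; apply: is_derive_eq; try exact: is_derive_scale.
  by rewrite /=; ring.
by rewrite /=; ring.
Qed.

Definition mxder m n (g : R -> 'M[C]_(m, n)) (t : R) (L : 'M[C]_(m, n)) :=
  forall i j, cder (fun s => g s i j) t (L i j).

Lemma mxder_cst m n (A : 'M[C]_(m, n)) t : mxder (fun=> A) t 0.
Proof. by move=> i j; rewrite mxE; exact: cder_cst. Qed.

Lemma mxder_eq m n (g : R -> 'M[C]_(m, n)) t L K : mxder g t L -> L = K -> mxder g t K.
Proof. by move=> ? <-. Qed.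

Lemma mxderM m n p (g : R -> 'M[C]_(m, n)) (h : R -> 'M[C]_(n, p)) t G H :
  mxder g t G -> mxder h t H ->
  mxder (fun s => g s *m h s) t (G *m h t + g t *m H).
Proof.
move=> hg hh i j; rewrite !mxE -big_split /=.
rewrite (_ : (fun s => _) = fun s => \sum_k g s i k * h s k j).
  by apply: cder_sum => k _; apply: cderM; [exact: hg | exact: hh].
by apply/funext => s; rewrite mxE.
Qed.

Lemma mxder_mulr n (g : R -> 'M[C]_n) t G (B : 'M[C]_n) :
  mxder g t G -> mxder (fun s => g s *m B) t (G *m B).
Proof.
move=> hg; apply: (mxder_eq (mxderM hg (mxder_cst B t))).
by rewrite mulmx0 addr0.
Qed.

Lemma mxder_mull n (g : R -> 'M[C]_n) t G (B : 'M[C]_n) :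
  mxder g t G -> mxder (fun s => B *m g s) t (B *m G).
Proof.
move=> hg; apply: (mxder_eq (mxderM (mxder_cst B t) hg)).
by rewrite mul0mx add0r.
Qed.

Lemma mxder_derive_mx n (g : R -> 'M[C]_n) t L : mxder g t L -> derive_mx g t = L.
Proof.
move=> h; apply/matrixP => i j; rewrite mxE; have [hr hi] := h i j.
by apply: complex_eq => /=; rewrite derive1E derive_val.
Qed.

Lemma smooth_mxder n (g : R -> 'M[C]_n) t : smooth_mx g -> mxder g t (derive_mx g t).
Proof.
move=> sg i j; have [hr hi] := sg 0%N i j t; rewrite mxE; split.
  by apply: DeriveDef; [exact: hr | rewrite -derive1E].
by apply: DeriveDef; [exact: hi | rewrite -derive1E].
Qed.

Lemma mxder0_cst n (g : R -> 'M[C]_n) s t : (forall x, mxder g x 0) -> g s = g t.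
Proof.
move=> h; apply/matrixP => i j; apply: complex_eq.
  apply: (@is_derive_0_is_cst R (fun s => Re (g s i j))) => x.
  by have [+ _] := h x i j; rewrite mxE.
apply: (@is_derive_0_is_cst R (fun s => Im (g s i j))) => x.
by have [_] := h x i j; rewrite mxE.
Qed.

(* The functions [Re (\tr (M *m g s))] are closed under differentiation and
   contain the real and imaginary parts of the entries of [g]. *)
Lemma smooth_linear_ode n (g : R -> 'M[C]_n) (A : 'M[C]_n) :
  (forall t, mxder g t (A *m g t)) -> smooth_mx g.
Proof.
move=> hg.
have der (M : 'M[C]_n) (t : R) : is_derive t 1 (fun s => Re (\tr (M *m g s)))
    (Re (\tr (M *m A *m g t))).
  have : cder (fun s => \tr (M *m g s)) t (\tr (M *m A *m g t)).
    rewrite -mulmxA; apply: cder_sum => i _.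
    exact: (mxder_mull M (hg t)).
  by case.
have nth k M : exists N : 'M[C]_n, derive1n k (fun s => Re (\tr (M *m g s))) =
    fun s => Re (\tr (N *m g s)).
  elim: k => [|k [N IH]]; first by exists M.
  exists (N *m A); rewrite derive1nS IH; apply/funext => t.
  by rewrite derive1E derive_val.
have entry i j c s : c * g s i j = \tr ((c *: delta_mx j i) *m g s).
  rewrite -scalemxAl mxtraceZ; congr (_ * _).
  rewrite /mxtrace (bigD1 j) //= big1 => [|k kj].
    rewrite addr0 mxE (bigD1 i) //= big1 => [|l li].
      by rewrite mxE !eqxx mul1r addr0.
    by rewrite mxE (negPf li) andbF mul0r.
  by rewrite mxE big1 // => l _; rewrite mxE (negPf kj) mul0r.
move=> k i j t; split.
  have -> : (fun s => Re (g s i j)) =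
      fun s => Re (\tr ((1 *: delta_mx j i) *m g s)).
    by apply/funext => s; rewrite -entry mul1r.
  by have [N ->] := nth k (1 *: delta_mx j i); exact: ex_derive.
have -> : (fun s => Im (g s i j)) =
    fun s => Re (\tr (((0 +i* (-1)) *: delta_mx j i) *m g s)).
  by apply/funext => s; rewrite -entry; case: (g s i j) => a b /=; ring.
by have [N ->] := nth k ((0 +i* (-1)) *: delta_mx j i); exact: ex_derive.
Qed.

Lemma is_derive_near (f : R -> R) (t l e : R) : is_derive t 1 f l -> 0 < e ->
  \forall h \near 0, `|f (t + h) - f t - h * l| <= e * `|h|.
Proof.
move=> fl e0; have dl : 'D_1 f t = l by exact: derive_val.
have /derivable_nbhs/eqaddoP/(_ e e0) : derivable f t 1 by exact: ex_derive.
rewrite dl; apply: filterS => h.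
by rewrite !fctE /= /GRing.scale /= mulr1 [h + t]addrC opprD addrA.
Qed.

Lemma mxder_near n (g : R -> 'M[C]_n) t L e : mxder g t L -> 0 < e ->
  \forall h \near 0, mnorm (g (t + h) - g t - h%:C *: L) <= e * `|h|.
Proof.
move=> hg e0; pose e1 := e / (n * n).+1%:R / 2.
have e10 : 0 < e1 by rewrite !divr_gt0.
have near_ij i j : \forall h \near 0,
    normc ((g (t + h) - g t - h%:C *: L) i j) <= (e1 + e1) * `|h|.
  have [hr hi] := hg i j.
  near=> h; apply: (le_trans (normc_le_ReIm _)); rewrite mulrDl !mxE lerD //.
    have -> : Re (g (t + h) i j - g t i j - h%:C * L i j) =
        Re (g (t + h) i j) - Re (g t i j) - h * Re (L i j).
      by case: (g (t + h) i j) (g t i j) (L i j) => [? ?] [? ?] [? ?] /=; ring.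
    by near: h; exact: (is_derive_near hr e10).
  have -> : Im (g (t + h) i j - g t i j - h%:C * L i j) =
      Im (g (t + h) i j) - Im (g t i j) - h * Im (L i j).
    by case: (g (t + h) i j) (g t i j) (L i j) => [? ?] [? ?] [? ?] /=; ring.
  by near: h; exact: (is_derive_near hi e10).
have := filter_forall (nbhs_filter (0 : R))
  (fun i => filter_forall (nbhs_filter (0 : R)) (near_ij i)).
apply: filterS => h hh; apply: (le_trans (mnorm_entries hh)).
rewrite mulrA ler_wpM2r // /e1 -splitr mulrCA ler_piMr ?(ltW e0) //.
by rewrite ler_pdivrMr ?ltr0Sn // mul1r ler_nat.
Unshelve. all: by end_near. Qed.

Lemma mxder_continuous n (g : R -> 'M[C]_n) t L : mxder g t L ->
  mnorm (g s - g t) @[s --> t] --> (0 : R).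
Proof.
move=> hg; apply/cvgrPdist_le => e e0.
have k0 : 0 < 1 + mnorm L by rewrite ltr_pwDl ?mnorm_ge0.
have : \forall h \near 0, mnorm (g (t + h) - g t) <= e.
  have := mxder_near hg ltr01; apply: filter_app.
  near=> h; rewrite mul1r => hh.
  rewrite -[_ - _](subrK (h%:C *: L)) (le_trans (mnormD _ _)) //.
  rewrite mnormZ normc_real (@le_trans _ _ (`|h| * (1 + mnorm L))) //.
    by rewrite mulrDr mulr1 lerD.
  rewrite -ler_pdivlMr //; near: h.
  exact: (@nbhs0_le R R _ (divr_gt0 e0 k0)).
move=> /nbhs_normP[d /= d0 hd]; apply/nbhs_normP; exists d => //= s.
move=> sd; rewrite sub0r normrN ger0_norm ?mnorm_ge0 //.
have -> : s = t + (s - t) by rewrite addrC subrK.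
by apply: hd; rewrite /= sub0r normrN distrC.
Unshelve. all: by end_near. Qed.

Lemma mxder_expmx n (A : 'M[C]_n) (t : R) : skew_hermitian A ->
  mxder (fun s => expmx (s%:C *: A)) t (A *m expmx (t%:C *: A)).
Proof.
move=> /skew_spectral[Q uQ [a ->]].
have hd : mxder (fun s => cisdiag (fun j => s * a j)) t
    (imdiag a *m cisdiag (fun j => t * a j)).
  rewrite mulmx_diag => i j; rewrite !mxE.
  rewrite (_ : (fun s => _) = fun s => cis (s * a i) * (i == j)%:R); last first.
    by apply/funext => s; rewrite !mxE mulr_natr; case: eqVneq => [->|].
  have := cderM (cder_cis (a i) t) (cder_cst ((i == j)%:R) t).
  move/cder_eq; apply; rewrite mulr0 addr0 mulr_natr.
  by case: eqVneq => [->|]; rewrite ?mulr0n // !mxE.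
have := mxder_mulr Q (mxder_mull (Q ^t*) hd).
rewrite (_ : (fun s => expmx (s%:C *: (Q ^t* *m imdiag a *m Q))) =
  (fun s => Q ^t* *m cisdiag (fun j => s * a j) *m Q)); last first.
  by apply/funext => s; rewrite (expmx_scale_spectral _ a uQ).
move/mxder_eq; apply.
by rewrite (expmx_scale_spectral _ a uQ) (conj_unitaryM _ _ uQ).
Qed.

End MatrixDerivative.

(** * First-order perturbation of unitary matrices *)


Section Homological.
Variables (R : realType) (n : nat) (d : 'rV[R[i]]_n).
Local Notation C := R[i].
Local Notation D := (diag_mx d).
Hypothesis d1 : forall j, normc (d 0 j) = 1.
Implicit Types X B : 'M[C]_n.

Lemma conj_unit j : Num.conj (d 0 j) * d 0 j = 1.
Proof. by rewrite mulrC -normCK normc_normr d1 expr1n. Qed.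

Lemma conj_unit_neq j l : d 0 j != d 0 l -> Num.conj (d 0 j) * d 0 l - 1 != 0.
Proof.
apply: contraNneq => /eqP; rewrite subr_eq0 => /eqP h.
apply/eqP; rewrite -[LHS]mulr1 -h mulrA [d 0 j * _]mulrC.
by rewrite conj_unit mul1r.
Qed.

(* Conjugating [D (1 + X)] by [exp (solve X)] removes, to first order, the entries
   of [X] outside the blocks where [d] is constant. *)
Definition solve X : 'M[C]_n := \matrix_(j, l)
  (if d 0 j == d 0 l then 0 else X j l / (Num.conj (d 0 j) * d 0 l - 1)).

Lemma solve_eq X : D ^t* *m solve X *m D - solve X = X - pinch (d 0) X.
Proof.
rewrite adj_diag mul_diag_mx mul_mx_diag; apply/matrixP => j l; rewrite !mxE.
case: ifPn => h; first by rewrite mulr0 mul0r !subrr.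
rewrite subr0 mulrAC -{2}[X j l / _]mul1r -mulrBl mulrC mulfVK //.
exact: conj_unit_neq.
Qed.

Lemma solve_comm X : D *m solve X - solve X *m D = - (D *m (X - pinch (d 0) X)).
Proof.
have uD : D \is unitarymx by exact: unitary_diag.
rewrite -solve_eq mulmxBr !mulmxA (unitary_mulmxV uD) mul1mx opprB.
by [].
Qed.

Lemma skew_entry X j l : skew_hermitian X -> Num.conj (X l j) = - X j l.
Proof. by move/matrixP => /(_ j l); rewrite !mxE. Qed.

Lemma solve_skew X : skew_hermitian X -> skew_hermitian (solve X).
Proof.
move=> sX; apply/matrixP => j l; rewrite !mxE eq_sym.
case: ifPn => h; first by rewrite rmorph0 oppr0.
rewrite conjCM conjCV conjCB1 conjCM conjCK (skew_entry _ _ sX).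
by rewrite mulNr [Num.conj _ * _ in RHS]mulrC.
Qed.

Lemma pinch_skew X : skew_hermitian X -> skew_hermitian (pinch (d 0) X).
Proof.
move=> sX; apply/matrixP => j l; rewrite !mxE eq_sym.
by case: ifPn => h; rewrite ?rmorph0 ?oppr0 // (skew_entry _ _ sX).
Qed.

Definition solve_cst : R :=
  \sum_j \sum_l normc (Num.conj (d 0 j) * d 0 l - 1)^-1.

Lemma solve_cst_ge0 : 0 <= solve_cst.
Proof. by do 2![apply: sumr_ge0 => ? _]; exact: normc_ge0. Qed.

Lemma solve_le X : mnorm (solve X) <= solve_cst * mnorm X.
Proof.
rewrite /solve_cst mulr_suml; apply: ler_sum => j _.
rewrite mulr_suml; apply: ler_sum => l _; rewrite mxE.
case: ifP => _; first by rewrite normc0 mulr_ge0 ?normc_ge0 ?mnorm_ge0.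
by rewrite normcM mulrC ler_wpM2l ?normc_ge0 ?normc_le_mnorm.
Qed.

Lemma pinch_le X : mnorm (pinch (d 0) X) <= mnorm X.
Proof.
apply: ler_sum => j _; apply: ler_sum => l _; rewrite mxE.
by case: ifP => _ //; rewrite normc0 normc_ge0.
Qed.

End Homological.

Section PolynomialCalculus.
Variables (R : realType) (m : nat) (c : nat -> R) (e : nat -> nat).
Local Notation C := R[i].

Definition rpol (x : R) := \sum_(k < m) c k * x ^+ e k.
Definition rpol_der (x : R) := \sum_(k < m) c k * (e k)%:R * x ^+ (e k).-1.

Definition mpol n (S : 'M[C]_n) := \sum_(k < m) (c k)%:C *: S ^+ e k.
Definition mpol_der n (S : 'M[C]_n) :=
  \sum_(k < m) (c k * (e k)%:R)%:C *: S ^+ (e k).-1.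

Definition skewpart n (V : 'M[C]_n) : 'M[C]_n := (2^-1)%:C *: (V - V ^t*).

Definition himag n (V : 'M[C]_n) : 'M[C]_n := (0 +i* (- 2^-1)) *: (V - V ^t*).

Lemma mpol_diag n (x : 'I_n -> R) :
  mpol (diag_mx (\row_j (x j)%:C)) = diag_mx (\row_j (rpol (x j))%:C).
Proof.
apply/matrixP => i j; rewrite /mpol summxE !mxE.
under eq_bigr do rewrite expr_diag_mx !mxE.
case: eqVneq => [->|_]; last by rewrite mulr0n big1 // => k _; rewrite mulr0n mulr0.
rewrite mulr1n realc_sum; apply: eq_bigr => k _.
by rewrite mulr1n realcM realcX.
Qed.

Lemma mpol_der_diag n (x : 'I_n -> R) :
  mpol_der (diag_mx (\row_j (x j)%:C)) = diag_mx (\row_j (rpol_der (x j))%:C).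
Proof.
apply/matrixP => i j; rewrite /mpol_der summxE !mxE.
under eq_bigr do rewrite expr_diag_mx !mxE.
case: eqVneq => [->|_]; last by rewrite mulr0n big1 // => k _; rewrite mulr0n mulr0.
rewrite mulr1n realc_sum; apply: eq_bigr => k _.
by rewrite mulr1n [in RHS]realcM [in RHS]realcX.
Qed.

Lemma himag_conj n (W V : 'M[C]_n) :
  himag (W ^t* *m V *m W) = W ^t* *m himag V *m W.
Proof. by rewrite /himag !adjM trmxCK mulmxA conjmxB conjmxZ. Qed.

Lemma mpol_conj n (W S : 'M[C]_n) : W \is unitarymx ->
  mpol (W ^t* *m S *m W) = W ^t* *m mpol S *m W.
Proof.
move=> uW; rewrite /mpol mulmx_sumr mulmx_suml; apply: eq_bigr => k _.
rewrite (expr_conjmx _ _ (unitary_mulmxV uW) (unitary_mulVmx uW)).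
by rewrite conjmxZ.
Qed.

Section Perturbation.
Variables (n : nat) (I : Type) (D : set I) (e1 : I -> R).
Variables (A S1 : I -> 'M[C]_n) (S0 : 'M[C]_n).
Hypothesis comm : forall i, D i -> S0 *m S1 i = S1 i *m S0.
Hypothesis S1O : eqO D e1 S1 (fun=> 0).
Hypotheses (bA : bdd D A) (bS1 : bdd D S1).
Hypothesis AE : eqO D (fun i => e1 i * e1 i) A (fun i => S0 + S1 i).

Lemma eqO_exp k : bdd D (fun i => A i ^+ k) /\
  eqO D (fun i => e1 i * e1 i) (fun i => A i ^+ k)
    (fun i => S0 ^+ k + (k%:R%:C *: S0 ^+ k.-1) *m S1 i).
Proof.
elim: k => [|k [bk IH]].
  split; first exact: bdd_cst.
  by apply: eqO_eq => i _; rewrite !expr0 scale0r mul0mx addr0.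
have -> : (fun i => A i ^+ k.+1) = (fun i => A i *m A i ^+ k).
  by apply/funext => i; rewrite exprS.
split; first exact: (bddM bA bk).
have bS0 : bdd D (fun=> S0) by exact: bdd_cst.
have bk' : bdd D (fun i => S0 ^+ k + (k%:R%:C *: S0 ^+ k.-1) *m S1 i).
  apply: bddD; first exact: bdd_cst.
  by apply: bddM => //; exact: bdd_cst.
apply: (eqO_trans (eqOM bA bk' AE IH)).
have z : eqO D (fun i => e1 i * e1 i)
    (fun i => S1 i *m ((k%:R%:C *: S0 ^+ k.-1) *m S1 i)) (fun=> 0).
  apply: (@eqO_mul0 _ _ _ _ e1 e1) => //.
  have := eqOM (bdd_cst D (k%:R%:C *: S0 ^+ k.-1)) (bdd_cst D 0)
    (eqO_refl D e1 _) S1O.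
  by move/eqO_trans; apply; apply: eqO_eq => i _; rewrite mulmx0.
have := eqOD (eqO_refl D (fun i => e1 i * e1 i) (fun i =>
  S0 ^+ k.+1 + (k.+1%:R%:C *: S0 ^+ k) *m S1 i)) z.
move=> h; apply: (eqO_trans _ (eqO_trans h _)); last first.
  by apply: eqO_eq => i _; rewrite addr0.
apply: eqO_eq => i Di; rewrite mulmxDl !mulmxDr.
have -> : S0 *m S0 ^+ k = S0 ^+ k.+1 by rewrite exprS.
rewrite -!addrA; congr (_ + _); rewrite addrA; congr (_ + _).
have -> : S1 i *m S0 ^+ k = S0 ^+ k *m S1 i.
  elim: (k) => [|l IHl]; first by rewrite expr0 mulmx1 mul1mx.
  by rewrite exprSr -[_ * _]/(_ *m _) mulmxA IHl -!mulmxA comm.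
rewrite mulmxA -scalemxAr -[S0 *m _]/(S0 * _) -exprS.
case: k {bk IH bk' z h} => [|k].
  by rewrite scale0r mul0mx add0r scale1r.
have -> : k.+2%:R%:C = k.+1%:R%:C + 1 :> C by rewrite -natr1 realcD.
by rewrite -!scalemxAl scalerDl scale1r ?[_ *: _ + _]addrC.
Qed.

Lemma eqO_mpol : eqO D (fun i => e1 i * e1 i) (fun i => mpol (A i))
  (fun i => mpol S0 + mpol_der S0 *m S1 i).
Proof.
apply: (@eqO_trans _ _ _ _ _ (fun i => \sum_(k < m) (c k)%:C *:
    (S0 ^+ e k + ((e k)%:R%:C *: S0 ^+ (e k).-1) *m S1 i))).
  by apply: eqO_sum => k; apply: eqOZ; exact: (eqO_exp (e k)).2.
apply: eqO_eq => i _; rewrite /mpol /mpol_der mulmx_suml -big_split.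
apply: eq_bigr => k _ /=.
by rewrite scalerDr scalemxAl scalerA realcM.
Qed.
End Perturbation.

End PolynomialCalculus.

Section SmallProducts.
Variables (R : realType) (n : nat) (I : Type) (D : set I) (e : I -> R).
Local Notation C := R[i].
Implicit Types A B : I -> 'M[C]_n.

Lemma eqO_mulr0 A B : bdd D B -> eqO D e A (fun=> 0) ->
  eqO D e (fun i => A i *m B i) (fun=> 0).
Proof.
move=> [b b0 hb] [a a0 ha]; exists (a * b) => [|i Di]; first exact: mulr_ge0.
have := ha i Di; rewrite !subr0 => hA.
rewrite (le_trans (mnormM _ _)) // mulrAC ler_pM ?mnorm_ge0 //.
exact: hb.
Qed.

Lemma eqO_mull0 A B : bdd D B -> eqO D e A (fun=> 0) ->
  eqO D e (fun i => B i *m A i) (fun=> 0).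
Proof.
move=> [b b0 hb] [a a0 ha]; exists (b * a) => [|i Di]; first exact: mulr_ge0.
have := ha i Di; rewrite !subr0 => hA.
rewrite (le_trans (mnormM _ _)) // -mulrA ler_pM ?mnorm_ge0 //.
exact: hb.
Qed.

Lemma eqO_add0 A B : eqO D e A (fun=> 0) -> eqO D e B (fun=> 0) ->
  eqO D e (fun i => A i + B i) (fun=> 0).
Proof.
move=> hA hB; apply: (eqO_trans (eqOD hA hB)).
by apply: eqO_eq => i _; rewrite addr0.
Qed.

Lemma eqO_opp0 A : eqO D e A (fun=> 0) -> eqO D e (fun i => - A i) (fun=> 0).
Proof.
by move=> hA; apply: (eqO_trans (eqON hA)); apply: eqO_eq => i _; rewrite oppr0.
Qed.

End SmallProducts.

Section FirstOrder.
Variables (R : realType) (n : nat) (phi : 'M[R[i]]_n -> R).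
Hypothesis hphi : unitarily_invariant_norm phi.
Variables (m : nat) (c : nat -> R) (e : nat -> nat).
Hypothesis hP : forall s t : R, s ^+ 2 + t ^+ 2 = 1 -> `|rpol_der m c e s * t| <= 1.
Local Notation C := R[i].
Local Notation mpol := (mpol m c e).
Local Notation mpol_der := (mpol_der m c e).

Lemma skewpart_skew (E : 'M[C]_n) : skew_hermitian (skewpart E).
Proof. by rewrite /skew_hermitian /skewpart adjZr adjB trmxCK -scalerN opprB. Qed.

Lemma skewpart_le (E : 'M[C]_n) : mnorm (skewpart E) <= mnorm E.
Proof.
rewrite /skewpart mnormZ normc_real ger0_norm ?invr_ge0 // ler_pdivrMl //.
by rewrite (le_trans (mnormD _ _)) // mnormN mnorm_adj; lra.
Qed.

Lemma skewpart_unitary (E : 'M[C]_n) : 1%:M + E \is unitarymx ->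
  E - skewpart E = - ((2^-1)%:C *: (E *m E ^t*)).
Proof.
move=> /unitarymxP; rewrite adjD adj1 mulmxDl !mulmxDr !mul1mx !mulmx1 => h.
have {h} : E ^t* + E = - (E *m E ^t*).
  apply/eqP; rewrite -subr_eq0 opprK; apply/eqP/(addrI (1%:M : 'M[C]_n)).
  by rewrite addr0 -[RHS]h !addrA.
move=> h; transitivity ((2^-1)%:C *: (E ^t* + E)); last by rewrite h scalerN.
rewrite /skewpart; have {1}-> : E = (2^-1)%:C *: (E + E) by rewrite scalerDr -scalerDl half_halfC scale1r.
by rewrite -scalerBr; congr (_ *: _); rewrite opprB addrACA subrr addr0 addrC.
Qed.

Lemma himag_diag (d : 'rV[C]_n) :
  himag (diag_mx d) = diag_mx (\row_j (Im (d 0 j))%:C).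
Proof.
rewrite /himag adj_diag; apply/matrixP => i j; rewrite !mxE.
case: (i == j); last by rewrite !mulr0n subr0 mulr0.
rewrite !mulr1n conjC_conjc; case: (d 0 i) => a b.
by apply: complex_eq => /=; field.
Qed.

Lemma himag_block (d : 'rV[C]_n) (X : 'M[C]_n) : (forall j, normc (d 0 j) = 1) ->
  skew_hermitian X -> himag (diag_mx d *m pinch (d 0) X) =
  (0 +i* (-1)) *: (diag_mx (\row_j (Re (d 0 j))%:C) *m pinch (d 0) X).
Proof.
move=> d1 sX; have sP := pinch_skew d sX.
rewrite /himag adjM sP mulNmx opprK adj_diag mul_mx_diag !mul_diag_mx.
apply/matrixP => i j; rewrite !mxE; case: eqP => [<-|_]; last first.
  by rewrite !(mulr0, mul0r) addr0 mulr0.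
rewrite conjC_conjc; case: (d 0 i) (X i j) => [a b] [a' b'].
by apply: complex_eq => /=; field.
Qed.

Lemma himagD (V V' : 'M[C]_n) : himag (V + V') = himag V + himag V'.
Proof. by rewrite /himag adjD opprD addrACA scalerDr. Qed.

Lemma sqr_scale_le (k N x y : R) : 0 <= k -> 0 <= x -> x <= N * y ->
  k * x ^+ 2 <= k * N ^+ 2 * y ^+ 2.
Proof.
move=> k0 x0 xy; rewrite -mulrA ler_wpM2l // -exprMn lerXn2r ?nnegrE //.
exact: le_trans x0 xy.
Qed.

Lemma uin_mpol_conj (V U : 'M[C]_n) : U \is unitarymx ->
  phi (mpol (himag (U ^t* *m V *m U))) = phi (mpol (himag V)).
Proof.
by move=> uU; rewrite himag_conj (mpol_conj _ _ _ _ uU) (uin_conjV hphi _ uU).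
Qed.

Lemma uin_mpol_conjV (V U : 'M[C]_n) : U \is unitarymx ->
  phi (mpol (himag (U *m V *m U ^t*))) = phi (mpol (himag V)).
Proof.
move=> uU; have h := uin_mpol_conj (U *m V *m U ^t*) uU.
have E : U ^t* *m (U *m V *m U ^t*) *m U = V.
  by rewrite !mulmxA (unitary_mulVmx uU) mul1mx -mulmxA (unitary_mulVmx uU) mulmx1.
exact: (etrans (esym h) (congr1 (fun X => phi (mpol (himag X))) E)).
Qed.

Section Diagonal.
Variable d : 'rV[C]_n.
Hypothesis d1 : forall j, normc (d 0 j) = 1.
Local Notation D := (diag_mx d).
Let Dom := [set E : 'M[C]_n | 1%:M + E \is unitarymx].
Let e1 := @mnorm R n n.
Let e2 := fun E : 'M[C]_n => mnorm E * mnorm E.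
Let B E := solve d (skewpart E).
Let W E := expmx (B E).
Let E0 (E : 'M[C]_n) : 'M[C]_n := pinch (d 0) (skewpart E).

Let skewpartO : eqO Dom e1 (@skewpart R n) (fun=> 0).
Proof. by exists 1 => // E _; rewrite subr0 mul1r skewpart_le. Qed.

Let skewpartE : eqO Dom e2 id (@skewpart R n).
Proof.
exists 2^-1 => [|E uE]; first by rewrite invr_ge0.
rewrite (skewpart_unitary uE) mnormN mnormZ normc_real ger0_norm ?invr_ge0 //.
rewrite ler_wpM2l ?invr_ge0 // (le_trans (mnormM _ _)) // mnorm_adj.
by [].
Qed.

Let BO : eqO Dom e1 B (fun=> 0).
Proof.
exists (solve_cst d) => [|E _]; first exact: solve_cst_ge0.
rewrite subr0 (le_trans (solve_le _ _)) // ler_wpM2l ?solve_cst_ge0 //.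
exact: skewpart_le.
Qed.

Let sB E : skew_hermitian (B E).
Proof. exact: (solve_skew d (skewpart_skew E)). Qed.

Let bE : bdd Dom (fun E => E).
Proof.
have h : bdd Dom (fun E => (1%:M + E) - 1%:M).
  apply: bddD; last exact: bdd_cst.
  by apply: bdd_unitary => E.
case: h => k k0 hk; exists k => // E DE.
by have := hk E DE; rewrite addrAC subrr add0r.
Qed.

Let bS : bdd Dom (@skewpart R n).
Proof.
have [k k0 hk] := bE; exists k => // E DE.
by rewrite (le_trans (skewpart_le E)) ?hk.
Qed.

Let bB : bdd Dom B.
Proof.
have [k k0 hk] := BO; have [l l0 hl] := bE; exists (k * l) => [|E DE].
  by rewrite mulr_ge0.
have := hk E DE; rewrite subr0 => h; rewrite (le_trans h) // ler_wpM2l //.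
exact: hl.
Qed.

Let WE : eqO Dom e2 W (fun E => 1%:M + B E).
Proof.
have [k k0 hk] := BO; exists (exp_cst R n * k ^+ 2) => [|E DE].
  by rewrite mulr_ge0 ?exprn_ge0 // /exp_cst mulr_ge0 ?exprn_ge0.
rewrite opprD addrA (le_trans (expmx_remainder1 (sB E))) // -mulrA ler_wpM2l //.
  by rewrite /exp_cst mulr_ge0 ?exprn_ge0.
rewrite /e2 -expr2 -exprMn lerXn2r ?nnegrE ?mnorm_ge0 ?mulr_ge0 ?mnorm_ge0 //.
by have := hk E DE; rewrite subr0.
Qed.

Let uW E : W E \is unitarymx.
Proof. exact: expmx_unitary (sB E). Qed.

Let WVW : eqO Dom e2 (fun E => (W E) ^t* *m (D *m (1%:M + E)) *m W E)
  (fun E => D + D *m E0 E).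
Proof.
have bW : bdd Dom W by apply: bdd_unitary => E _; exact: uW.
have bD : bdd Dom (fun=> D) by exact: bdd_cst.
have b1 : bdd Dom (fun=> 1%:M : 'M[C]_n) by exact: bdd_cst.
have WsE : eqO Dom e2 (fun E => (W E) ^t*) (fun E => 1%:M - B E).
  apply: (eqO_trans (eqO_adj WE)); apply: eqO_eq => E _.
  by rewrite adjD adj1 (sB E).
have VE : eqO Dom e2 (fun E => D *m (1%:M + E)) (fun E => D *m (1%:M + skewpart E)).
  apply: (eqOM bD (bddD b1 bS) (eqO_refl _ _ _)).
  exact: (eqOD (eqO_refl _ _ _) skewpartE).
have bV' := bddM bD (bddD b1 bS); have bV := bddM bD (bddD b1 bE).
have h1 := eqOM (bdd_adj bW) bV' WsE VE.
have h2 := eqOM (bddM (bdd_adj bW) bV) (bddD b1 bB) h1 WE.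
have z1 : eqO Dom e2 (fun E => B E *m D *m skewpart E) (fun=> 0).
  exact: (eqO_mul0 (eqO_mulr0 bD BO) skewpartO).
have z2 : eqO Dom e2 (fun E => D *m skewpart E *m B E) (fun=> 0).
  exact: (eqO_mul0 (eqO_mull0 bD skewpartO) BO).
have z3 : eqO Dom e2 (fun E => B E *m D *m B E) (fun=> 0).
  exact: (eqO_mul0 (eqO_mulr0 bD BO) BO).
have z4 : eqO Dom e2 (fun E => B E *m D *m skewpart E *m B E) (fun=> 0).
  exact: (eqO_mulr0 bB z1).
have z := eqO_add0 (eqO_add0 (eqO_add0 (eqO_opp0 z1) z2) (eqO_opp0 z3)) (eqO_opp0 z4).
have h3 := eqOD (eqO_refl Dom e2 (fun E => D + D *m E0 E)) z.
apply: (eqO_trans h2); apply: (eqO_trans (eqO_trans _ h3)); last first.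
  by apply: eqO_eq => E _; rewrite addr0.
apply: eqO_eq => E _.
have hc := solve_comm d1 (skewpart E); rewrite -/(B E) -/(E0 E) in hc.
rewrite mulmxBr opprB in hc.
have hc' : D *m E0 E = D *m B E - B E *m D + D *m skewpart E.
  by rewrite hc subrK.
rewrite hc' !(mulmxDl, mulmxDr, mulNmx, mul1mx, mulmx1) !mulmxA.
move: (B E *m D *m skewpart E *m B E) (B E *m D *m B E) (D *m skewpart E *m B E).
move: (B E *m D *m skewpart E) (D *m B E) (B E *m D) (D *m skewpart E) D.
move=> x1 x2 x3 x4 x5 x6 x7 x8; apply/matrixP => i j; rewrite !mxE; ring.
Qed.

Let pinchO : eqO Dom e1 E0 (fun=> 0).
Proof.
exists 1 => // E _; rewrite subr0 mul1r.
exact: le_trans (pinch_le _ _) (skewpart_le E).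
Qed.

Lemma local_estimate_diag : exists2 k : R, 0 <= k & forall E : 'M[C]_n,
  1%:M + E \is unitarymx ->
  phi (mpol (himag (D *m (1%:M + E)))) <=
  phi (mpol (himag D)) + phi E + k * mnorm E ^+ 2.
Proof.
pose S0 := himag D; pose S1 E := himag (D *m E0 E).
have uD : D \is unitarymx by exact: unitary_diag.
pose A E := himag ((W E) ^t* *m (D *m (1%:M + E)) *m W E).
have himagO (F G : 'M[C]_n -> 'M[C]_n) e' : eqO Dom e' F G ->
    eqO Dom e' (fun E => himag (F E)) (fun E => himag (G E)).
  move=> FG; apply: eqOZ; apply: (eqOD FG); apply: eqON; exact: eqO_adj.
have AE : eqO Dom e2 A (fun E => S0 + S1 E).
  by apply: (eqO_trans (himagO _ _ _ WVW)); apply: eqO_eq => E _; rewrite himagD.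
have S1O : eqO Dom e1 S1 (fun=> 0).
  have h := himagO _ _ _ (eqO_mull0 (bdd_cst Dom D) pinchO).
  apply: (eqO_trans h); apply: eqO_eq => E _.
  by rewrite /himag trmx0 map_mx0 subrr scaler0.
have bA : bdd Dom A.
  have bU : bdd Dom (fun E => (W E) ^t* *m (D *m (1%:M + E)) *m W E).
    apply: bdd_unitary => E DE.
    apply: mul_unitarymx (uW E).
    exact: (mul_unitarymx (unitary_adj (uW E)) (mul_unitarymx uD DE)).
  by apply: bddZ; apply: bddD => //; apply: bddN; exact: bdd_adj.
have bS1 : bdd Dom S1.
  have [k k0 hk] := S1O; have [l l0 hl] := bE; exists (k * l) => [|E DE].
    by rewrite mulr_ge0.
  have := hk E DE; rewrite subr0 => h; rewrite (le_trans h) // ler_wpM2l //.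
  exact: hl.
have S1E E : S1 E = (0 +i* (-1)) *: (diag_mx (\row_j (Re (d 0 j))%:C) *m E0 E).
  exact: (himag_block d1 (skewpart_skew E)).
have S0E : S0 = diag_mx (\row_j (Im (d 0 j))%:C) by exact: himag_diag.
have comm E : Dom E -> S0 *m S1 E = S1 E *m S0.
  move=> _; rewrite S1E S0E -scalemxAr -scalemxAl; congr (_ *: _).
  rewrite /E0 !mul_diag_mx mul_mx_diag; apply/matrixP => i j; rewrite !mxE.
  by case: eqP => [->|_]; rewrite ?mulr0 ?mul0r //; ring.
have [k k0 hk] := eqO_uin hphi (eqO_mpol m c e comm S1O bA bS1 AE).
have [l l0 hl] := eqO_uin hphi (eqO_sym skewpartE).
exists (k + l) => [|E DE]; first exact: addr_ge0.
apply: (le_trans (eq_ler (esym (uin_mpol_conj (D *m (1%:M + E)) (uW E))))).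
suff h3 : phi (mpol_der S0 *m S1 E) <= phi (skewpart E).
  have h1 := hk E DE; have h4 := hl E DE; rewrite expr2.
  have h2 := uinormD hphi (mpol S0) (mpol_der S0 *m S1 E).
  rewrite (le_trans h1) // mulrDl [k * _ + _]addrC addrA lerD2r -addrA.
  by rewrite (le_trans h2) // lerD2l (le_trans h3).
rewrite S1E -scalemxAr.
rewrite (uinormZ hphi) (_ : normc _ = 1) ?mul1r; last first.
  by apply: normc_eq1; rewrite expr0n add0r sqrrN expr1n.
apply: le_trans (uin_pinch hphi (d 0) _).
rewrite S0E mpol_der_diag mulmxA mulmx_diag.
rewrite (_ : diag_mx _ = diag_mx (\row_j (rpol_der m c e (Im (d 0 j)) *
  Re (d 0 j))%:C)); last first.
  by congr diag_mx; apply/rowP => j; rewrite !mxE realcM.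
apply: (uin_contraction hphi) => j; apply: hP.
have := d1 j; case: (d 0 j) => a b /= h.
by rewrite addrC -[LHS]sqr_sqrtr ?h ?expr1n // addr_ge0 ?sqr_ge0.
Qed.

End Diagonal.

Lemma local_estimate (u : 'M[C]_n) : u \is unitarymx ->
  exists2 k : R, 0 <= k & forall v : 'M[C]_n, v \is unitarymx ->
  phi (mpol (himag v)) <=
  phi (mpol (himag u)) + phi (u ^t* *m v - 1%:M) + k * mnorm (u ^t* *m v - 1%:M) ^+ 2.
Proof.
move=> uu; have [Q uQ [d d1 hu]] := unitary_spectral uu.
have [k k0 hk] := local_estimate_diag d1.
exists (k * ((n * n)%:R ^+ 2) ^+ 2) => [|v uv]; first by rewrite mulr_ge0 ?exprn_ge0.
pose E := Q *m (u ^t* *m v - 1%:M) *m Q ^t*.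
have uQs := unitary_adj uQ.
have ud : diag_mx d \is unitarymx by exact: unitary_diag.
have hE : 1%:M + E = Q *m (u ^t* *m v) *m Q ^t*.
  by rewrite /E mulmxBr mulmx1 mulmxBl (unitary_mulmxV uQ) addrC subrK.
have hv : diag_mx d *m (1%:M + E) = Q *m v *m Q ^t*.
  rewrite hE (conj_unitary_diag uQ hu) !mulmxA.
  rewrite -[_ *m Q ^t* *m Q]mulmxA (unitary_mulVmx uQ) mulmx1.
  by rewrite -[Q *m u *m u ^t*]mulmxA (unitary_mulmxV uu) mulmx1.
have /hk : 1%:M + E \is unitarymx.
  rewrite hE.
  exact: (mul_unitarymx (mul_unitarymx uQ (mul_unitarymx (unitary_adj uu) uv)) uQs).
have hV : phi (mpol (himag v)) = phi (mpol (himag (diag_mx d *m (1%:M + E)))).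
  by rewrite hv; exact: esym (uin_mpol_conjV v uQ).
have hU : phi (mpol (himag (diag_mx d))) = phi (mpol (himag u)).
  by rewrite (conj_unitary_diag uQ hu); exact: uin_mpol_conjV.
have hE' : phi E = phi (u ^t* *m v - 1%:M) by exact: (uin_conj hphi _ uQ).
move=> h; apply: (le_trans (eq_ler hV)); apply: (le_trans h); apply: lerD.
  by apply: lerD; [exact: eq_ler hU | exact: eq_ler hE'].
exact: (sqr_scale_le k0 (mnorm_ge0 E) (mnorm_unitary_conj _ uQ)).
Qed.

End FirstOrder.

(** * Polynomial approximation of the arcsine *)

Section ArcsinePolynomials.
Variable R : realType.
Implicit Types (x t : R) (m k : nat).

Definition asin_coef k : R := \prod_(j < k) ((2 * j + 1)%N%:R / (2 * j + 2)%N%:R).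

Lemma asin_coef_ge0 k : 0 <= asin_coef k.
Proof. by apply: prodr_ge0 => j _; rewrite divr_ge0. Qed.

Lemma asin_coef_le1 k : asin_coef k <= 1.
Proof.
apply: prodr_ile1 => j _; rewrite divr_ge0 //= ler_pdivrMr ?mul1r ?ler_nat //.
by rewrite leq_add2l.
Qed.

Lemma asin_coefS k : (k.+1)%:R * asin_coef k.+1 = (k%:R + 2^-1) * asin_coef k.
Proof.
rewrite /asin_coef big_ord_recr /= mulrCA mulrC; congr (_ * _).
have two i : (2 * k + i)%N%:R = 2 * k%:R + i%:R :> R by rewrite natrD natrM.
rewrite !two -natr1; have h : 2 * k%:R + 2 != 0 :> R by rewrite gt_eqF // ltr_wpDl // mulr_ge0.
by field.
Qed.

Definition asin_c k : R := asin_coef k / (k.*2.+1)%:R.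
Definition asin_e k : nat := k.*2.+1.

Definition invsqrt_pol m x : R := \sum_(k < m) asin_coef k * x ^+ k.

Lemma asin_rpol_der m s : rpol_der m asin_c asin_e s = invsqrt_pol m (s ^+ 2).
Proof.
apply: eq_bigr => k _; rewrite /asin_c /asin_e divfK ?pnatr_eq0 //=.
by rewrite -exprM mul2n.
Qed.

Lemma invsqrt_pol_ge0 m x : 0 <= x -> 0 <= invsqrt_pol m x.
Proof.
by move=> x0; apply: sumr_ge0 => k _; rewrite mulr_ge0 ?asin_coef_ge0 ?exprn_ge0.
Qed.

Definition invsqrt_der m x : R := \sum_(k < m) asin_coef k * (k%:R * x ^+ k.-1).

Lemma is_derive_exprn k x : is_derive x 1 (fun y : R => y ^+ k) (k%:R * x ^+ k.-1).
Proof.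
elim: k => [|k IH].
  rewrite mul0r (_ : (fun y : R => _) = cst 1); first exact: is_derive_cst.
  by apply/funext => y; rewrite expr0.
rewrite (_ : (fun y : R => _) = id * (fun y : R => y ^+ k)); last first.
  by apply/funext => y; rewrite exprS.
apply: (is_derive_eq (is_deriveM (is_derive_id x 1) IH)).
rewrite /GRing.scale /= mulr1 -natr1 mulrDl mul1r; congr (_ + _).
by case: (k) => [|j]; rewrite ?mul0r ?mulr0 // exprS mulrCA.
Qed.

Lemma is_derive_invsqrt m x : is_derive x 1 (invsqrt_pol m) (invsqrt_der m x).
Proof.
rewrite (_ : invsqrt_pol m = \sum_(k < m) (fun y : R => asin_coef k * y ^+ k)).
  apply: is_derive_sum => k.
  apply: (is_derive_eq (is_deriveZ (asin_coef k) (is_derive_exprn k x))).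
  by [].
by apply/funext => y; rewrite fct_sumE.
Qed.

(* The truncation [q] of the series of [(1 - x)^(-1/2)] satisfies
   [(1 - x) q' - q / 2 = - m a_m x^(m-1)] by telescoping. *)
Lemma invsqrt_ode m x : (1 - x) * invsqrt_der m x - invsqrt_pol m x / 2 =
  - (m%:R * asin_coef m * x ^+ m.-1).
Proof.
elim: m => [|m IH].
  by rewrite /invsqrt_der /invsqrt_pol !big_ord0 !mul0r mulr0 subrr oppr0.
rewrite /invsqrt_der /invsqrt_pol !big_ord_recr /= -/(invsqrt_der m x).
rewrite -/(invsqrt_pol m x) asin_coefS.
have -> : (1 - x) * (invsqrt_der m x + asin_coef m * (m%:R * x ^+ m.-1)) -
    (invsqrt_pol m x + asin_coef m * x ^+ m) / 2 =
    ((1 - x) * invsqrt_der m x - invsqrt_pol m x / 2) +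
    asin_coef m * (m%:R * x ^+ m.-1) - asin_coef m * m%:R * (x * x ^+ m.-1)
    - asin_coef m * x ^+ m / 2 by ring.
rewrite IH; case: m {IH} => [|m]; first by rewrite !mul0r !mulr0 !expr0; ring.
by rewrite -exprS /=; ring.
Qed.

Definition defect m x := invsqrt_pol m x ^+ 2 * (1 - x).

Lemma is_derive_defect m x : is_derive x 1 (defect m)
  (- 2 * invsqrt_pol m x * (m%:R * asin_coef m * x ^+ m.-1)).
Proof.
have dq := is_derive_invsqrt m x.
have d1x : is_derive x 1 (fun y : R => 1 - y) (-1).
  rewrite (_ : (fun y : R => 1 - y) = cst 1 - id); last exact/funext.
  apply: (is_derive_eq (is_deriveB (is_derive_cst (1 : R) x 1) (is_derive_id x 1))).
  by rewrite sub0r.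
rewrite (_ : defect m = (invsqrt_pol m * invsqrt_pol m) * (fun y => 1 - y)).
  apply: (is_derive_eq (is_deriveM (is_deriveM dq dq) d1x)).
  rewrite -[_ * asin_coef m * _]opprK -invsqrt_ode /GRing.scale /= fctE.
  by field.
by apply/funext => y; rewrite /defect !fctE expr2.
Qed.

Lemma defect0 m : defect m.+1 0 = 1.
Proof.
rewrite /defect subr0 mulr1 /invsqrt_pol big_ord_recl /= expr0 mulr1.
rewrite big1 => [|k _]; last by rewrite exprS mul0r mulr0.
by rewrite addr0 /asin_coef big_ord0 expr1n.
Qed.

Lemma defect_mvt m x : 0 <= x -> exists2 y, 0 <= y <= x &
  1 - defect m.+1 x = 2 * invsqrt_pol m.+1 y * (m.+1%:R * asin_coef m.+1 * y ^+ m) * x.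
Proof.
move=> x0.
have dd (y : R) := is_derive_defect m.+1 y.
have [|y] := MVT_segment x0 (fun y _ => dd y).
  exact: continuous_subspaceT (is_derive_continuous dd).
rewrite in_itv /= defect0 subr0 => yx h; exists y => //.
by rewrite -opprB h !mulNr opprK.
Qed.

Lemma defect_le1 m x : 0 <= x -> defect m x <= 1.
Proof.
case: m => [_|m x0].
  by rewrite /defect /invsqrt_pol big_ord0 expr0n mul0r ler01.
rewrite -subr_ge0; have [y /andP[y0 yx] ->] := defect_mvt m x0.
by rewrite !mulr_ge0 ?invsqrt_pol_ge0 ?asin_coef_ge0 ?exprn_ge0.
Qed.

Lemma asin_rpol_der_le1 m s t : s ^+ 2 + t ^+ 2 = 1 ->
  `|rpol_der m asin_c asin_e s * t| <= 1.
Proof.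
move=> h; rewrite asin_rpol_der -(@expr_le1 _ 2) // real_normK ?num_real // exprMn.
have -> : t ^+ 2 = 1 - s ^+ 2 by rewrite -h addrAC subrr add0r.
exact: defect_le1 (sqr_ge0 s).
Qed.

Lemma defect_ge m x r : 0 <= x <= r -> r < 1 ->
  1 - defect m.+1 x <= 2 / (1 - r) * (m.+1%:R * r ^+ m.+1).
Proof.
move=> /andP[x0 xr] r1; have [y /andP[y0 yx] ->] := defect_mvt m x0.
have yr : y <= r := le_trans yx xr.
have y1 : y < 1 := le_lt_trans yr r1.
have q0 := invsqrt_pol_ge0 m.+1 y0.
have qle : invsqrt_pol m.+1 y <= (1 - r)^-1.
  rewrite -[leRHS]mul1r ler_pdivlMr ?subr_gt0 //.
  apply: (@le_trans _ _ (invsqrt_pol m.+1 y * (1 - y))).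
    by rewrite ler_wpM2l // lerB.
  rewrite -(@expr_le1 _ 2) ?mulr_ge0 ?subr_ge0 ?(ltW y1) //.
  apply: le_trans (defect_le1 m.+1 y0); rewrite /defect exprMn ler_wpM2l ?sqr_ge0 //.
  by rewrite expr2 ler_piMr ?subr_ge0 ?(ltW y1) // gerBl.
have -> : 2 * invsqrt_pol m.+1 y * (m.+1%:R * asin_coef m.+1 * y ^+ m) * x =
  2 * invsqrt_pol m.+1 y * (m.+1%:R * (asin_coef m.+1 * (y ^+ m * x))) by ring.
apply: ler_pM.
- by rewrite mulr_ge0.
- by rewrite !mulr_ge0 ?asin_coef_ge0 ?exprn_ge0.
- by rewrite ler_wpM2l.
rewrite ler_wpM2l // (@le_trans _ _ (y ^+ m * x)) //.
  by rewrite ler_piMl ?asin_coef_le1 // mulr_ge0 ?exprn_ge0.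
rewrite exprSr ler_pM ?exprn_ge0 // lerXn2r ?nnegrE //.
exact: le_trans yr.
Qed.

Lemma cvg_natmul_expr r : 0 <= r < 1 -> m%:R * r ^+ m @[m --> \oo] --> (0 : R).
Proof.
move=> /andP[r0 r1]; have [->|rn0] := eqVneq r 0.
  rewrite (_ : (fun m => _) = fun=> 0); first exact: cvg_cst.
  by apply/funext => -[|m]; rewrite ?mul0r // exprS mul0r mulr0.
have rp : 0 < r by rewrite lt_neqAle eq_sym rn0.
pose q := Num.sqrt r; have q0 : 0 < q by rewrite sqrtr_gt0.
have q1 : q < 1 by rewrite -sqrtr1 ltr_sqrt.
pose h := q^-1 - 1; have h0 : 0 < h by rewrite subr_gt0 invf_gt1.
have bern m : 1 + m%:R * h <= (1 + h) ^+ m.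
  elim: m => [|m IH]; first by rewrite mul0r addr0 expr0.
  rewrite exprS; apply: le_trans (ler_wpM2l _ IH); last by rewrite addr_ge0 ?ltW.
  have : 0 <= h * (m%:R * h) by rewrite !mulr_ge0 ?(ltW h0).
  by rewrite -natr1; move: (m%:R : R) => M hM; lra.
have mq m : m%:R * q ^+ m <= h^-1.
  have hq : 1 + h = q^-1 by rewrite /h addrC subrK.
  rewrite -ler_pdivlMr ?exprn_gt0 // -exprVn -hq ler_pdivlMl // mulrC.
  by apply: le_trans (bern m); rewrite lerDr.
have hz : h^-1 * q ^+ m @[m --> \oo] --> (0 : R).
  rewrite -(mulr0 h^-1); apply: cvgMl_tmp; apply: cvg_expr.
  by rewrite ger0_norm ?(ltW q0).
apply: (@squeeze_cvgr _ _ _ _ (fun=> 0) (fun m => h^-1 * q ^+ m));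
  [|exact: cvg_cst|exact: hz].
near=> m; rewrite mulr_ge0 ?exprn_ge0 //=.
have -> : r ^+ m = q ^+ m * q ^+ m by rewrite -exprMn -expr2 sqr_sqrtr.
by rewrite mulrA ler_wpM2r ?exprn_ge0 ?(ltW q0).
Unshelve. all: by end_near. Qed.

Lemma is_derive_rpol m c e x : is_derive x 1 (rpol m c e) (rpol_der m c e x).
Proof.
rewrite (_ : rpol m c e = \sum_(k < m) (fun y : R => c k * y ^+ e k)).
  apply: is_derive_sum => k.
  apply: (is_derive_eq (is_deriveZ (c k) (is_derive_exprn (e k) x))).
  by rewrite /GRing.scale /= mulrA.
by apply/funext => y; rewrite fct_sumE.
Qed.

Lemma cvg_asin_rpol t : `|t| < pi / 2 ->
  rpol m asin_c asin_e (sin t) @[m --> \oo] --> t.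
Proof.
move=> ht; pose r := sin t ^+ 2.
have ct : 0 < cos t by apply: cos_gt0_pihalf; rewrite -ltr_norml.
have r1 : r < 1 by rewrite /r sin2cos2 gtrBl exprn_gt0.
have r0 : 0 <= r by exact: sqr_ge0.
rewrite -(cvg_shiftS (fun m => rpol m asin_c asin_e (sin t))).
suff bound m : `|t - rpol m.+1 asin_c asin_e (sin t)| <=
    `|t| * (2 / (1 - r)) * (m.+1%:R * r ^+ m.+1).
  have z : `|t| * (2 / (1 - r)) * (m.+1%:R * r ^+ m.+1) @[m --> \oo] --> (0 : R).
    rewrite -(mulr0 (`|t| * (2 / (1 - r)))); apply: cvgMl_tmp.
    rewrite (cvg_shiftS (fun m => m%:R * r ^+ m)); apply: cvg_natmul_expr.
    by rewrite r0.
  apply/cvgrPdist_le => eps eps0; move/cvgrPdist_le : z => /(_ eps eps0).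
  apply: filterS => m; rewrite sub0r normrN; apply: le_trans.
  exact: le_trans (bound m) (ler_norm _).
pose f (s : R) := s - rpol m.+1 asin_c asin_e (sin s).
pose df (s : R) := 1 - rpol_der m.+1 asin_c asin_e (sin s) * cos s.
have fdf (s : R) : is_derive s 1 f (df s).
  have ds : is_derive (sin s) 1 (rpol m.+1 asin_c asin_e) _ := is_derive_rpol _ _ _ (sin s).
  have dsin : is_derive s 1 (@sin R) (cos s) := is_derive_sin s.
  have da : derivable (rpol m.+1 asin_c asin_e) (sin s) 1 by exact: ex_derive.
  have db : derivable (@sin R) s 1 by exact: ex_derive.
  have dc : is_derive s 1 (rpol m.+1 asin_c asin_e \o sin)
      (rpol_der m.+1 asin_c asin_e (sin s) * cos s).
    apply: DeriveDef.
      move/derivable1_diffP : da; move/derivable1_diffP : db => db da.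
      exact/derivable1_diffP/(@differentiable_comp _ _ _ _ (@sin R)).
    have := @derive1_comp R _ _ s db da; rewrite !derive1E => ->.
    by rewrite (derive_val (is_derive := ds)) (derive_val (is_derive := dsin)).
  exact: (is_deriveB (is_derive_id s 1) dc).
have [s st] := MVT_sym0 t fdf.
have f0 : f 0 = 0.
  rewrite /f sin0 sub0r /rpol big1 ?oppr0 // => k _.
  by rewrite /asin_e exprS mul0r mulr0.
rewrite f0 subr0 /f => ->; rewrite normrM mulrC -mulrA ler_wpM2l //.
have cs : cos t <= cos s.
  rewrite -(cos_norm t) -(cos_norm s).
  move: st; rewrite le_eqVlt => /predU1P[->//|st]; apply: ltW.
  rewrite ltr_cos // in_itv /= normr_ge0 /=.
    by apply: ltW (lt_le_trans (lt_trans st ht) _); rewrite ler_piMr ?pi_ge0 //; lra.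
  by apply: ltW (lt_le_trans ht _); rewrite ler_piMr ?pi_ge0 //; lra.
have xs : sin s ^+ 2 <= r.
  by rewrite /r !sin2cos2 lerB // lerXn2r ?nnegrE ?(ltW ct) // (le_trans (ltW ct)).
apply: le_trans (defect_ge m (andb_true_intro (conj (sqr_ge0 (sin s)) xs)) r1).
rewrite /df asin_rpol_der /defect -cos2sin2 -exprMn.
set q := _ * cos s.
have q0 : 0 <= q by rewrite mulr_ge0 ?invsqrt_pol_ge0 ?sqr_ge0 ?(le_trans (ltW ct)).
have q1 : q <= 1.
  rewrite -(@expr_le1 _ 2) // /q exprMn cos2sin2; exact: defect_le1 (sqr_ge0 _).
by rewrite ger0_norm ?subr_ge0 // lerB // expr2 ler_piMl.
Qed.

End ArcsinePolynomials.

(** * Lower bound for the length of a path *)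

Section RightDerivative.
Variable R : realType.
Implicit Types (H p P q : R -> R) (a b c t : R).

Definition cts_on H a b := forall t, a <= t <= b -> forall e, 0 < e ->
  exists2 d, 0 < d & forall s, a <= s <= b -> `|s - t| < d -> `|H s - H t| < e.

Lemma right_nonincreasing H a b : a <= b -> cts_on H a b ->
  (forall t, a <= t < b -> exists2 d, 0 < d &
    forall h, 0 < h <= d -> t + h <= b -> H (t + h) <= H t) ->
  H b <= H a.
Proof.
move=> ab cH loc; pose S := [set t | a <= t <= b /\ H t <= H a].
have Sa : S a by split => //; rewrite lexx ab.
have Sub : has_sup S by split; [exists a | exists b => t [/andP[]]].
pose c := sup S.
have ac : a <= c by apply: sup_upper_bound.
have cb : c <= b by apply: sup_le_ub; [exists a | move=> t [/andP[]]].
have cab : a <= c <= b by rewrite ac cb.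
have Hc : H c <= H a.
  rewrite leNgt; apply/negP => Hca.
  have [d d0 hd] := cH c cab (H c - H a) ltac:(by rewrite subr_gt0).
  have [t [tab Ht] tc] := sup_adherent d0 Sub.
  have tc' : t <= c by apply: sup_upper_bound => //; split.
  have := hd t tab; rewrite distrC ger0_norm ?subr_ge0 // ltrBlDl -ltrBlDr.
  move=> /(_ tc); rewrite distrC ger0_norm; last first.
    by rewrite subr_ge0 (le_trans Ht) ?ltW.
  by rewrite ltrD2l ltrN2 ltNge Ht.
move: cb; rewrite le_eqVlt => /predU1P[<- //|cb].
have [d d0 hd] := loc c ltac:(by rewrite ac cb).
pose h := Num.min d (b - c).
have h0 : 0 < h by rewrite lt_min d0 subr_gt0.
have hb : c + h <= b by rewrite addrC -lerBrDr ge_min lexx orbT.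
have Sh : S (c + h).
  split; first by rewrite hb (le_trans ac) // lerDl ltW.
  by apply: le_trans Hc; apply: hd => //; rewrite h0 ge_min lexx.
have : c + h <= c by apply: sup_upper_bound.
by rewrite gerDl leNgt h0.
Qed.

Lemma continuous_primitive p a b : continuous p -> a <= b -> exists2 P,
  (forall t, a <= t <= b -> is_derive t 1 P (p t)) &
  P b - P a = (\int[lebesgue_measure]_(t in `[a, b]) p t)%R.
Proof.
move=> cp ab.
have ip x y : lebesgue_measure.-integrable `[x, y] (EFin \o p).
  apply: continuous_compact_integrable; first exact: segment_compact.
  exact: continuous_subspaceT.
exists (fun x => (\int[lebesgue_measure]_(t in `[a - 1, x]) p t)%R) => [t /andP[at_ tb]|].
  have tb1 : t < b + 1 by rewrite (le_lt_trans tb) // ltrDl.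
  have at1 : a - 1 < t by rewrite (lt_le_trans _ at_) // gtrBl.
  have [dP dPE] := continuous_FTC1_closed tb1 (ip _ _) at1 (cp t).
  by apply: DeriveDef; [exact: dP | rewrite -derive1E; exact: dPE].
rewrite (Rintegral_itvB (ip _ _)) ?bnd_simp //; last by rewrite gerBl.
apply: Rintegral_itv_obnd_cbnd; apply: integrableS (ip a b) => //.
by apply: subset_itvr; rewrite bnd_simp.
Qed.

Lemma right_derivative_le H p a b : a <= b -> continuous p -> cts_on H a b ->
  (forall t e, a <= t < b -> 0 < e -> exists2 d, 0 < d &
    forall h, 0 < h <= d -> t + h <= b -> H (t + h) <= H t + h * (p t + e)) ->
  H b - H a <= (\int[lebesgue_measure]_(t in `[a, b]) p t)%R.
Proof.
move=> ab cp cH loc; have [P dP <-] := continuous_primitive cp ab.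
rewrite lerBlDr; apply/ler_addgt0Pr => e e0.
pose e' := e / (b - a + 1).
have ba0 : 0 < b - a + 1 by rewrite ltr_wpDl // subr_ge0.
have e'0 : 0 < e' by rewrite divr_gt0.
suff : H b - P b - e' * b <= H a - P a - e' * a.
  have : e' * (b - a) <= e.
    by rewrite /e' mulrAC ler_pdivrMr // ler_wpM2l ?(ltW e0) // lerDl.
  by rewrite mulrBr; lra.
apply: (right_nonincreasing (H := fun t => H t - P t - e' * t)) => //.
  move=> t tab e1 e10; have [d d0 hd] := cH t tab (e1 / 2) ltac:(by rewrite divr_gt0).
  have dPt := dP t tab.
  have cP : {for t, continuous (fun t => P t + e' * t)}.
    apply/differentiable_continuous/derivable1_diffP.
    by apply: derivableD; [exact: ex_derive | exact: derivableM].
  move/cvgrPdist_lt : cP => /(_ (e1 / 2) ltac:(by rewrite divr_gt0)).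
  move=> /nbhs_normP[d1 /= d10 hd1]; exists (Num.min d d1) => [|s sab].
    by rewrite lt_min d0.
  rewrite lt_min => /andP[sd sd1].
  have h1 := hd s sab sd; have := hd1 s; rewrite /= distrC => /(_ sd1).
  rewrite distrC => h2.
  have -> : H s - P s - e' * s - (H t - P t - e' * t) =
    (H s - H t) - ((P s + e' * s) - (P t + e' * t)) by ring.
  by rewrite (le_lt_trans (ler_normB _ _)) // [ltRHS]splitr ltrD.
move=> t /andP[at_ tb]; have tab : a <= t <= b by rewrite at_ ltW.
have e20 : 0 < e' / 2 by rewrite divr_gt0.
have [d d0 hd] := loc t (e' / 2) ltac:(by rewrite at_ tb) e20.
have := is_derive_near (dP t tab) e20.
move=> /nbhs_normP[d1 /= d10 hd1]; exists (Num.min d (d1 / 2)) => [|h].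
  by rewrite lt_min d0 divr_gt0.
rewrite le_min => /andP[h0 /andP[hd' hd1']] hb.
have h1 := hd h ltac:(by rewrite h0 hd') hb.
have : `|P (t + h) - P t - h * p t| <= e' / 2 * `|h|.
  apply: hd1; rewrite /= sub0r normrN gtr0_norm //.
  by rewrite (le_lt_trans hd1') // ltr_pdivrMr // ltr_pMr // ltrDl.
rewrite ler_norml (gtr0_norm h0) => /andP[h2 _].
have e1E : h * (e' / 2) = e' / 2 * h by rewrite mulrC.
have -> : e' * (t + h) = e' * t + e' / 2 * h + e' / 2 * h by field.
by rewrite mulrDr e1E in h1; lra.
Qed.

End RightDerivative.

Section CurveCalculus.
Variables (R : realType) (n : nat).
Local Notation C := R[i].
Implicit Types (g : R -> 'M[C]_n) (t : R).

Lemma mxder_adj g t L : mxder g t L -> mxder (fun s => (g s) ^t*) t (L ^t*).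
Proof.
move=> hg i j; have [hr hi] := hg j i; split.
  rewrite (_ : (fun s => _) = fun s => Re (g s j i)); last first.
    by apply/funext => s; rewrite !mxE conjC_conjc; case: (g s j i).
  by apply: (is_derive_eq hr); rewrite !mxE conjC_conjc; case: (L j i).
rewrite (_ : (fun s => _) = - (fun s => Im (g s j i))); last first.
  by apply/funext => s; rewrite fctE !mxE conjC_conjc; case: (g s j i).
by apply: (is_derive_eq (is_deriveN hi)); rewrite !mxE conjC_conjc; case: (L j i).
Qed.

Lemma smooth_mxder2 g t : smooth_mx g -> exists L, mxder (derive_mx g) t L.
Proof.
move=> sg; exists (derive_mx (derive_mx g) t) => i j.
have [hr hi] := sg 1%N i j t.
have er : (fun s => Re (derive_mx g s i j)) = derive1n 1 (fun s => Re (g s i j)).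
  by apply/funext => s; rewrite mxE.
have ei : (fun s => Im (derive_mx g s i j)) = derive1n 1 (fun s => Im (g s i j)).
  by apply/funext => s; rewrite mxE.
rewrite [X in cder _ _ X]mxE; split.
  by rewrite er; apply: DeriveDef; [exact: hr | rewrite -derive1E].
by rewrite ei; apply: DeriveDef; [exact: hi | rewrite -derive1E].
Qed.

Variable phi : 'M[C]_n -> R.
Hypothesis hphi : unitarily_invariant_norm phi.

Lemma uin_dist A B : `|phi A - phi B| <= uin_cst phi * mnorm (A - B).
Proof.
have h A' B' : phi A' - phi B' <= uin_cst phi * mnorm (A' - B').
  by rewrite lerBlDl (le_trans (uin_lip hphi _ B')) // lerD2l uin_le_mnorm.
by rewrite ler_norml h andbT lerNl opprB -mnormN opprB h.
Qed.

Lemma uin_continuous g : (forall t, exists L, mxder g t L) ->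
  continuous (fun t => phi (g t)).
Proof.
move=> hg t; have [L hL] := hg t; apply/cvgrPdist_le => e e0.
have K0 : 0 < uin_cst phi + 1 by rewrite ltr_wpDl // uin_cst_ge0.
have := mxder_continuous hL => /cvgrPdist_le /(_ (e / (uin_cst phi + 1))).
move=> /(_ ltac:(by rewrite divr_gt0)); apply: filterS => s.
rewrite sub0r normrN ger0_norm ?mnorm_ge0 // => hs.
rewrite (le_trans (uin_dist _ _)) // -mnormN opprB.
rewrite (@le_trans _ _ ((uin_cst phi + 1) * mnorm (g s - g t))) //.
  by rewrite ler_wpM2r ?mnorm_ge0 // lerDl.
by rewrite mulrC -ler_pdivlMr.
Qed.

Lemma speed_continuous g : smooth_mx g ->
  continuous (fun t => phi ((g t) ^t* *m derive_mx g t)).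
Proof.
move=> sg; apply: uin_continuous => t; have [L hL] := smooth_mxder2 t sg.
eexists; exact: (mxderM (mxder_adj (smooth_mxder t sg)) hL).
Qed.

Lemma derive_mx_near g (gam : R -> 'M[C]_n) (a b t : R) : a < t < b ->
  (forall s, a <= s <= b -> gam s = g s) -> derive_mx gam t = derive_mx g t.
Proof.
move=> /andP[at_ tb] gE; apply/matrixP => i j; rewrite !mxE !derive1E.
have nE : \forall s \near t, gam s = g s.
  near=> s; apply: gE; apply/andP; split; apply: ltW.
    by near: s; exact: lt_nbhsr.
  by near: s; exact: lt_nbhsl.
by congr (_ +i* _); apply: near_eq_derive; rewrite ?oner_eq0 //;
   apply: filterS nE => s ->.
Unshelve. all: by end_near. Qed.

End CurveCalculus.

Section PathLength.
Variables (R : realType) (n : nat) (phi : 'M[R[i]]_n -> R).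
Hypothesis hphi : unitarily_invariant_norm phi.
Variables (m : nat) (c : nat -> R) (e : nat -> nat).
Hypothesis hP : forall s t : R, s ^+ 2 + t ^+ 2 = 1 -> `|rpol_der m c e s * t| <= 1.
Local Notation C := R[i].
Implicit Types (g gam : R -> 'M[C]_n) (u v : 'M[C]_n).

(* The sine of the spectrum of [v] replaces the logarithm, and a polynomial [P] with
   [|P' (sin a) * cos a| <= 1] makes the height 1-Lipschitz along curves. *)
Definition height v := phi (mpol m c e (himag v)).

Lemma height_lip : exists2 K : R, 0 <= K & forall u v, u \is unitarymx ->
  v \is unitarymx -> `|height u - height v| <= K * mnorm (u - v).
Proof.
pose Dom := [set w : 'M[C]_n * 'M[C]_n | w.1 \is unitarymx /\ w.2 \is unitarymx].
pose e1 := fun w : 'M[C]_n * 'M[C]_n => mnorm (w.1 - w.2).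
have b1 : bdd Dom (fun w => w.1) by apply: bdd_unitary => w [].
have b2 : bdd Dom (fun w => w.2) by apply: bdd_unitary => w [].
have h0 : eqO Dom e1 (fun w => w.1) (fun w => w.2).
  by exists 1 => // w _; rewrite mul1r.
have hS : eqO Dom e1 (fun w => himag w.1) (fun w => himag w.2).
  by apply: eqOZ; apply: (eqOD h0); apply: eqON; exact: eqO_adj.
have bS (f : 'M[C]_n * 'M[C]_n -> 'M[C]_n) : bdd Dom f -> bdd Dom (fun w => himag (f w)).
  by move=> bf; apply: bddZ; apply: (bddD bf); apply: bddN; exact: bdd_adj.
have hk k : [/\ eqO Dom e1 (fun w => himag w.1 ^+ k) (fun w => himag w.2 ^+ k),
    bdd Dom (fun w => himag w.1 ^+ k) & bdd Dom (fun w => himag w.2 ^+ k)].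
  elim: k => [|k [hE h1 h2]].
    by split; [exact: eqO_refl | exact: bdd_cst | exact: bdd_cst].
  split.
  - have h := eqOM (bS _ b1) h2 hS hE.
    by case: h => q q0 hq; exists q => // w Dw; rewrite !exprS; exact: hq.
  - by have [q q0 hq] := bddM (bS _ b1) h1; exists q => // w Dw; rewrite exprS; exact: hq.
  - by have [q q0 hq] := bddM (bS _ b2) h2; exists q => // w Dw; rewrite exprS; exact: hq.
have hm : eqO Dom e1 (fun w => mpol m c e (himag w.1)) (fun w => mpol m c e (himag w.2)).
  by apply: eqO_sum => k; apply: eqOZ; have [hE _ _] := hk (e k).
have [k k0 hk'] := hm.
exists (uin_cst phi * k) => [|u v uu uv]; first by rewrite mulr_ge0 ?uin_cst_ge0.
rewrite (le_trans (uin_dist hphi _ _)) // -mulrA ler_wpM2l ?uin_cst_ge0 //.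
have := hk' (u, v) (conj uu uv); rewrite /e1 /fst /snd; apply.
Qed.

Lemma height_piece g gam (a b : R) : a <= b -> smooth_mx g ->
  (forall t, a <= t <= b -> gam t \is unitarymx) ->
  (forall t, a <= t <= b -> gam t = g t) ->
  height (gam b) - height (gam a) <=
  (\int[lebesgue_measure]_(t in `[a, b]) phi ((g t) ^t* *m derive_mx g t))%R.
Proof.
move=> ab sg ugam gamE; have cp := speed_continuous hphi sg.
have [K K0 hK] := height_lip.
apply: (right_derivative_le (H := fun t => height (gam t)) ab cp).
  move=> t tab eps eps0; have := mxder_continuous (smooth_mxder t sg).
  move=> /cvgrPdist_lt /(_ (eps / (K + 1))) /(_ ltac:(by rewrite divr_gt0 // ltr_wpDl)).
  move=> /nbhs_normP[d /= d0 hd]; exists d => // s sab st.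
  rewrite (le_lt_trans (hK _ _ (ugam s sab) (ugam t tab))) //.
  rewrite (gamE s sab) (gamE t tab).
  have := hd s; rewrite /= distrC => /(_ st).
  rewrite sub0r normrN ger0_norm ?mnorm_ge0 // ltr_pdivlMr ?ltr_wpDl //.
  by apply: le_lt_trans; rewrite mulrC ler_wpM2l ?mnorm_ge0 // lerDl.
move=> t eps /andP[at_ tb] eps0; have tab : a <= t <= b by rewrite at_ ltW.
have [k k0 hk] := local_estimate hphi hP (ugam t tab).
pose A := (g t) ^t* *m derive_mx g t; pose N := (n * n)%:R : R.
have N0 : 0 <= N by exact: ler0n.
pose K1 := uin_cst phi * N + 1.
have K10 : 0 < K1 by rewrite ltr_wpDl // mulr_ge0 // uin_cst_ge0.
pose eta := eps / 2 / K1; have eta0 : 0 < eta by rewrite !divr_gt0.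
pose M := mnorm A + N * eta.
have M0 : 0 <= M by rewrite addr_ge0 ?mnorm_ge0 // mulr_ge0 // ltW.
pose d2 := eps / 2 / (k * M ^+ 2 + 1).
have d20 : 0 < d2 by rewrite !divr_gt0 // ltr_wpDl // mulr_ge0 ?sqr_ge0.
have := mxder_near (smooth_mxder t sg) eta0.
move=> /nbhs_normP[d1 /= d10 hd1]; exists (Num.min d2 (d1 / 2)) => [|h].
  by rewrite lt_min d20 divr_gt0.
rewrite le_min => /andP[h0 /andP[hd2 hd1']] hb.
have thab : a <= t + h <= b by rewrite hb andbT (le_trans at_) // lerDl ltW.
pose E := (gam t) ^t* *m gam (t + h) - 1%:M.
have hE : E = h%:C *: A + (g t) ^t* *m (g (t + h) - g t - h%:C *: derive_mx g t).
  rewrite !mulmxBr -scalemxAr addrC subrK /E (gamE _ thab) (gamE _ tab).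
  by rewrite (unitary_mulVmx (U := g t)) // -(gamE _ tab) ugam.
have mE : mnorm (g (t + h) - g t - h%:C *: derive_mx g t) <= eta * h.
  rewrite -[X in _ <= _ * X](gtr0_norm h0); apply: hd1.
  rewrite /= sub0r normrN gtr0_norm //.
  by rewrite (le_lt_trans hd1') // ltr_pdivrMr // ltr_pMr // ltrDl.
have mg : mnorm ((g t) ^t*) <= N.
  by rewrite mnorm_adj -(gamE _ tab); exact: mnorm_unitary (ugam t tab).
have mr : mnorm ((g t) ^t* *m (g (t + h) - g t - h%:C *: derive_mx g t)) <= N * (eta * h).
  apply: le_trans (mnormM _ _) _; apply: ler_pM => //; exact: mnorm_ge0.
have phiE : phi E <= h * phi A + uin_cst phi * (N * (eta * h)).
  rewrite hE; apply: le_trans (uinormD hphi _ _) _.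
  rewrite (uinZr hphi) (gtr0_norm h0) lerD2l.
  by apply: le_trans (uin_le_mnorm hphi _) _; rewrite ler_wpM2l ?uin_cst_ge0.
have mEM : mnorm E <= h * M.
  rewrite hE; apply: le_trans (mnormD _ _) _.
  rewrite mnormZ normc_real (gtr0_norm h0) /M mulrDr lerD2l.
  by rewrite (_ : h * (N * eta) = N * (eta * h)) //; ring.
apply: (le_trans (hk _ (ugam _ thab))); rewrite -/E -addrA lerD2l mulrDr.
have h1 : uin_cst phi * (N * (eta * h)) <= h * (eps / 2).
  have -> : uin_cst phi * (N * (eta * h)) = h * (eta * (uin_cst phi * N)) by ring.
  rewrite ler_wpM2l ?(ltW h0) // /eta mulrAC ler_pdivrMr //.
  by rewrite ler_wpM2l ?divr_ge0 ?(ltW eps0) // lerDl.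
have h2 : k * mnorm E ^+ 2 <= h * (eps / 2).
  apply: (@le_trans _ _ (k * (h * M) ^+ 2)).
    by rewrite ler_wpM2l // lerXn2r ?nnegrE ?mnorm_ge0 ?mulr_ge0 ?(ltW h0).
  have -> : k * (h * M) ^+ 2 = h * (h * (k * M ^+ 2)) by ring.
  rewrite ler_wpM2l ?(ltW h0) // (@le_trans _ _ (d2 * (k * M ^+ 2))) //.
    by rewrite ler_wpM2r // mulr_ge0 ?sqr_ge0.
  rewrite /d2 mulrAC ler_pdivrMr ?ltr_wpDl ?mulr_ge0 ?sqr_ge0 //.
  by rewrite ler_wpM2l ?divr_ge0 ?(ltW eps0) // lerDl.
by have := lerD phiE (lerD h1 h2); rewrite -/A; lra.
Qed.

End PathLength.

Section LengthLowerBound.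
Variables (R : realType) (n : nat) (phi : 'M[R[i]]_n -> R).
Hypothesis hphi : unitarily_invariant_norm phi.
Local Notation C := R[i].
Local Notation mu := (@lebesgue_measure R).
Implicit Types (g gam : R -> 'M[C]_n) (u v : 'M[C]_n).

Definition speed gam (t : R) : R := phi (invmx (gam t) *m derive_mx gam t).

Lemma speed_piece g gam (a b : R) : a < b -> smooth_mx g ->
  (forall t, a <= t <= b -> gam t \is unitarymx) ->
  (forall t, a <= t <= b -> gam t = g t) ->
  measurable_fun `[a, b] (speed gam) /\
  (\int[mu]_(t in `[a, b]) (speed gam t)%:E =
   (\int[mu]_(t in `[a, b]) phi ((g t) ^t* *m derive_mx g t))%:E)%E.
Proof.
move=> ab sg ugam gamE; have cp := speed_continuous hphi sg.
pose p t := phi ((g t) ^t* *m derive_mx g t).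
have qp t : a < t < b -> speed gam t = p t.
  move=> tab; have tab' : a <= t <= b.
    by case/andP: tab => /ltW -> /ltW ->.
  rewrite /speed (derive_mx_near tab gamE) (invmx_unitary (ugam t tab')).
  by rewrite (gamE t tab').
have mp (D : set R) : measurable D -> measurable_fun D p.
  by move=> mD; apply: measurable_funTS; exact: continuous_measurable_fun.
have mq : measurable_fun `]a, b[ (speed gam).
  apply: (eq_measurable_fun p); last exact: mp.
  by move=> t /set_mem; rewrite /= in_itv /= => /qp.
have mqc : measurable_fun `[a, b] (speed gam) by exact: measurable_fun_itv_cc mq.
split => //.
have ip : mu.-integrable `[a, b] (EFin \o p).
  apply: continuous_compact_integrable; first exact: segment_compact.
  exact: continuous_subspaceT.
have toopen (f : R -> R) : measurable_fun `[a, b] f ->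
    (\int[mu]_(t in `[a, b]) (f t)%:E = \int[mu]_(t in `]a, b[) (f t)%:E)%E.
  move=> mf; rewrite -integral_itv_bndo_bndc; last first.
    by apply/measurable_EFinP; exact: measurable_fun_itv_co mf.
  rewrite -integral_itv_obnd_cbnd //.
  apply/measurable_EFinP.
  apply: measurable_funS mf => //; apply: subset_itvScc; rewrite ?bnd_simp //.
rewrite /Rintegral fineK; last exact: (integrable_fin_num _ ip).
apply: (etrans (toopen _ mqc)).
apply: (etrans _ (esym (toopen p (mp _ (measurable_itv _))))).
apply: eq_integral => t tab; congr EFin; apply: qp.
by move/set_mem: tab; rewrite /= in_itv.
Qed.

Variables (m : nat) (c : nat -> R) (e : nat -> nat).
Hypothesis hP : forall s t : R, s ^+ 2 + t ^+ 2 = 1 -> `|rpol_der m c e s * t| <= 1.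
Local Notation height := (height phi m c e).

Lemma speed_ge0 gam t : 0 <= speed gam t.
Proof. exact: uinorm_ge0. Qed.

Lemma height_partition gam (a b : R) (s : seq R) : itv_partition a b s ->
  (forall t, a <= t <= b -> gam t \is unitarymx) ->
  (forall k : nat, (k < size s)%N -> exists2 g : R -> 'M[C]_n, smooth_mx g &
    forall t : R, nth 0 (a :: s) k <= t <= nth 0 (a :: s) k.+1 -> gam t = g t) ->
  [/\ measurable_fun `[a, b] (speed gam),
    (\int[mu]_(t in `[a, b]) (speed gam t)%:E < +oo)%E &
    ((height (gam b) - height (gam a))%:E <=
      \int[mu]_(t in `[a, b]) (speed gam t)%:E)%E].
Proof.
elim: s a => [|x s IH] a.
  move=> /itv_partition_nil <- _ _; rewrite subrr set_itv1 integral_set1.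
  by split => //; exact: measurable_fun_set1.
move=> hp ugam hs; have ax : a < x by case: hp => /= /andP[].
have hp' := itv_partition_cons hp; have xb := itv_partition_le hp'.
have [g sg gamE] := hs 0%N isT; rewrite /= in gamE.
have ugam1 t : a <= t <= x -> gam t \is unitarymx.
  by move=> /andP[at_ tx]; apply: ugam; rewrite at_ (le_trans tx).
have ugam2 t : x <= t <= b -> gam t \is unitarymx.
  by move=> /andP[xt tb]; apply: ugam; rewrite tb (le_trans (ltW ax)).
have [m1 i1] := speed_piece ax sg ugam1 gamE.
have [m2 f2 h2] := IH x hp' ugam2 (fun k hk => hs k.+1 hk).
have h1 := height_piece hphi hP (ltW ax) sg ugam1 gamE.
have m2' : measurable_fun `]x, b] (speed gam).
  by apply: measurable_funS m2 => //; apply: subset_itvr; rewrite bnd_simp.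
have split_ab : `[a, b]%classic = `[a, x] `|` `]x, b].
  by apply: itv_bndbnd_setU; rewrite bnd_simp // ltW.
have mU : measurable_fun (`[a, x] `|` `]x, b]) (speed gam).
  by apply/measurable_funU.
have iU : (\int[mu]_(t in `[a, b]) (speed gam t)%:E =
    \int[mu]_(t in `[a, x]) (speed gam t)%:E + \int[mu]_(t in `[x, b]) (speed gam t)%:E)%E.
  rewrite split_ab ge0_integral_setU //=.
  - rewrite integral_itv_obnd_cbnd //; exact/measurable_EFinP.
  - exact/measurable_EFinP.
  - by move=> t _; rewrite lee_fin speed_ge0.
  - apply/disj_setPS => t [/=]; rewrite !in_itv /= => /andP[_ tx] /andP[].
    by rewrite ltNge tx.
split; first by rewrite split_ab.
  by rewrite iU i1 lte_add_pinfty // ltry.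
rewrite iU i1; move: h1 h2; move: (height (gam a)) (height (gam x)) (height (gam b)).
move=> ya yx yb h1 h2; rewrite (_ : yb - ya = (yx - ya) + (yb - yx)); last by ring.
by rewrite EFinD leeD // lee_fin.
Qed.

Lemma height_le_length gam u v : unitary_path u v gam ->
  height v - height u <= path_length phi gam.
Proof.
move=> [[s hs hg] ugam <- <-].
have [_ h2 h3] := height_partition hs ugam hg.
rewrite /path_length -lee_fin /Rintegral -/(speed gam) fineK //.
rewrite ge0_fin_numE // integral_ge0 // => t _.
by rewrite lee_fin speed_ge0.
Qed.

End LengthLowerBound.

(** * Distances to the identity *)


Section Logarithms.
Variable R : realType.
Local Notation C := R[i].

Lemma unit_log (z : C) : normc z = 1 -> 0 < Re z ->
  exists2 t : R, `|t| < pi / 2 & z = cis t.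
Proof.
case: z => a b /= h a0; have h2 : a ^+ 2 + b ^+ 2 = 1.
  by rewrite -[LHS]sqr_sqrtr ?h ?expr1n // addr_ge0 ?sqr_ge0.
have b1 : `|b| < 1.
  rewrite -(@expr_lt1 _ 2) // real_normK ?num_real // -h2.
  by rewrite ltrDr exprn_gt0.
have bi : -1 <= b <= 1 by rewrite -ler_norml ltW.
move: (b1); rewrite ltr_norml => /andP[bl br].
exists (asin b).
  rewrite ltr_norml asin_gtNpi2 ?bl ?ltW // asin_ltpi2 // br andbT.
  exact: ltW.
rewrite /cis cos_asin // asinK ?in_itv //= -h2 addrK sqrtr_sqr gtr0_norm //.
Qed.

Lemma angle_le (t : R) : `|t| < pi / 2 -> 2^-1 <= cos t -> `|t| <= 2 * `|sin t|.
Proof.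
move=> ht hc; have [c ct] := MVT_sym0 t (@is_derive_sin R).
rewrite sin0 subr0 => ->; rewrite normrM mulrA ler_peMl //.
have : cos t <= cos c.
  rewrite -(cos_norm t) -(cos_norm c).
  move: ct; rewrite le_eqVlt => /predU1P[->//|ct]; apply: ltW.
  rewrite ltr_cos // in_itv /= normr_ge0 /=.
    by apply: ltW (lt_le_trans (lt_trans ct ht) _); rewrite ler_piMr ?pi_ge0 //; lra.
  by apply: ltW (lt_le_trans ht _); rewrite ler_piMr ?pi_ge0 //; lra.
by move=> h; have := ler_norm (cos c); lra.
Qed.

Variable n : nat.
Implicit Types (Q A U w : 'M[C]_n).

Lemma unitary_log U : U \is unitarymx ->
  (forall Q (d : 'rV[C]_n), Q \is unitarymx -> U = Q ^t* *m diag_mx d *m Q ->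
    forall j, 0 < Re (d 0 j)) ->
  exists2 Q, Q \is unitarymx & exists2 t : 'I_n -> R, forall j, `|t j| < pi / 2 &
    U = Q ^t* *m cisdiag t *m Q.
Proof.
move=> uU hU; have [Q uQ [d d1 hd]] := unitary_spectral uU.
have hj j := unit_log (d1 j) (hU Q d uQ hd j).
exists Q => //; exists (fun j => projT1 (cid2 (hj j))).
  by move=> j; case: cid2.
rewrite hd; apply: (congr1 (fun X => Q ^t* *m X *m Q)); congr diag_mx.
by apply/rowP => j; rewrite mxE; case: cid2.
Qed.

Definition log_cst : R := (n * n)%:R ^+ 2 * ((n * n)%:R * (2 * (n * n)%:R ^+ 2)).

Lemma log_near1 w : w \is unitarymx ->
  (n * n)%:R ^+ 2 * mnorm (w - 1%:M) <= 2^-1 ->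
  exists2 b, skew_hermitian b & w = expmx b /\ mnorm b <= log_cst * mnorm (w - 1%:M).
Proof.
move=> uw hw.
have hd1 Q (d : 'rV[C]_n) : Q \is unitarymx -> w = Q ^t* *m diag_mx d *m Q ->
    forall j, normc (d 0 j - 1) <= (n * n)%:R ^+ 2 * mnorm (w - 1%:M).
  move=> uQ hd j; apply: le_trans (mnorm_unitary_conj (w - 1%:M) uQ).
  have -> : d 0 j - 1 = (Q *m (w - 1%:M) *m Q ^t*) j j.
    rewrite mulmxBr mulmxBl -(conj_unitary_diag uQ hd) mulmx1.
    by rewrite (unitary_mulmxV uQ) !mxE eqxx mulr1n.
  exact: normc_le_mnorm.
have Re_d Q (d : 'rV[C]_n) : Q \is unitarymx -> w = Q ^t* *m diag_mx d *m Q ->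
    forall j, 2^-1 <= Re (d 0 j).
  move=> uQ hd j; have := le_trans (hd1 Q d uQ hd j) hw.
  move=> /(le_trans (Re_le_normc _)); case: (d 0 j) => a b /=.
  by rewrite ler_norml => /andP[h _]; lra.
have [|Q uQ [t ht hwt]] := unitary_log uw.
  by move=> Q d uQ hd j; have := Re_d Q d uQ hd j; apply: lt_le_trans.
exists (Q ^t* *m imdiag t *m Q); first exact: skew_conj (skew_imdiag t).
split; first by rewrite (expmx_spectral t uQ).
have mt : mnorm (imdiag t) <= (n * n)%:R * (2 * (n * n)%:R ^+ 2 * mnorm (w - 1%:M)).
  apply: mnorm_entries => i j; rewrite !mxE; case: eqVneq => [->|_]; last first.
    by rewrite mulr0n normc0 !mulr_ge0 ?exprn_ge0 ?mnorm_ge0.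
  rewrite mulr1n /= expr0n add0r sqrtr_sqr.
  have h1 := Re_d Q (\row_j cis (t j)) uQ hwt j; rewrite mxE /= in h1.
  have h2 := hd1 Q (\row_j cis (t j)) uQ hwt j; rewrite mxE in h2.
  apply: le_trans (angle_le (ht j) h1) _; rewrite -mulrA ler_wpM2l //.
  apply: le_trans h2; apply: le_trans _ (Im_le_normc _).
  by rewrite /= subr0.
have := mnorm_unitary_conj (imdiag t) (unitary_adj uQ); rewrite trmxCK.
move/le_trans; apply; rewrite /log_cst -[leRHS]mulrA ler_wpM2l ?exprn_ge0 //.
by rewrite -[leRHS]mulrA.
Qed.

End Logarithms.

Section SpectralNormDomain.
Variables (R : realType) (n : nat).
Local Notation C := R[i].

Lemma euclidean_norm_entry (v : 'cV[C]_n) i : euclidean_norm v <= 1 ->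
  normc (v i 0) <= 1.
Proof.
move=> h; rewrite -(@expr_le1 _ 2) ?normc_ge0 //.
have : euclidean_norm v ^+ 2 <= 1 by rewrite expr_le1 // sqrtr_ge0.
rewrite sqr_sqrtr; last by apply: sumr_ge0 => j _; rewrite sqr_ge0.
apply: le_trans; rewrite (bigD1 i) //= lerDl.
by apply: sumr_ge0 => j _; rewrite sqr_ge0.
Qed.

Lemma le_spectral_norm (A : 'M[C]_n) (v : 'cV[C]_n) : euclidean_norm v <= 1 ->
  euclidean_norm (A *m v) <= spectral_norm A.
Proof.
move=> hv; apply: sup_upper_bound; last by exists v.
split; first by exists (euclidean_norm (A *m v)), v.
exists (Num.sqrt (n%:R * mnorm A ^+ 2)) => _ [w hw <-].
rewrite /euclidean_norm ler_wsqrtr //.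
apply: (@le_trans _ _ (\sum_(i < n) mnorm A ^+ 2)); last first.
  by rewrite sumr_const card_ord mulr_natl.
apply: ler_sum => i _; rewrite lerXn2r ?nnegrE ?normc_ge0 ?mnorm_ge0 // mxE.
apply: le_trans (normc_sum _ _ _) _.
apply: (@le_trans _ _ (\sum_j normc (A i j))).
  apply: ler_sum => j _; rewrite normcM ler_piMr ?normc_ge0 //.
  exact: euclidean_norm_entry.
rewrite /mnorm [leRHS](bigD1 i) //= lerDl; apply: sumr_ge0 => k _.
by apply: sumr_ge0 => j _; exact: normc_ge0.
Qed.

Lemma spectral_norm_domain (U : 'M[C]_n) : U \is unitarymx ->
  spectral_norm (U - 1%:M) < Num.sqrt 2 ->
  exists2 Q : 'M[C]_n, Q \is unitarymx & exists2 t : 'I_n -> R,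
    forall j, `|t j| < pi / 2 & U = Q ^t* *m cisdiag t *m Q.
Proof.
move=> uU hU; apply: (unitary_log uU) => Q d uQ hd j.
have dj1 := unitary_diag_norm1 uQ uU hd j.
pose v := col j (Q ^t*).
have v1 : euclidean_norm v = 1.
  rewrite /euclidean_norm -[RHS]sqrtr1 -(unitary_sum_sqr j uQ).
  by congr Num.sqrt; apply: eq_bigr => i _; rewrite !mxE normc_conj.
have hv : (U - 1%:M) *m v = (d 0 j - 1) *: v.
  have -> : (U - 1%:M) *m v = col j ((U - 1%:M) *m Q ^t*) by rewrite /v !colE mulmxA.
  rewrite mulmxBl mul1mx {1}hd (mulmxtVK _ uQ) mul_mx_diag.
  by apply/matrixP => i k; rewrite !mxE mulrBl mul1r mulrC.
have : euclidean_norm ((d 0 j - 1) *: v) < Num.sqrt 2.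
  by rewrite -hv; apply: le_lt_trans hU; apply: le_spectral_norm; rewrite v1.
have -> : euclidean_norm ((d 0 j - 1) *: v) = normc (d 0 j - 1).
  rewrite /euclidean_norm; under eq_bigr do rewrite mxE normcM exprMn.
  rewrite -mulr_sumr sqrtrM ?sqr_ge0 // sqrtr_sqr ger0_norm ?normc_ge0 //.
  by rewrite [Num.sqrt _]v1 mulr1.
move: dj1; case: (d 0 j) => a b /= h1; rewrite ltr_sqrt //.
have h2 : a ^+ 2 + b ^+ 2 = 1.
  by rewrite -[LHS]sqr_sqrtr ?h1 ?expr1n // addr_ge0 ?sqr_ge0.
rewrite subr0 sqrrB1 -mulr_natl; move: h2; move: (a ^+ 2) (b ^+ 2) => A B; lra.
Qed.

End SpectralNormDomain.

Section Distance.
Variables (R : realType) (n : nat) (phi : 'M[R[i]]_n -> R).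
Hypothesis hphi : unitarily_invariant_norm phi.
Local Notation C := R[i].
Local Notation mu := (@lebesgue_measure R).
Implicit Types (g gam : R -> 'M[C]_n) (u v K b : 'M[C]_n).

Lemma path_length_ge0 gam : 0 <= path_length phi gam.
Proof. by apply: Rintegral_ge0 => t _; exact: uinorm_ge0. Qed.

Lemma dist_le_length u v gam : unitary_path u v gam ->
  unitary_dist phi u v <= path_length phi gam.
Proof.
move=> hg; apply: ge_inf; last by exists gam.
by exists 0 => _ [gam' _ <-]; exact: path_length_ge0.
Qed.

Lemma Rintegral01_cst (k : R) :
  (\int[mu]_(t in `[0%R, 1%R]) (fun=> k) t)%R = k.
Proof.
rewrite Rintegral_cst //= lebesgue_measure_itv /= lte_fin ltr01.
by rewrite oppr0 adde0 mulr1.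
Qed.

Lemma expmx_path K : skew_hermitian K ->
  unitary_path 1%:M (expmx K) (fun t => expmx (t%:C *: K)).
Proof.
move=> sK; split.
- exists [:: 1]; first by rewrite /itv_partition /= ltr01 eqxx.
  move=> k _; exists (fun t => expmx (t%:C *: K)) => //.
  by apply: (smooth_linear_ode (A := K)) => t; exact: mxder_expmx.
- by move=> t _; apply: expmx_unitary; exact: skewZ.
- by rewrite scale0r expmx0.
- by rewrite scale1r.
Qed.

Lemma expmx_path_length K : skew_hermitian K ->
  path_length phi (fun t => expmx (t%:C *: K)) = phi K.
Proof.
move=> sK; rewrite -[RHS]Rintegral01_cst; apply: eq_Rintegral => t _.
have uE := expmx_unitary (skewZ t sK).
rewrite (mxder_derive_mx (mxder_expmx t sK)) (invmx_unitary uE) mulmxA.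
exact: uin_conjV.
Qed.

Lemma dist_expmx_le K : skew_hermitian K ->
  unitary_dist phi 1%:M (expmx K) <= phi K.
Proof.
move=> sK; rewrite -(expmx_path_length sK).
exact: dist_le_length (expmx_path sK).
Qed.

Local Notation aheight m := (height phi m (@asin_c R) asin_e).

Lemma aheight1 m : aheight m 1%:M = 0.
Proof.
rewrite /height (_ : mpol _ _ _ _ = 0) ?uin0 //.
have -> : himag (1%:M : 'M[C]_n) = 0 by rewrite /himag adj1 subrr scaler0.
rewrite /mpol big1 // => k _; rewrite /asin_e exprS -[_ * _]/(_ *m _).
by rewrite mul0mx scaler0.
Qed.

Lemma aheight_le_dist m K : skew_hermitian K ->
  aheight m (expmx K) <= unitary_dist phi 1%:M (expmx K).
Proof.
move=> sK; apply: lb_le_inf.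
  exists (path_length phi (fun t => expmx (t%:C *: K))).
  by exists (fun t => expmx (t%:C *: K)); [exact: expmx_path sK | exact: erefl].
move=> _ [gam hgam <-].
have := height_le_length hphi (@asin_rpol_der_le1 R m) hgam.
by rewrite aheight1 subr0.
Qed.

Lemma aheight_mul_expmx m v b : v \is unitarymx -> skew_hermitian b ->
  aheight m (v *m expmx b) <= aheight m v + phi b.
Proof.
move=> uv sb; pose g (t : R) := v *m expmx (t%:C *: b).
have dg t : mxder g t (v *m (b *m expmx (t%:C *: b))).
  by apply: mxder_mull; exact: mxder_expmx.
have sg : smooth_mx g.
  apply: (smooth_linear_ode (A := v *m b *m v ^t*)) => t.
  apply: (mxder_eq (dg t)).
  by rewrite /g !mulmxA (mulmxKtV _ uv).
have ug t : 0 <= t <= 1 -> g t \is unitarymx.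
  by move=> _; apply: (mul_unitarymx uv); exact: expmx_unitary (skewZ t sb).
have := height_piece hphi (@asin_rpol_der_le1 R m) ler01 sg ug (fun t _ => erefl).
have -> : (\int[mu]_(t in `[0, 1]) phi ((g t) ^t* *m derive_mx g t))%R = phi b.
  rewrite -[RHS]Rintegral01_cst; apply: eq_Rintegral => t _.
  have uE := expmx_unitary (skewZ t sb).
  rewrite (mxder_derive_mx (dg t)) /g; move: (expmx (t%:C *: b)) uE => E uE.
  rewrite (_ : _ *m _ = E ^t* *m b *m E); first exact: uin_conjV.
  by rewrite adjM -!mulmxA (mulmxA (v ^t*)) (unitary_mulVmx uv) mul1mx.
by rewrite /g scale0r scale1r expmx0 mulmx1 lerBlDl.
Qed.

(* As the arcsine polynomials converge to the arcsine, the heights of [expmx K]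
   converge to [phi K] when the spectrum of [K] is in [(-i pi/2, i pi/2)]. *)
Lemma uin_le_of_aheight Q (t : 'I_n -> R) (X : R) : Q \is unitarymx ->
  (forall j, `|t j| < pi / 2) ->
  (forall m, aheight m (Q ^t* *m cisdiag t *m Q) <= X) ->
  phi (Q ^t* *m imdiag t *m Q) <= X.
Proof.
move=> uQ ht hX; rewrite (uin_conjV hphi _ uQ).
have hX' m : phi (diag_mx (\row_j (rpol m (@asin_c R) asin_e (sin (t j)))%:C)) <= X.
  apply: le_trans (hX m); apply: eq_ler.
  apply: etrans (esym (uin_mpol_conj hphi m _ _ (cisdiag t) uQ)).
  have E : himag (cisdiag t) = diag_mx (\row_j (sin (t j))%:C).
    by rewrite himag_diag; congr diag_mx; apply/rowP => j; rewrite !mxE.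
  by rewrite E mpol_diag.
have -> : phi (imdiag t) = phi (diag_mx (\row_j (t j)%:C)).
  have -> : imdiag t = (0 +i* 1) *: diag_mx (\row_j (t j)%:C).
    apply/matrixP => i j; rewrite !mxE mulrnAr; congr (_ *+ _).
    by apply: complex_eq => /=; ring.
  rewrite (uinormZ hphi) normc_eq1 ?mul1r //.
  by rewrite expr0n add0r expr1n.
apply/ler_addgt0Pr => eps eps0.
pose e1 := eps / (uin_cst phi * (n * n)%:R + 1).
have k0 : 0 < uin_cst phi * (n * n)%:R + 1.
  by rewrite ltr_wpDl // mulr_ge0 // uin_cst_ge0.
have e10 : 0 < e1 by rewrite divr_gt0.
have near_j j : \forall m \near \oo,
    `|t j - rpol m (@asin_c R) asin_e (sin (t j))| <= e1.
  by have /cvgrPdist_le /(_ e1 e10) := cvg_asin_rpol (ht j).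
have [m _ /(_ m (leqnn m)) hm] := filter_forall _ near_j.
rewrite (le_trans (uin_lip hphi _
  (diag_mx (\row_j (rpol m (@asin_c R) asin_e (sin (t j)))%:C)))) // lerD //.
rewrite (le_trans (uin_le_mnorm hphi _)) //.
apply: (@le_trans _ _ (uin_cst phi * ((n * n)%:R * e1))).
  rewrite ler_wpM2l ?uin_cst_ge0 //; apply: mnorm_entries => i j; rewrite !mxE.
  case: eqVneq => [->|_]; last by rewrite !mulr0n subrr normc0 ltW.
  by rewrite !mulr1n -realcN -realcD normc_real.
rewrite mulrA /e1 mulrA ler_pdivrMr // mulrC.
by rewrite ler_wpM2l ?(ltW eps0) // lerDl.
Qed.

End Distance.

(** * Second-order perturbation *)


Section CommutingExponentials.
Variables (R : realType) (n : nat).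
Local Notation C := R[i].
Implicit Types (X Y A B K : 'M[C]_n) (t : 'I_n -> R).

Lemma comm_imdiag_cisdiag t Y (s : R) :
  (forall j l, t j != t l -> Y j l = 0) ->
  cisdiag (fun j => s * t j) *m Y = Y *m cisdiag (fun j => s * t j).
Proof.
move=> hY; rewrite mul_diag_mx mul_mx_diag; apply/matrixP => j l; rewrite !mxE.
by have [->|/hY ->] := eqVneq (t j) (t l); rewrite ?mulr0 ?mul0r // mulrC.
Qed.

(* [exp(- s (A + Y)) exp(s A) exp(s Y)] has zero derivative in [s]. *)
Lemma expmx_add_imdiag t Y : skew_hermitian Y ->
  (forall j l, t j != t l -> Y j l = 0) ->
  expmx (imdiag t + Y) = cisdiag t *m expmx Y.
Proof.
move=> sY hY; have sA := skew_imdiag t; have sK := skewD sA sY.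
pose E (K : 'M[C]_n) (s : R) := expmx (s%:C *: K).
have EA s : E (imdiag t) s = cisdiag (fun j => s * t j).
  by rewrite /E imdiagZ expmx_imdiag.
pose G s := (E (imdiag t + Y) s) ^t* *m E (imdiag t) s *m E Y s.
have dG s : mxder G s 0.
  have dE K : skew_hermitian K -> mxder (E K) s (K *m E K s).
    by move=> sK'; exact: mxder_expmx.
  apply: (mxder_eq (mxderM (mxderM (mxder_adj (dE _ sK)) (dE _ sA)) (dE _ sY))).
  have cY : E (imdiag t) s *m Y = Y *m E (imdiag t) s.
    by rewrite EA; exact: comm_imdiag_cisdiag.
  rewrite adjM sK; move: (E _ s) (E _ s) (E Y s) cY => EK EA' EY cY.
  have -> : (EK ^t* *m - (imdiag t + Y) *m EA' + EK ^t* *m (imdiag t *m EA')) *m EY +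
      EK ^t* *m EA' *m (Y *m EY) =
      EK ^t* *m (- (imdiag t + Y) *m EA' + imdiag t *m EA' + EA' *m Y) *m EY.
    by rewrite !(mulmxDr, mulmxDl) !mulmxA.
  rewrite cY mulNmx mulmxDl (_ : - _ + _ + _ = 0) ?mulmx0 ?mul0mx //.
  by rewrite -addrA addNr.
have := mxder0_cst 1 0 dG; rewrite /G /E !scale0r !scale1r expmx0 adj1 !mulmx1.
rewrite expmx_imdiag; have uK := expmx_unitary sK; move: (expmx _) uK => EK uK.
move/(congr1 (fun Z => EK *m Z)); rewrite mulmx1 !mulmxA (unitary_mulmxV uK).
by rewrite mul1mx => ->.
Qed.

Lemma jet2_expmx A B : skew_hermitian A -> skew_hermitian B ->
  jet2 (fun s => expmx (s%:C *: A + (s ^+ 2)%:C *: B)) 1%:M A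
    (B + (2^-1)%:C *: (A *m A)).
Proof.
move=> sA sB; pose K (s : R) := s%:C *: A + (s ^+ 2)%:C *: B.
have sK s : skew_hermitian (K s) by apply: skewD; exact: skewZ.
pose M := mnorm A + mnorm B; have M0 : 0 <= M by rewrite addr_ge0 ?mnorm_ge0.
have mK (s : R) : `|s| <= 1 -> mnorm (K s) <= M * `|s|.
  move=> s1; rewrite /K (le_trans (mnormD _ _)) // mulrDl lerD //.
    by rewrite mnormZ normc_real mulrC.
  rewrite mnormZ normc_real mulrC ler_wpM2l ?mnorm_ge0 // normrX expr2.
  by rewrite ler_piMl.
pose L := mnorm (A *m B + B *m A) + mnorm (B *m B).
exists (exp_cst R n * M ^+ 3 + 2^-1 * L) => [|s /= s1].
  by rewrite addr_ge0 // !mulr_ge0 ?exprn_ge0 ?addr_ge0 ?mnorm_ge0.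
pose Z := (2^-1)%:C *: ((s ^+ 3)%:C *: (A *m B + B *m A) + (s ^+ 4)%:C *: (B *m B)).
have KE : (2^-1)%:C *: (K s *m K s) = (2^-1)%:C *: ((s ^+ 2)%:C *: (A *m A)) + Z.
  rewrite -scalerDr; congr (_ *: _); rewrite /K !realcX; move: (s%:C) => c.
  rewrite !(mulmxDl, mulmxDr) -!(scalemxAl, scalemxAr) !scalerA.
  move: (A *m A) (A *m B) (B *m A) (B *m B) => x1 x2 x3 x4.
  apply/matrixP => i j; rewrite !mxE.
  move: (x1 i j) (x2 i j) (x3 i j) (x4 i j) => y1 y2 y3 y4; ring.
have -> : expmx (K s) - (1%:M + s%:C *: A + (s ^+ 2)%:C *: (B + (2^-1)%:C *: (A *m A))) =
    (expmx (K s) - 1%:M - K s - (2^-1)%:C *: (K s *m K s)) + Z.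
  rewrite KE; clear KE; move: (expmx (K s)) Z => Ex W; rewrite /K; move: (A *m A) => x1.
  move: (1%:M : 'M[C]_n) (s%:C) ((s ^+ 2)%:C) ((2^-1)%:C) => I c c2 h.
  apply/matrixP => i j; rewrite !mxE.
  move: (Ex i j) (I i j) (A i j) (B i j) (x1 i j) (W i j) => y1 y2 y3 y4 y5 y6.
  ring.
apply: le_trans (mnormD _ _) _; rewrite mulrDl lerD //.
  apply: le_trans (expmx_remainder2 (sK s)) _.
  rewrite -mulrA ler_wpM2l ?mulr_ge0 ?exprn_ge0 // -exprMn.
  by rewrite lerXn2r ?nnegrE ?mnorm_ge0 ?mulr_ge0 // mK.
rewrite mnormZ normc_real ger0_norm ?invr_ge0 // -mulrA ler_wpM2l ?invr_ge0 //.
apply: le_trans (mnormD _ _) _; rewrite !mnormZ !normc_real !normrX /L mulrDl.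
rewrite ![_ * `|s| ^+ 3]mulrC lerD // ler_wpM2r ?mnorm_ge0 //.
by rewrite ler_wiXn2l.
Qed.

End CommutingExponentials.

Lemma second_order_identity (K : comNzRingType) (n : nat) (X0 Xo A B P : 'M[K]_n)
    (h : K) : h + h = 1 ->
  (B + h *: (A *m A)) + (X0 + Xo - (A + Xo)) *m A +
  (h *: ((X0 + Xo) *m (X0 + Xo)) + - (A + Xo) *m (X0 + Xo) +
  (- (B + (h *: (Xo *m A - A *m Xo) + h *: (X0 *m Xo - Xo *m X0) +
    (X0 *m A - A *m X0) - P)) + h *: ((A + Xo) *m (A + Xo)))) =
  P + h *: (X0 *m X0).
Proof.
move=> hh; transitivity (P + h *: (X0 *m X0) +
  (h + h - 1) *: (A *m A + Xo *m X0 + Xo *m Xo + A *m Xo)); last first.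
  by rewrite hh subrr scale0r addr0.
rewrite !(mulmxDl, mulmxDr, mulmxN, mulNmx).
move: (A *m A) (A *m X0) (A *m Xo) (X0 *m A) (X0 *m X0) (X0 *m Xo).
move: (Xo *m A) (Xo *m X0) (Xo *m Xo) => x1 x2 x3 x4 x5 x6 x7 x8 x9.
apply/matrixP => i j; rewrite !mxE.
move: (x1 i j) (x2 i j) (x3 i j) (x4 i j) (x5 i j) (x6 i j) (x7 i j) (x8 i j).
move: (x9 i j) (B i j) (P i j) => y9 b p y1 y2 y3 y4 y5 y6 y7 y8.
ring.
Qed.

Section SecondOrder.
Variables (R : realType) (n : nat) (t : 'I_n -> R) (X : 'M[R[i]]_n).
Local Notation C := R[i].
Hypothesis sX : skew_hermitian X.
Local Notation d := (\row_j cis (t j) : 'rV[C]_n).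
Local Notation D := (cisdiag t).

Definition in_part : 'M[C]_n := pinch (d 0) X.
Definition off_part : 'M[C]_n := X - in_part.
Definition rot_part : 'M[C]_n := solve d X.

(* The second-order term of the logarithm of [D exp (s X)] conjugated by
   [exp (s rot_part)]. *)
Definition quad_part : 'M[C]_n :=
  (2^-1)%:C *: (off_part *m rot_part - rot_part *m off_part) +
  (2^-1)%:C *: (in_part *m off_part - off_part *m in_part) +
  (in_part *m rot_part - rot_part *m in_part).

Definition normal_exponent (s : R) : 'M[C]_n :=
  s%:C *: in_part + (s ^+ 2)%:C *: pinch (d 0) quad_part.

Let A := rot_part.
Let X0 := in_part.
Let Xo := off_part.
Let Q := quad_part.
Let B := solve d Q.

Let d1 j : normc (d 0 j) = 1.
Proof. by rewrite mxE normc_cis. Qed.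

Let sX0 : skew_hermitian X0. Proof. exact: pinch_skew. Qed.
Let sXo : skew_hermitian Xo. Proof. by apply: skewD => //; exact: skewN. Qed.
Let sA : skew_hermitian A. Proof. exact: solve_skew. Qed.

Lemma skew_commutator (M N : 'M[C]_n) : skew_hermitian M -> skew_hermitian N ->
  skew_hermitian (M *m N - N *m M).
Proof.
rewrite /skew_hermitian => sM sN; rewrite adjB !adjM sM sN.
by rewrite !mulmxN !mulNmx !opprK opprB.
Qed.

Let sQ : skew_hermitian Q.
Proof.
by apply: skewD; [apply: skewD; apply: skewZ|]; exact: skew_commutator.
Qed.
Let sB : skew_hermitian B. Proof. exact: solve_skew. Qed.

Let uD : D \is unitarymx. Proof. exact: unitary_cisdiag. Qed.

Let jetY : jet2 (fun s => expmx (normal_exponent s)) 1%:M X0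
  (pinch (d 0) Q + (2^-1)%:C *: (X0 *m X0)).
Proof. exact: jet2_expmx sX0 (pinch_skew d sQ). Qed.

Definition rotation (s : R) : 'M[C]_n :=
  expmx (s%:C *: rot_part + (s ^+ 2)%:C *: solve d quad_part).

Lemma unitary_rotation s : rotation s \is unitarymx.
Proof. by apply: expmx_unitary; apply: skewD; exact: skewZ. Qed.

Let jetR : jet2 rotation 1%:M A (B + (2^-1)%:C *: (A *m A)).
Proof. exact: jet2_expmx sA sB. Qed.

Let conj_solve (Z : 'M[C]_n) : D ^t* *m solve d Z *m D = solve d Z + (Z - pinch (d 0) Z).
Proof. by rewrite -(solve_eq d1) addrC subrK. Qed.

Let jetW : jet2 (fun s => D ^t* *m (rotation s) ^t* *m D) 1%:M (- (A + Xo))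
  (- (B + (Q - pinch (d 0) Q)) + (2^-1)%:C *: ((A + Xo) *m (A + Xo))).
Proof.
have EA : D ^t* *m A *m D = A + Xo by exact: conj_solve.
have EB : D ^t* *m B *m D = B + (Q - pinch (d 0) Q) by exact: conj_solve.
rewrite -EA -EB; have sA' := skewN (skew_conj D sA); have sB' := skewN (skew_conj D sB).
have := jet2_expmx sA' sB'; rewrite mulNmx mulmxN opprK.
move/jet2_eq; apply => s _.
rewrite !scalerN -opprD expmxN; last by apply: skewD; exact: skewZ (skew_conj _ _).
have -> : s%:C *: (D ^t* *m A *m D) + (s ^+ 2)%:C *: (D ^t* *m B *m D) =
    D ^t* *m (s%:C *: A + (s ^+ 2)%:C *: B) *m D.
  by rewrite !conjmxZ mulmxDr mulmxDl.
rewrite (expmx_conj uD); last by apply: skewD; exact: skewZ.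
by rewrite -/(rotation s) !adjM trmxCK mulmxA.
Qed.

Lemma second_order_normal_form : exists2 k : R, 0 <= k & forall s : R, `|s| <= 1 ->
  mnorm ((rotation s) ^t* *m (D *m expmx (s%:C *: X)) *m rotation s -
         D *m expmx (normal_exponent s)) <= k * `|s| ^+ 3.
Proof.
have jetX : jet2 (fun s => expmx (s%:C *: X)) 1%:M X (0 + (2^-1)%:C *: (X *m X)).
  have s0 : skew_hermitian (0 : 'M[C]_n).
    by rewrite /skew_hermitian trmx0 map_mx0 oppr0.
  by apply: (jet2_eq (jet2_expmx sX s0)) => s _; rewrite scaler0 addr0.
have j := jet2M (jet2M jetW jetX) jetR.
have XE : X = X0 + Xo by rewrite /Xo /off_part addrC subrK.
have c1 : 1%:M *m 1%:M *m A + (1%:M *m X + - (A + Xo) *m 1%:M) *m 1%:M = X0.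
  have gen (a x y : 'M[C]_n) : a + (x + y - (a + y)) = x.
    by apply/matrixP => i l; rewrite !mxE; ring.
  by rewrite !mul1mx !mulmx1 XE; exact: gen.
rewrite c1 !mul1mx !mulmx1 add0r XE in j.
rewrite (second_order_identity _ _ _ _ _ (half_halfC R)) in j.
have [k k0 hk] := eqO_trans j (eqO_sym jetY).
exists ((n * n)%:R * k) => [|s s1]; first exact: mulr_ge0.
have -> : (rotation s) ^t* *m (D *m expmx (s%:C *: X)) *m rotation s =
    D *m (D ^t* *m (rotation s) ^t* *m D *m expmx (s%:C *: X) *m rotation s).
  by rewrite !mulmxA (unitary_mulmxV uD) mul1mx.
rewrite -mulmxBr; apply: le_trans (mnormM _ _) _; rewrite -mulrA.
apply: ler_pM; [exact: mnorm_ge0 | exact: mnorm_ge0 | exact: mnorm_unitary uD |].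
by have := hk s s1; rewrite -XE.
Qed.

End SecondOrder.

Section SwapAverage.
Variables (R : realType) (n : nat) (phi : 'M[R[i]]_n -> R).
Hypothesis hphi : unitarily_invariant_norm phi.
Local Notation C := R[i].
Variable w : 'I_n -> 'I_n -> R.
Hypothesis w0 : forall j l, 0 <= w j l.
Hypothesis wC : forall j l, w j l = w l j.

Definition flow (t : 'I_n -> R) j : R := \sum_l 2 * w j l * (t j - t l).

Lemma imdiagD (t t' : 'I_n -> R) : imdiag (fun j => t j + t' j) = imdiag t + imdiag t'.
Proof.
rewrite /imdiag; apply/matrixP => j l; rewrite !mxE -mulrnDl; congr (_ *+ _).
by apply: complex_eq; rewrite /= ?addr0.
Qed.

Lemma imdiag_sum (I : finType) (F : I -> 'I_n -> R) :
  imdiag (fun j => \sum_i F i j) = \sum_i imdiag (F i).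
Proof.
apply/matrixP => j l; rewrite summxE (eq_bigr (fun i => (0 +i* F i j) *+ (j == l))).
  rewrite !mxE sumrMnl; congr (_ *+ _).
  rewrite (big_morph (fun x : R => 0 +i* x) (id1 := 0) (op1 := +%R)) // => x y.
  by apply: complex_eq; rewrite /= ?addr0.
by move=> i _; rewrite !mxE.
Qed.

Lemma sum_swap (t : 'I_n -> R) j :
  \sum_a \sum_b w a b * (t (tperm a b j) - t j) = - flow t j.
Proof.
have e a b : w a b * (t (tperm a b j) - t j) =
    (a == j)%:R * (w j b * (t b - t j)) + (b == j)%:R * (w j a * (t a - t j)).
  have [->|aj] := eqVneq a j.
    rewrite tpermL mul1r; have [->|_] := eqVneq b j; last by rewrite mul0r addr0.
    by rewrite !subrr !mulr0 addr0.
  have [->|bj] := eqVneq b j; first by rewrite tpermR mul0r mul1r add0r wC.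
  by rewrite tpermD // subrr mulr0 !mul0r addr0.
rewrite (eq_bigr (fun a => \sum_b (a == j)%:R * (w j b * (t b - t j)) +
    \sum_b (b == j)%:R * (w j a * (t a - t j)))); last first.
  by move=> a _; rewrite -big_split; apply: eq_bigr => b _; exact: e.
rewrite big_split /=.
have -> : \sum_a \sum_b (a == j)%:R * (w j b * (t b - t j)) = \sum_b w j b * (t b - t j).
  rewrite (bigD1 j) //= eqxx [X in _ + X]big1 ?addr0.
    by apply: eq_bigr => b _; rewrite mul1r.
  by move=> a /negbTE ->; rewrite big1 // => b _; rewrite mul0r.
have -> : \sum_a \sum_b (b == j)%:R * (w j a * (t a - t j)) = \sum_a w j a * (t a - t j).
  apply: eq_bigr => a _; rewrite (bigD1 j) //= eqxx mul1r big1 ?addr0 //.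
  by move=> b /negbTE ->; rewrite mul0r.
rewrite -big_split -sumrN /=; apply: eq_bigr => l _; ring.
Qed.

(* A small step against the flow is a convex combination of the transpositions
   of the eigenvalues. *)
Lemma uin_flow_le (e : R) t : 0 <= e -> e * (\sum_a \sum_b w a b) <= 1 ->
  phi (imdiag (fun j => t j - e * flow t j)) <= phi (imdiag t).
Proof.
move=> e0 he; set S := \sum_a _ in he.
have -> : imdiag (fun j => t j - e * flow t j) =
    (1 - e * S)%:C *: imdiag t +
    \sum_a \sum_b (e * w a b)%:C *: imdiag (fun j => t (tperm a b j)).
  have -> : \sum_a \sum_b (e * w a b)%:C *: imdiag (fun j => t (tperm a b j)) =
      imdiag (fun j => \sum_a \sum_b (e * w a b) * t (tperm a b j)).
    rewrite imdiag_sum; apply: eq_bigr => a _; rewrite imdiag_sum.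
    by apply: eq_bigr => b _; rewrite imdiagZ.
  rewrite imdiagZ -imdiagD; congr imdiag; apply/funext => j.
  rewrite -mulrN -sum_swap mulrBl mul1r -addrA; congr (_ + _).
  rewrite -mulrA /S mulr_suml !mulr_sumr -sumrN -big_split; apply: eq_bigr => a _ /=.
  rewrite mulr_suml !mulr_sumr -sumrN -big_split; apply: eq_bigr => b _ /=; ring.
apply: le_trans (uinormD hphi _ _) _.
have -> : phi (imdiag t) = (1 - e * S) * phi (imdiag t) +
    \sum_a \sum_b (e * w a b) * phi (imdiag t).
  rewrite mulrBl mul1r -addrA (_ : - _ + _ = 0) ?addr0 // addrC; apply/eqP.
  rewrite subr_eq0; apply/eqP; rewrite -mulrA /S mulr_suml mulr_sumr.
  by apply: eq_bigr => a _; rewrite mulr_suml mulr_sumr; apply: eq_bigr => b _; ring.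
apply: lerD; first by rewrite (uinZr hphi) ger0_norm // subr_ge0.
apply: le_trans (uin_sum hphi _ _ _) _; apply: ler_sum => a _.
apply: le_trans (uin_sum hphi _ _ _) _; apply: ler_sum => b _.
rewrite (uinZr hphi) ger0_norm ?mulr_ge0 // ler_wpM2l ?mulr_ge0 //.
rewrite -(uin_diag_perm hphi (tperm a b) (\row_j (0 +i* t j))); apply: eq_ler.
by congr (phi (diag_mx _)); apply/rowP => j; rewrite !mxE.
Qed.

Lemma uin_le_flow : exists2 k : R, 0 <= k & forall t, exists2 k' : R, 0 <= k' &
  forall e, 0 <= e -> e * k <= 1 ->
  phi (imdiag t) <= phi (imdiag (fun j => t j + e * flow t j)) + k' * e ^+ 2.
Proof.
exists (\sum_a \sum_b w a b); first by do 2![apply: sumr_ge0 => ? _].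
move=> t; exists (phi (imdiag (flow (flow t)))) => [|e e0 he].
  exact: (uinorm_ge0 hphi).
pose t' j := t j + e * flow t j.
have -> : imdiag t = imdiag (fun j => t' j - e * flow t' j) +
    (e ^+ 2)%:C *: imdiag (flow (flow t)).
  rewrite imdiagZ -imdiagD; congr imdiag; apply/funext => j.
  have -> : flow t' j = flow t j + e * flow (flow t) j.
    rewrite /flow mulr_sumr -big_split; apply: eq_bigr => l _ /=.
    by rewrite /t' /flow; ring.
  by rewrite /t'; ring.
apply: le_trans (uinormD hphi _ _) _; apply: lerD; first exact: uin_flow_le.
by rewrite (uinZr hphi) ger0_norm ?exprn_ge0 // mulrC.
Qed.

End SwapAverage.

Section QuadraticTerm.
Variables (R : realType) (n : nat) (t : 'I_n -> R) (X : 'M[R[i]]_n).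
Local Notation C := R[i].
Hypothesis sX : skew_hermitian X.
Hypothesis ht : forall j, `|t j| < pi / 2.
Local Notation d := (\row_j cis (t j) : 'rV[C]_n).

Lemma cis_inj j l : d 0 j = d 0 l -> t j = t l.
Proof.
rewrite !mxE => -[_ h]; apply: (sin_inj _ _ h); rewrite in_itv /=.
  by have := ltW (ht j); rewrite ler_norml.
by have := ltW (ht l); rewrite ler_norml.
Qed.

Lemma skew_normal_exponent s : skew_hermitian (normal_exponent t X s).
Proof.
apply: skewD; apply: skewZ; apply: pinch_skew => //.
have s0 := pinch_skew d sX; have sA := solve_skew d sX.
have so : skew_hermitian (X - pinch (d 0) X) by apply: skewD => //; exact: skewN.
by apply: skewD; [apply: skewD; apply: skewZ|]; exact: skew_commutator.
Qed.

Lemma pinch_off (T : eqType) (c : 'I_n -> T) (A : 'M[C]_n) j l :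
  c j != c l -> pinch c A j l = 0.
Proof. by move=> /negbTE h; rewrite mxE h. Qed.

Lemma pinch_on (T : eqType) (c : 'I_n -> T) (A : 'M[C]_n) j l :
  c j = c l -> pinch c A j l = A j l.
Proof. by move=> h; rewrite mxE h eqxx. Qed.

Lemma normal_exponent_block s j l : t j != t l -> normal_exponent t X s j l = 0.
Proof.
move=> tjl; have djl : d 0 j != d 0 l.
  by apply: contraNneq tjl => /cis_inj ->.
rewrite /normal_exponent /in_part; move: (quad_part _ _) => P.
have := pinch_off X djl; have := pinch_off P djl.
move: (pinch _ X) (pinch _ P) => X' P' h1 h2.
by rewrite mxE mxE h2 mxE h1 !mulr0 addr0.
Qed.

(* [sin] has the sign of the gap [t j - t l] because the gap is less than [pi]: this
   makes the weights nonnegative.  They vanish when the gap does ([0 / 0 = 0]). *)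
Definition weight j l : R :=
  normc (X j l) ^+ 2 * sin (t j - t l) / (2 - 2 * cos (t j - t l)) /
  (2 * (t j - t l)).

Lemma weight_sym j l : weight j l = weight l j.
Proof.
have h : normc (X l j) = normc (X j l).
  by rewrite -normc_conj (skew_entry _ _ sX) normcN.
rewrite /weight h -[t l - t j]opprB sinN cosN; move: (t j - t l) => a.
by rewrite !mulrN !mulNr invrN mulrN opprK.
Qed.

Lemma weight_ge0 j l : 0 <= weight j l.
Proof.
have c1 : 0 <= 2 - 2 * cos (t j - t l).
  by have := cos_le1 (t j - t l); lra.
have hpi : `|t j - t l| < pi.
  by rewrite (le_lt_trans (ler_normB _ _)) // (splitr pi) ltrD.
suff h : 0 <= sin (t j - t l) / (2 * (t j - t l)).
  rewrite /weight [_ * sin _ / _]mulrAC -[_ * sin _ / _]mulrA mulr_ge0 //.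
  by rewrite divr_ge0 ?exprn_ge0 ?normc_ge0.
move: hpi; set a := t j - t l; rewrite ltr_norml => /andP[al ar].
have [a0|a0] := leP 0 a.
  by rewrite divr_ge0 ?mulr_ge0 // sin_ge0_pi // a0 ltW.
rewrite -mulrNN -invrN -sinN -mulrN divr_ge0 //.
  by rewrite sin_ge0_pi // oppr_ge0 ltW //= lerNl ltW.
by rewrite mulr_ge0 // oppr_ge0 ltW.
Qed.

Lemma quad_term (x : C) (c s : R) : c ^+ 2 + s ^+ 2 = 1 -> 2 - 2 * c != 0 ->
  (2^-1)%:C * (x * (- Num.conj x / ((c - 1) +i* s)) -
    x / ((c - 1) +i* (- s)) * - Num.conj x) =
  0 +i* (normc x ^+ 2 * s / (2 - 2 * c)).
Proof.
move=> h c0; have e : (c - 1) ^+ 2 + s ^+ 2 = 2 - 2 * c.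
  have -> : (c - 1) ^+ 2 + s ^+ 2 = (c ^+ 2 + s ^+ 2) + 1 - 2 * c by ring.
  by rewrite h.
have e' : (c - 1) ^+ 2 + (- s) ^+ 2 = 2 - 2 * c by rewrite sqrrN.
case: x => a b; rewrite conjC_conjc.
have -> : normc (a +i* b) ^+ 2 = a ^+ 2 + b ^+ 2.
  by rewrite sqr_sqrtr // addr_ge0 ?sqr_ge0.
by apply: complex_eq; rewrite /= ?e ?e'; field.
Qed.

Lemma quad_part_diag j : quad_part t X j j = 0 +i* flow weight t j.
Proof.
have z1 (A B : 'M[C]_n) : (forall j l, d 0 j = d 0 l -> B j l = 0) ->
    (pinch (d 0) A *m B) j j = 0.
  move=> hB; rewrite mxE big1 // => l _.
  have [h|h] := eqVneq (d 0 j) (d 0 l); first by rewrite (hB l j) ?mulr0.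
  by rewrite pinch_off ?mul0r.
have z2 (A B : 'M[C]_n) : (forall j l, d 0 j = d 0 l -> B j l = 0) ->
    (B *m pinch (d 0) A) j j = 0.
  move=> hB; rewrite mxE big1 // => l _.
  have [h|h] := eqVneq (d 0 j) (d 0 l); first by rewrite (hB j l) ?mul0r.
  by rewrite pinch_off ?mulr0 // eq_sym.
have hX k l : d 0 k = d 0 l -> (X - pinch (d 0) X) k l = 0.
  by move=> h; rewrite 2!mxE pinch_on ?subrr.
have hA k l : d 0 k = d 0 l -> solve d X k l = 0.
  by move=> h; rewrite mxE h eqxx.
have entry (a b : C) (M N P Q U V : 'M[C]_n) :
    (a *: (M - N) + b *: (P - Q) + (U - V)) j j =
    a * (M j j - N j j) + b * (P j j - Q j j) + (U j j - V j j).
  by rewrite !mxE.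
rewrite /quad_part /off_part /in_part /rot_part entry {entry}.
rewrite (z1 X _ hX) (z2 X _ hX) (z1 X _ hA) (z2 X _ hA).
rewrite subrr mulr0 !addr0.
rewrite [(_ *m solve d X) j j]mxE [(solve d X *m _) j j]mxE -sumrB mulr_sumr.
rewrite /flow (big_morph (fun x : R => 0 +i* x) (id1 := 0) (op1 := +%R)) //; last first.
  by move=> x y; apply: complex_eq; rewrite /= ?addr0.
apply: eq_bigr => l _; have [djl|djl] := eqVneq (d 0 j) (d 0 l).
  rewrite (hX _ _ djl) (hA _ _ djl) !mul0r subrr mulr0 (cis_inj djl) subrr mulr0.
  exact: erefl.
have tjl : t j - t l != 0.
  by rewrite subr_eq0; apply: contraNneq djl => h; rewrite !mxE h.
have eX k m : d 0 k != d 0 m -> (X - pinch (d 0) X) k m = X k m.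
  by move=> h; rewrite 2!mxE pinch_off ?subr0.
have dlj : d 0 l != d 0 j by rewrite eq_sym.
have -> : 2 * weight j l * (t j - t l) =
    normc (X j l) ^+ 2 * sin (t j - t l) / (2 - 2 * cos (t j - t l)).
  by rewrite /weight; move: (_ / (2 - _)) => w; field.
have cn : 2 - 2 * cos (t j - t l) != 0.
  apply: contraNneq djl => h; have c1 : cos (t j - t l) = 1 by lra.
  have s0 : sin (t j - t l) = 0.
    by have /eqP := sin2cos2 (t j - t l); rewrite c1 expr1n subrr sqrf_eq0 => /eqP.
  rewrite !mxE -[t j](subrK (t l)) cisD {1}/cis c1 s0; apply/eqP.
  exact: mul1r.
have eA k m : d 0 k != d 0 m ->
    solve d X k m = X k m / ((cos (t m - t k) - 1) +i* sin (t m - t k)).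
  move=> /negbTE h; rewrite mxE h; congr (_ / _).
  rewrite !mxE conj_cis -cisD [- t k + t m]addrC.
  by apply: complex_eq; rewrite /= ?subr0.
rewrite (eX _ _ djl) (eX _ _ dlj) (eA _ _ djl) (eA _ _ dlj).
rewrite -[X l j]opprK -(skew_entry _ _ sX) -[t l - t j]opprB cosN sinN.
exact: quad_term (cos2Dsin2 _) cn.
Qed.

End QuadraticTerm.

Section SecondDifference.
Variables (R : realType) (n : nat) (phi : 'M[R[i]]_n -> R).
Hypothesis hphi : unitarily_invariant_norm phi.
Local Notation C := R[i].
Local Notation aheight m := (height phi m (@asin_c R) asin_e).

Lemma eigenvalue_perturbation (t h : 'I_n -> R) (Y Q : 'M[C]_n) (M : R) :
  Q \is unitarymx -> imdiag t + Y = Q ^t* *m imdiag h *m Q ->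
  (forall j, `|t j| <= M) -> forall j, `|h j| <= M + (n * n)%:R ^+ 2 * mnorm Y.
Proof.
move=> uQ hA tM j; have e := conj_unitary_diag uQ hA.
have -> : `|h j| = normc (diag_mx (\row_j (0 +i* h j)) j j : C).
  by rewrite !mxE eqxx mulr1n /= expr0n add0r sqrtr_sqr.
rewrite e mulmxDr mulmxDl mxE; apply: le_trans (le_normcD _ _) _; apply: lerD; last first.
  exact: le_trans (normc_le_mnorm _ _ _) (mnorm_unitary_conj _ uQ).
rewrite mul_mx_diag mxE -[M]mul1r -(unitary_sum_sqr j uQ) mulr_suml.
apply: le_trans (normc_sum _ _ _) _; apply: ler_sum => l _; rewrite !mxE.
rewrite !normcM normc_conj mulrAC -expr2 ler_wpM2l ?exprn_ge0 ?normc_ge0 //.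
by rewrite /= expr0n add0r sqrtr_sqr.
Qed.

Lemma unitary_defect (v T : 'M[C]_n) : v \is unitarymx ->
  mnorm (v ^t* *m T - 1%:M) <= (n * n)%:R * mnorm (v - T).
Proof.
move=> uv; have -> : v ^t* *m T - 1%:M = - (v ^t* *m (v - T)).
  by rewrite mulmxBr (unitary_mulVmx uv) opprB.
rewrite mnormN; apply: le_trans (mnormM _ _) _; apply: ler_wpM2r.
  exact: mnorm_ge0.
exact: mnorm_unitary (unitary_adj uv).
Qed.

Lemma small_angle (N : R) (t : 'I_n -> R) (Y : R -> 'M[C]_n) (k : R) : 0 <= k ->
  0 <= N -> (forall j, `|t j| < pi / 2) ->
  (forall s, `|s| <= 1 -> mnorm (Y s) <= k * `|s|) ->
  exists2 e : R, 0 < e <= 1 & exists2 M : R, (forall j, `|t j| <= M) &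
    forall s, `|s| <= e -> M + N * mnorm (Y s) < pi / 2.
Proof.
move=> k0 N0 ht hY; have pi2 : 0 < pi / 2 :> R by rewrite divr_gt0 ?pi_gt0.
pose M := \big[Num.max/0]_j `|t j|.
have Mlt : M < pi / 2 by rewrite /M; elim/big_ind: _ => // x y hx hy; rewrite gt_max hx.
have gap : 0 < pi / 2 - M by rewrite subr_gt0.
have Nk : 0 < N * k + 1 by rewrite ltr_wpDl ?mulr_ge0.
exists (Num.min 1 ((pi / 2 - M) / 2 / (N * k + 1))).
  by rewrite lt_min ltr01 !divr_gt0 //= ge_min lexx.
exists M => [j|s]; first by rewrite /M (bigD1 j) //= le_max lexx.
rewrite le_min => /andP[s1 hs].
have : N * mnorm (Y s) <= N * k * `|s| by rewrite -mulrA ler_wpM2l ?hY.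
move: hs; rewrite ler_pdivlMr // mulrDr mulr1 [`|s| * _]mulrC.
have := normr_ge0 s; lra.
Qed.

Variables (t : 'I_n -> R) (X : 'M[C]_n).
Hypothesis sX : skew_hermitian X.
Hypothesis ht : forall j, `|t j| < pi / 2.
Local Notation D := (cisdiag t).

Lemma normal_exponent_bound : exists2 k : R, 0 <= k &
  forall s, `|s| <= 1 -> mnorm (normal_exponent t X s) <= k * `|s|.
Proof.
rewrite /normal_exponent; move: (in_part _ _) (pinch _ _) => A B.
exists (mnorm A + mnorm B) => [|s s1]; first by rewrite addr_ge0 ?mnorm_ge0.
apply: le_trans (mnormD _ _) _; rewrite !mnormZ !normc_real mulrDl mulrC.
rewrite lerD // mulrC ler_wpM2l ?mnorm_ge0 // normrX expr2.
by rewrite ler_piMl.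
Qed.

Lemma uin_normal_exponent_le : exists2 k : R, 0 <= k & exists2 e : R, 0 < e <= 1 &
  forall s, `|s| <= e -> forall Z : R,
  (forall m, aheight m (D *m expmx (s%:C *: X)) <= Z) ->
  phi (imdiag t + normal_exponent t X s) <= Z + k * `|s| ^+ 3.
Proof.
have [k k0 hk] := second_order_normal_form t sX.
have [kY kY0 hY] := normal_exponent_bound.
have N0 : 0 <= (n * n)%:R ^+ 2 :> R by rewrite exprn_ge0.
have [e1 /andP[e1p e11] [M hM hsmall]] := small_angle kY0 N0 ht hY.
pose L := (n * n)%:R * k : R; have L0 : 0 <= L by rewrite mulr_ge0.
have NL : 0 < (n * n)%:R ^+ 2 * L + 1 by rewrite ltr_wpDl ?mulr_ge0.
pose e2 := Num.min e1 (2^-1 / ((n * n)%:R ^+ 2 * L + 1)).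
exists (uin_cst phi * (log_cst R n * L)).
  by rewrite !mulr_ge0 ?uin_cst_ge0 ?exprn_ge0.
have e2p : 0 < e2 by rewrite lt_min e1p divr_gt0 ?invr_gt0.
exists e2; first by rewrite e2p /= (le_trans _ e11) // ge_min lexx.
move=> s; rewrite le_min => /andP[se1 se2] Z hZ.
have s1 : `|s| <= 1 by exact: le_trans se1 e11.
set Y := normal_exponent t X s; have sY : skew_hermitian Y by exact: skew_normal_exponent.
have [Q uQ [h hQ]] := skew_spectral (skewD (skew_imdiag t) sY).
have hh j : `|h j| < pi / 2.
  exact: le_lt_trans (eigenvalue_perturbation uQ hQ hM j) (hsmall _ se1).
have eT : D *m expmx Y = Q ^t* *m cisdiag h *m Q.
  have hB j l : t j != t l -> Y j l = 0 by exact: normal_exponent_block.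
  rewrite -(expmx_add_imdiag sY hB) hQ; exact: expmx_spectral.
pose W := rotation t X s; have uW : W \is unitarymx := unitary_rotation t sX s.
pose v := W ^t* *m (D *m expmx (s%:C *: X)) *m W.
have uv : v \is unitarymx.
  have uE := mul_unitarymx (unitary_cisdiag t) (expmx_unitary (skewZ s sX)).
  exact: mul_unitarymx (mul_unitarymx (unitary_adj uW) uE) uW.
have uT : D *m expmx Y \is unitarymx.
  exact: mul_unitarymx (unitary_cisdiag t) (expmx_unitary sY).
pose w := v ^t* *m (D *m expmx Y).
have uw : w \is unitarymx := mul_unitarymx (unitary_adj uv) uT.
have w1 : mnorm (w - 1%:M) <= L * `|s| ^+ 3.
  apply: le_trans (unitary_defect _ uv) _; rewrite /L -mulrA.
  apply: ler_wpM2l; first exact: ler0n.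
  exact: hk.
have s3 : `|s| ^+ 3 <= `|s| by rewrite exprS ler_piMr // exprn_ile1.
have [b sb [wE bb]] : exists2 b, skew_hermitian b &
    w = expmx b /\ mnorm b <= log_cst R n * mnorm (w - 1%:M).
  apply: log_near1 => //; apply: (@le_trans _ _ ((n * n)%:R ^+ 2 * L * `|s|)).
    rewrite -mulrA ler_wpM2l // (le_trans w1) // ler_wpM2l //.
  move: se2; rewrite ler_pdivlMr // mulrDr mulr1 [`|s| * _]mulrC.
  by have := normr_ge0 s; lra.
have phib : phi b <= uin_cst phi * (log_cst R n * L) * `|s| ^+ 3.
  apply: le_trans (uin_le_mnorm hphi b) _; rewrite -[leRHS]mulrA.
  apply: ler_wpM2l; first exact: uin_cst_ge0.
  rewrite -[leRHS]mulrA; apply: le_trans bb _; apply: ler_wpM2l; first by rewrite !mulr_ge0 ?exprn_ge0.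
  exact: w1.
rewrite hQ; apply: (uin_le_of_aheight hphi uQ hh) => m; rewrite -eT.
have -> : D *m expmx Y = v *m expmx b.
  by rewrite -wE /w mulmxA (unitary_mulmxV uv) mul1mx.
apply: le_trans (aheight_mul_expmx hphi m uv sb) _; apply: lerD; last exact: phib.
apply: (le_trans _ (hZ m)); apply: eq_ler; rewrite /height.
exact: (uin_mpol_conj hphi _ _ _ (D *m expmx (s%:C *: X)) uW).
Qed.

Lemma normal_exponent_mean (s : R) :
  (2^-1)%:C *: ((imdiag t + normal_exponent t X s) +
                (imdiag t + normal_exponent t X (- s))) =
  imdiag t + (s ^+ 2)%:C *: pinch ((\row_j cis (t j)) 0) (quad_part t X).
Proof.
rewrite /normal_exponent sqrrN realcN.
move: (imdiag t) (in_part _ _) (pinch _ _) => I A P; move: (s%:C) ((s ^+ 2)%:C) => a b.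
have h := half_halfC R; move: (2^-1)%:C h => c h.
transitivity ((c + c) *: (I + b *: P)); last by rewrite h scale1r.
by apply/matrixP => j l; rewrite !mxE; ring.
Qed.

Lemma pinch_id_quad (s : R) :
  pinch id (imdiag t + (s ^+ 2)%:C *: pinch ((\row_j cis (t j)) 0) (quad_part t X)) =
  imdiag (fun j => t j + s ^+ 2 * flow (weight t X) t j).
Proof.
have hq := quad_part_diag sX ht; move: (quad_part t X) hq => P hq.
apply/matrixP => j l; rewrite [LHS]mxE; have [<-|jl] := eqVneq j l; last first.
  by rewrite !mxE (negbTE jl).
rewrite [LHS]mxE [X in _ + X]mxE pinch_on // hq !mxE eqxx !mulr1n.
by apply: complex_eq; rewrite /= ?mul0r ?mulr0 ?subrr ?addr0.
Qed.

Lemma two_sided_bound (p q r x u v v' Z Z' : R) : p <= Z + u -> q <= Z' + u ->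
  x <= r + v -> r <= 2^-1 * (p + q) -> v <= v' -> 2 * x <= Z + Z' + (2 * u + 2 * v').
Proof. lra. Qed.

Lemma second_difference_ge : exists2 k : R, 0 <= k & exists2 e : R, 0 < e <= 1 &
  forall s, 0 <= s <= e -> forall Z Z' : R,
  (forall m, aheight m (D *m expmx (s%:C *: X)) <= Z) ->
  (forall m, aheight m (D *m expmx ((- s)%:C *: X)) <= Z') ->
  2 * phi (imdiag t) <= Z + Z' + k * s ^+ 3.
Proof.
have [k1 k10 [e1 /andP[e1p e11] h1]] := uin_normal_exponent_le.
have [k2 k20 h2] := uin_le_flow hphi (weight_ge0 X ht) (weight_sym t sX).
have [k3 k30 h3] := h2 t.
exists (2 * k1 + 2 * k3); first by rewrite addr_ge0 ?mulr_ge0.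
exists (Num.min e1 (k2 + 1)^-1).
  by rewrite lt_min e1p invr_gt0 ltr_wpDl //= ge_min e11.
move=> s /andP[s0]; rewrite le_min => /andP[se1 se2] Z Z' hZ hZ'.
have s1 : s <= 1 by exact: le_trans se1 e11.
have := h1 s; rewrite ger0_norm // => /(_ se1 Z hZ) a1.
have := h1 (- s); rewrite normrN ger0_norm // => /(_ se1 Z' hZ') a2.
pose t' j := t j + s ^+ 2 * flow (weight t X) t j.
have s2k : s ^+ 2 * k2 <= 1.
  apply: (@le_trans _ _ (s * (k2 + 1))).
    by rewrite expr2 -mulrA ler_wpM2l // (@le_trans _ _ k2) ?ler_piMl // lerDl.
  by rewrite -ler_pdivlMr ?mul1r // ltr_wpDl.
have a3 := h3 _ (sqr_ge0 s) s2k.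
have a4 : phi (imdiag t') <= phi ((2^-1)%:C *:
    ((imdiag t + normal_exponent t X s) + (imdiag t + normal_exponent t X (- s)))).
  rewrite normal_exponent_mean; apply: le_trans (uin_pinch hphi id _); apply: eq_ler.
  by rewrite pinch_id_quad.
have a5 := le_trans a4 (uin_mean hphi _ _).
rewrite -/t' in a3.
have s43 : k3 * (s ^+ 2) ^+ 2 <= k3 * s ^+ 3.
  by rewrite ler_wpM2l // -exprM [leLHS]exprS ler_piMl // exprn_ge0.
by rewrite [leRHS](_ : _ = Z + Z' + (2 * (k1 * s ^+ 3) + 2 * (k3 * s ^+ 3)));
  [exact: two_sided_bound a1 a2 a3 a5 s43 | ring].
Qed.

End SecondDifference.

(** * Convexity *)

Section Convexity.
Variables (R : realType) (f : R -> R) (L : R).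
Hypothesis L0 : 0 <= L.
Hypothesis fL : forall s t : R, 0 <= s <= 1 -> 0 <= t <= 1 -> f s <= f t + L * `|s - t|.
Hypothesis f2 : forall t : R, 0 < t < 1 -> exists2 k : R, 0 <= k &
  exists2 e : R, 0 < e & forall s : R, 0 <= s <= e ->
  2 * f t <= f (t + s) + f (t - s) + k * s ^+ 3.

Lemma max_lip (a s t : R) : `|Num.max a s - Num.max a t| <= `|s - t|.
Proof.
have h := ler_norm (s - t); have h' := ler_norm (t - s); rewrite distrC in h'.
by rewrite ler_norml; have [as_|sa] := leP a s; have [at_|ta] := leP a t; lra.
Qed.

Lemma clamp_lip (a b s t : R) :
  `|Num.max a (Num.min s b) - Num.max a (Num.min t b)| <= `|s - t|.
Proof.
apply: le_trans (max_lip _ _ _) _.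
have h := ler_norm (s - t); have h' := ler_norm (t - s); rewrite distrC in h'.
by rewrite ler_norml; have [sb|bs] := leP s b; have [tb|bt] := leP t b; lra.
Qed.

Lemma clamp_itv (a b t : R) : a <= b -> a <= Num.max a (Num.min t b) <= b.
Proof. by move=> ab; rewrite le_max lexx ge_max ab ge_min lexx orbT. Qed.

Lemma clampK (a b t : R) : a <= t <= b -> Num.max a (Num.min t b) = t.
Proof. by move=> /andP[at_ tb]; rewrite (min_idPl tb) (max_idPr at_). Qed.

Lemma lip_clamp_continuous (a b : R) : 0 <= a -> a <= b -> b <= 1 ->
  continuous (fun t => f (Num.max a (Num.min t b))).
Proof.
move=> a0 ab b1 t; have h s t' : f (Num.max a (Num.min s b)) <=
    f (Num.max a (Num.min t' b)) + L * `|s - t'|.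
  have itv u : 0 <= Num.max a (Num.min u b) <= 1.
    by have /andP[h1 h2] := clamp_itv u ab; rewrite (le_trans a0) //= (le_trans h2).
  by apply: le_trans (fL (itv s) (itv t')) _; rewrite lerD2l ler_wpM2l // clamp_lip.
apply/cvgrPdist_le => e e0; have K0 : 0 < L + 1 by rewrite ltr_wpDl.
near=> s; have ts : `|t - s| <= e / (L + 1).
  by near: s; apply: cvgr_dist_le; [exact: cvg_id | rewrite divr_gt0].
have Le : L * `|t - s| <= e.
  move: ts; rewrite ler_pdivlMr // => ts; apply: le_trans ts.
  by rewrite mulrC ler_wpM2l // lerDl.
rewrite ler_norml lerBlDl lerNl opprB lerBlDl.
rewrite (le_trans (h s t)) ?lerD2l 1?distrC //=.
by rewrite (le_trans (h t s)) // lerD2l.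
Unshelve. all: by end_near.
Qed.

(* At an interior maximum of [f - chord + e (t - a) (t - b)] the second difference
   is nonpositive, whereas the parabola makes it at least [2 e s^2 - k s^3]. *)
Lemma le_chord_eps (a b t e : R) : 0 <= a -> a < b -> b <= 1 -> a <= t <= b -> 0 < e ->
  f t <= f a + (f b - f a) / (b - a) * (t - a) + e * (t - a) * (b - t).
Proof.
move=> a0 ab b1 tab e0; set q := (f b - f a) / (b - a).
pose F u := f (Num.max a (Num.min u b)).
pose p (u : R) : R := f a + q * (u - a) + e * (u - a) * (b - u).
have pc : continuous p.
  move=> u; have ca : (fun v => v - a) @ u --> u - a.
    by apply: cvgB; [exact: cvg_id | exact: cvg_cst].
  have cb : (fun v => b - v) @ u --> b - u.
    by apply: cvgB; [exact: cvg_cst | exact: cvg_id].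
  have cM k : (fun v => k * (v - a)) @ u --> k * (u - a).
    by apply: cvgM; [exact: cvg_cst | exact: ca].
  have c1 : (fun v => f a + q * (v - a)) @ u --> f a + q * (u - a).
    by apply: cvgD; [exact: cvg_cst | exact: cM].
  exact: (cvgD c1 (cvgM (cM e) cb)).
have gc : {within `[a, b], continuous (fun u => F u - p u)}.
  apply: continuous_subspaceT => u; apply: cvgB; last exact: pc.
  exact: lip_clamp_continuous a0 (ltW ab) b1 u.
have [c] := EVT_max (ltW ab) gc; rewrite in_itv /= => cab hc.
have FE u : a <= u <= b -> F u = f u by move=> h; rewrite /F clampK.
suff cp : F c - p c <= 0.
  have := hc t; rewrite in_itv /= => /(_ tab); rewrite FE // => h.
  by rewrite -subr_le0; exact: le_trans h cp.
rewrite leNgt; apply/negP => cpos.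
have pa : p a = f a by rewrite /p; ring.
have pb : p b = f b by rewrite /p /q; field; lra.
have ac : a < c.
  rewrite lt_neqAle (andP cab).1 andbT; apply/eqP => E; move: cpos.
  by rewrite -E FE ?lexx ?ltW // pa subrr ltxx.
have cb : c < b.
  rewrite lt_neqAle (andP cab).2 andbT; apply/eqP => E; move: cpos.
  by rewrite E FE ?lexx ?andbT ?ltW // pb subrr ltxx.
have c01 : 0 < c < 1 by rewrite (le_lt_trans a0) //= (lt_le_trans cb).
have [k k0 [r r0 hk]] := f2 c01.
pose s := Num.min (Num.min r (c - a)) (Num.min (b - c) (e / (k + 1))).
have K0 : 0 < k + 1 by rewrite ltr_wpDl.
have s0 : 0 < s by rewrite !lt_min r0 !subr_gt0 ac cb divr_gt0.
have [sr sa sb se] : [/\ s <= r, s <= c - a, s <= b - c & s <= e / (k + 1)].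
  by split; rewrite /s !ge_min lexx ?orbT.
have h2 := hk s; rewrite (ltW s0) sr in h2; have {}h2 := h2 isT.
have cs1 : a <= c + s <= b by lra.
have cs2 : a <= c - s <= b by lra.
have m1 := hc (c + s); rewrite in_itv /= in m1; have {}m1 := m1 cs1.
have m2 := hc (c - s); rewrite in_itv /= in m2; have {}m2 := m2 cs2.
rewrite (FE _ cs1) (FE c cab) in m1; rewrite (FE _ cs2) (FE c cab) in m2.
have e2 : p (c + s) + p (c - s) = 2 * p c - 2 * e * s ^+ 2 by rewrite /p; ring.
have e3 : 2 * e * s ^+ 2 <= k * s ^+ 3 by lra.
have e4 : k * s ^+ 3 <= e * s ^+ 2.
  rewrite exprS mulrA ler_wpM2r ?sqr_ge0 //.
  by move: se; rewrite ler_pdivlMr //; nra.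
have e5 : 0 < e * s ^+ 2 by rewrite mulr_gt0 // exprn_gt0.
lra.
Qed.

Lemma le_chord (a b t : R) : 0 <= a -> a < b -> b <= 1 -> a <= t <= b ->
  f t <= f a + (f b - f a) / (b - a) * (t - a).
Proof.
move=> a0 ab b1 tab; apply/ler_addgt0Pr => e e0.
apply: le_trans (le_chord_eps a0 ab b1 tab e0) _; rewrite lerD2l -mulrA.
by rewrite ler_piMr ?(ltW e0) //; nra.
Qed.

Lemma convex_of_second_difference : convex_function (`[0, 1]%classic : set R) f.
Proof.
suff lt_case (a b p : R) : 0 <= a -> b <= 1 -> a < b -> 0 <= p <= 1 ->
    f (p * a + (1 - p) * b) <= p * f a + (1 - p) * f b.
  move=> t a b /set_mem; rewrite /= in_itv /= => /andP[a0 a1].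
  move=> /set_mem; rewrite /= in_itv /= => /andP[b0 b1].
  have t01 : 0 <= (t%:num : R) <= 1 by rewrite ge0 le1.
  change (f (t%:num * a + (1 - t%:num) * b) <= t%:num * f a + (1 - t%:num) * f b).
  move: (t%:num : R) t01 => p /andP[p0 p1].
  have [ab|ba|<-] := ltgtP a b.
  - by apply: lt_case => //; rewrite p0.
  - have q01 : 0 <= 1 - p <= 1 by rewrite subr_ge0 p1 gerBl.
    have := lt_case b a (1 - p) b0 a1 ba q01.
    by rewrite subKr ![(1 - p) * _ + _]addrC.
  - by rewrite -!mulrDl addrC subrK !mul1r.
move=> a0 b1 ab /andP[p0 p1]; have tab : a <= p * a + (1 - p) * b <= b by nra.
apply: le_trans (le_chord a0 ab b1 tab) _; apply: eq_ler; field.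
by rewrite subr_eq0 gt_eqF.
Qed.

End Convexity.

Section DistanceAlongExponentials.
Variables (R : realType) (n : nat) (phi : 'M[R[i]]_n -> R).
Hypothesis hphi : unitarily_invariant_norm phi.
Local Notation C := R[i].
Local Notation aheight m := (height phi m (@asin_c R) asin_e).
Local Notation dist V := (unitary_dist phi 1%:M V).
Implicit Types (x K U V Q : 'M[C]_n) (X : R).

Definition near_identity V := V \is unitarymx /\ spectral_norm (V - 1%:M) < Num.sqrt 2.

Lemma near_identity_log V : near_identity V ->
  exists2 Q, Q \is unitarymx & exists2 t : 'I_n -> R, forall j, `|t j| < pi / 2 &
    [/\ V = Q ^t* *m cisdiag t *m Q, V = expmx (Q ^t* *m imdiag t *m Q)
      & dist V <= phi (imdiag t)].
Proof.
move=> [uV hV]; have [Q uQ [t ht e]] := spectral_norm_domain uV hV.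
have eV : V = expmx (Q ^t* *m imdiag t *m Q) by rewrite (expmx_spectral t uQ).
exists Q => //; exists t => //; split=> //.
rewrite eV; apply: le_trans (dist_expmx_le hphi (skew_conj Q (skew_imdiag t))) _.
by apply: eq_ler; exact: uin_conjV.
Qed.

Lemma near_identity_aheight_le V m : near_identity V -> aheight m V <= dist V.
Proof.
move=> /near_identity_log[Q uQ [t ht [_ -> _]]].
exact: (aheight_le_dist hphi m (skew_conj Q (skew_imdiag t))).
Qed.

Lemma near_identity_dist_le V X : near_identity V ->
  (forall m, aheight m V <= X) -> dist V <= X.
Proof.
move=> /near_identity_log[Q uQ [t ht [eV _ dV]]] hX; apply: le_trans dV _.
rewrite -(uin_conjV hphi _ uQ); apply: (uin_le_of_aheight hphi uQ ht) => m.
by rewrite -eV.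
Qed.

Lemma expmx_mul_unitary (s : R) x V : V \is unitarymx -> skew_hermitian x ->
  expmx (s%:C *: x) *m V = V *m expmx (s%:C *: (V ^t* *m x *m V)).
Proof.
move=> uV sx; have -> : s%:C *: (V ^t* *m x *m V) = V ^t* *m (s%:C *: x) *m V.
  by rewrite -scalemxAr -scalemxAl.
by rewrite (expmx_conj uV (skewZ s sx)) !mulmxA (unitary_mulmxV uV) mul1mx.
Qed.

Lemma dist_expmx_lip (s : R) x V : skew_hermitian x -> near_identity V ->
  near_identity (expmx (s%:C *: x) *m V) ->
  dist (expmx (s%:C *: x) *m V) <= dist V + phi x * `|s|.
Proof.
move=> sx nV nV'; apply: near_identity_dist_le => // m.
rewrite (expmx_mul_unitary _ nV.1 sx).
have sb := skewZ s (skew_conj V sx).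
apply: le_trans (aheight_mul_expmx hphi m nV.1 sb) _; apply: lerD.
  exact: near_identity_aheight_le.
by rewrite (uinZr hphi) (uin_conjV hphi _ nV.1) mulrC.
Qed.

Lemma dist_expmx_second_difference x V : skew_hermitian x -> near_identity V ->
  exists2 k : R, 0 <= k & exists2 e : R, 0 < e & forall s : R, 0 <= s <= e ->
  near_identity (expmx (s%:C *: x) *m V) ->
  near_identity (expmx ((- s)%:C *: x) *m V) ->
  2 * dist V <= dist (expmx (s%:C *: x) *m V) +
    dist (expmx ((- s)%:C *: x) *m V) + k * s ^+ 3.
Proof.
move=> sx nV; have [Q uQ [t ht [eV _ dV]]] := near_identity_log nV.
have [X sX hX] : exists2 X, skew_hermitian X & V ^t* *m x *m V = Q ^t* *m X *m Q.
  have := skew_conj V sx; move: (V ^t* *m x *m V) => P sP.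
  exists (Q *m P *m Q ^t*); first by have := skew_conj (Q ^t*) sP; rewrite trmxCK.
  rewrite !mulmxA (unitary_mulVmx uQ) mul1mx -mulmxA (unitary_mulVmx uQ).
  exact: (esym (mulmx1 P)).
have [k k0 [e /andP[e0 _] h]] := second_difference_ge hphi sX ht.
have conjX (s : R) : expmx (s%:C *: x) *m V =
    Q ^t* *m (cisdiag t *m expmx (s%:C *: X)) *m Q.
  rewrite (expmx_mul_unitary _ nV.1 sx).
  have -> : s%:C *: (V ^t* *m x *m V) = Q ^t* *m (s%:C *: X) *m Q.
    by rewrite hX -scalemxAr -scalemxAl.
  rewrite (expmx_conj uQ (skewZ s sX)) [X in X *m _]eV; exact: conj_unitaryM.
have le_dist (s : R) m : near_identity (expmx (s%:C *: x) *m V) ->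
    aheight m (cisdiag t *m expmx (s%:C *: X)) <= dist (expmx (s%:C *: x) *m V).
  move=> ns; apply: le_trans (near_identity_aheight_le m ns).
  rewrite conjX; apply: eq_ler; apply/esym; rewrite /height.
  exact: (uin_mpol_conj hphi _ _ _ (cisdiag t *m expmx (s%:C *: X)) uQ).
exists k => //; exists e => // s hs n1 n2.
apply: (le_trans _ (h s hs _ _ (fun m => le_dist s m n1) (fun m => le_dist _ m n2))).
apply: ler_wpM2l; [exact: ler0n | exact: dV].
Qed.

End DistanceAlongExponentials.

Theorem theorem6p7 (R : realType) (n : nat) (x y : 'M[R[i]]_n)
  (hx : skew_hermitian x) (hy : skew_hermitian y)
  (hxy : forall t : R, 0 <= t <= 1 ->
     spectral_norm (expmx (t%:C *: x) *m expmx y - 1%:M) < Num.sqrt 2)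
  (phi : 'M[R[i]]_n -> R) (hphi : unitarily_invariant_norm phi) :
  convex_function (`[0, 1]%classic : set R)
    (fun t : R => unitary_dist phi 1%:M (expmx (t%:C *: x) *m expmx y)).
Proof.
pose u (t : R) := expmx (t%:C *: x) *m expmx y.
have nu t : 0 <= t <= 1 -> near_identity (u t).
  move=> t01; split; last exact: hxy.
  exact: mul_unitarymx (expmx_unitary (skewZ t hx)) (expmx_unitary hy).
have uD t s : u (t + s) = expmx (s%:C *: x) *m u t.
  by rewrite /u addrC (expmx_scaleD _ _ hx) mulmxA.
have uB s t : u s = expmx ((s - t)%:C *: x) *m u t by rewrite -uD addrC subrK.
apply: (@convex_of_second_difference R (fun t => unitary_dist phi 1%:M (u t)) (phi x)).
- exact: (uinorm_ge0 hphi).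
- move=> s t /nu us /nu ut; rewrite (uB s t) in us *.
  exact: dist_expmx_lip.
move=> t /andP[t0 t1]; have t01 : 0 <= t <= 1 by rewrite !ltW.
have [k k0 [e e0 h]] := dist_expmx_second_difference hphi hx (nu t t01).
exists k => //; exists (Num.min e (Num.min t (1 - t))).
  by rewrite !lt_min e0 t0 subr_gt0.
move=> s /andP[s0]; rewrite !le_min => /and3P[se st s1t].
have n1 : near_identity (u (t + s)) by apply: nu; lra.
have n2 : near_identity (u (t - s)) by apply: nu; lra.
have hs : 0 <= s <= e by rewrite s0.
rewrite !uD in n1 n2 *; exact: h.
Qed.
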